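(* Let $K$ be a simplicial complex on $[m]$. There is an isomorphism of $\mathcal A$-modules $$\widetilde H^*(\mathcal Z_K)\;\cong\;\bigoplus_{J\subseteq[m],\,J\notin K}\Sigma^{|J|+1}\,\widetilde H^*(K_J).$$
   Context: $H^*(-)$ denotes cohomology with $\mathbb F_2$ coefficients, $\widetilde H^*$ reduced cohomology, and $\mathcal A$ is the mod 2 Steenrod algebra. A simplicial complex on $[m]=\{1,\dots,m\}$ is a collection of subsets of $[m]$, closed under taking subsets and containing $\emptyset$, with vertices labelled by $[m]$; cohomology of a simplicial complex means that of its geometric realization. For $J\subseteq[m]$, $K_J$ is the full subcomplex of $K$ on $J$. The moment-angle complex is $\mathcal Z_K=(D^2,S^1)^K=\bigcup_{\sigma\in K}\prod_{i=1}^mY_i^\sigma\subseteq(D^2)^m$ with $Y_i^\sigma=D^2$ if $i\in\sigma$ and $Y_i^\sigma=S^1$ if $i\notin\sigma$. For a graded module $M$, $(\Sigma M)^n=M^{n-1}$, and the Steenrod operations commute with $\Sigma$. *)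

(* Defs.v *)
From HB Require Import structures.
From mathcomp Require Import all_boot all_order all_algebra.
From mathcomp Require Import generic_quotient.
From mathcomp Require Import zify.
From mathcomp Require Import all_classical all_reals all_analysis.
Import Order.TTheory GRing.Theory Num.Theory.
Import numFieldNormedType.Exports.

Set Implicit Arguments.
Unset Strict Implicit.
Unset Printing Implicit Defensive.

Local Open Scope ring_scope.

Lemma mulmxr_continuous (R : realType) (p n : nat) (M : 'M[R]_(p, n)) :
  continuous (fun t : 'rV[R]_p => t *m M).
Proof.
move=> t A [P HP HA]; apply: (filterS (P := fun s : 'rV[R]_p =>
  forall ij : 'I_1 * 'I_n, P ij.1 ij.2 ((s *m M) ij.1 ij.2))).
  by move=> s Hs; apply: HA => i j; exact: (Hs (i, j)).
apply: (@filter_forall _ _ (fun ij (s : 'rV[R]_p) =>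
  P ij.1 ij.2 ((s *m M) ij.1 ij.2)) (nbhs t)) => -[i j] /=.
suff : ((fun s : 'rV[R]_p => (s *m M) i j) @ t --> (t *m M) i j)%classic.
  by move=> h; exact: (h (P i j) (HP i j)).
have -> : (fun s : 'rV[R]_p => (s *m M) i j) =
    (fun s => \sum_k s i k * M k j) by apply/funext => s; rewrite mxE.
rewrite mxE; move: t {A P HP HA}.
have add_cont : continuous (fun x : R * R => x.1 + x.2).
  exact: add_continuous.
apply: (continuous_big add_cont) => k _ s.
apply: cvgMr_tmp; first exact: (nbhs_filter s).
exact: coord_continuous.
Qed.

(* Simplices and cochains are indexed by their number N of vertices, that is,
   N stands for degree N - 1.  The standard simplex with N = 0 vertices is
   empty, hence every space X, even the empty one, has exactly one singular
   simplex on 0 vertices: the cochains indexed by N : nat form the augmented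
   singular cochain complex, whose cohomology is reduced cohomology (with
   F_2 in degree -1 when X is empty). *)
Definition stdsimplex (R : realType) (N : nat) : set 'rV[R]_N :=
  [set t : 'rV[R]_N | (forall i, 0 <= t 0 i) /\ \sum_i t 0 i = 1]%classic.
Arguments stdsimplex R N : clear implicits.

Definition vertex_mx (R : realType) (p n : nat) (th : 'I_p -> 'I_n)
  : 'M[R]_(p, n) := \matrix_(j, i) (th j == i)%:R.
Arguments vertex_mx R {p n} th.

Lemma stdsimplex_mul (R : realType) (p n : nat) (th : 'I_p -> 'I_n)
  (t : 'rV[R]_p) :
  t \in stdsimplex R p -> t *m vertex_mx R th \in stdsimplex R n.
Proof.
rewrite !inE => -[t0 t1]; split=> [i|].
  rewrite mxE; apply: sumr_ge0 => j _; rewrite mulr_ge0 // mxE; exact: ler0n.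
under eq_bigr do rewrite mxE.
rewrite exchange_big -[RHS]t1 /=; apply: eq_bigr => j _.
rewrite (bigD1 (th j)) //= !mxE eqxx mulr1 big1 ?addr0 // => i ij.
by rewrite mxE eq_sym (negbTE ij) mulr0.
Qed.

Definition stdmap (R : realType) (p n : nat) (th : 'I_p -> 'I_n)
    (t : stdsimplex R p) : stdsimplex R n :=
  exist _ (val t *m vertex_mx R th) (stdsimplex_mul th (valP t)).

Lemma stdmap_continuous (R : realType) (p n : nat) (th : 'I_p -> 'I_n) :
  continuous (@stdmap R p n th).
Proof.
apply: continuous_comp_initial => t.
apply: (@continuous_comp _ _ _ (val : stdsimplex R p -> 'rV[R]_p)
  (fun s => s *m vertex_mx R th)).
  exact: initial_continuous.
exact: mulmxr_continuous.
Qed.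

HB.instance Definition _ (R : realType) (p n : nat) (th : 'I_p -> 'I_n) :=
  isContinuous.Build _ _ (@stdmap R p n th) (@stdmap_continuous R p n th).

Definition simplex (R : realType) (X : topologicalType) (N : nat) : Type :=
  continuousType (stdsimplex R N) X.

Definition sface (R : realType) (X : topologicalType) (p n : nat)
  (th : 'I_p -> 'I_n) (s : simplex R X n) : simplex R X p :=
  s \o @stdmap R p n th.


Lemma sface_comp (R : realType) (X : topologicalType) (p q n : nat)
    (la : 'I_p -> 'I_q) (th : 'I_q -> 'I_n) (s : simplex R X n) :
  sface la (sface th s) = sface (th \o la) s.
Proof.
apply/continuousEP => t /=; congr (s _); apply: val_inj => /=.
rewrite -mulmxA; congr (_ *m _); apply/matrixP => j i; rewrite !mxE.
rewrite (bigD1 (la j)) //= !mxE eqxx mul1r big1 ?addr0 // => k kj.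
by rewrite mxE eq_sym (negbTE kj) mul0r.
Qed.

Definition cochain (R : realType) (X : topologicalType) (N : nat) : Type :=
  simplex R X N -> ('F_2)^o.

HB.instance Definition _ (R : realType) (X : topologicalType) (N : nat) :=
  GRing.Lmodule.copy (cochain R X N) (simplex R X N -> ('F_2)^o).

Definition codiff (R : realType) (X : topologicalType) (N : nat)
    (f : cochain R X N) : cochain R X N.+1 :=
  fun s => \sum_(i < N.+1) f (sface (lift i) s).

Definition increasing (p n : nat) (th : 'I_p -> 'I_n) : bool :=
  [forall i : 'I_p, forall j : 'I_p, (i < j)%N ==> (th i < th j)%N].

(* The value of f on the face of s spanned by the vertices in S: the sum has
   exactly one term if #|S| = p, and none otherwise. *)
Definition onface (R : realType) (X : topologicalType) (p n : nat)
    (f : cochain R X p) (s : simplex R X n) (S : {set 'I_n}) : 'F_2 :=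
  \sum_(th : {ffun 'I_p -> 'I_n} | increasing th && (th @: 'I_p == S)%SET)
    f (sface th s).

(* A set A = {a_0 < ... < a_i} of vertices cuts 0, ..., n - 1 into i + 2
   consecutive intervals overlapping at the a_j; evens A (resp. odds A) is the
   union of those of even (resp. odd) rank. *)
Definition nbelow (n : nat) (A : {set 'I_n}) (u : 'I_n) : nat :=
  #|[set a in A | (a < u)%N]%SET|.

Definition evens (n : nat) (A : {set 'I_n}) : {set 'I_n} :=
  [set u | (u \in A) || ~~ odd (nbelow A u)]%SET.

Definition odds (n : nat) (A : {set 'I_n}) : {set 'I_n} :=
  [set u | (u \in A) || odd (nbelow A u)]%SET.

(* Steenrod's cup-i product of f and g, evaluated on a simplex s with n
   vertices.  A term is nonzero only if #|evens A| = p and #|odds A| = q, in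
   which case #|A| = p + q - n since evens A and odds A cover all the vertices
   and meet in A.  So the sum runs in effect over the A with i + 1 elements,
   i = p + q - n - 1 being determined by n; i = 0 is the Alexander-Whitney
   product.  In particular, for f of degree d = p - 1, the cochain cup f f
   of degree d + k = n - 1 is the cup-(d - k) square of f, i.e. the standard
   cochain representative of Sq^k [f]. *)
Definition cup (R : realType) (X : topologicalType) (p q n : nat)
    (f : cochain R X p) (g : cochain R X q) : cochain R X n :=
  fun s => \sum_(A : {set 'I_n}) onface f s (evens A) * onface g s (odds A).

Lemma addF2 (x : 'F_2) : x + x = 0.
Proof. by rewrite addrr_pchar2 // pchar_Fp. Qed.

Lemma increasingP (p n : nat) (th : 'I_p -> 'I_n) :
  reflect (forall i j : 'I_p, (i < j)%N -> (th i < th j)%N) (increasing th).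
Proof.
rewrite /increasing; apply: (iffP forallP) => h i.
  by move=> j; have /forallP/(_ j)/implyP := h i.
by apply/forallP => j; apply/implyP; exact: h.
Qed.

Lemma increasing_inj (p n : nat) (th : 'I_p -> 'I_n) :
  increasing th -> injective th.
Proof.
move=> /increasingP h i j e; case: (ltngtP i j) => [ij|ij|/ord_inj //].
  by have := h i j ij; rewrite e ltnn.
by have := h j i ij; rewrite e ltnn.
Qed.

Lemma increasing_comp (p q n : nat) (la : 'I_p -> 'I_q) (th : 'I_q -> 'I_n) :
  increasing la -> increasing th -> increasing (th \o la).
Proof.
by move=> /increasingP h /increasingP k; apply/increasingP => i j /h /k.
Qed.

Lemma increasing_lift (n : nat) (i : 'I_n.+1) : @increasing n n.+1 (lift i).
Proof.
apply/increasingP => j k jk; rewrite /= /bump.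
by case: (leqP i j) => ij; case: (leqP i k) => ik; rewrite ?add1n ?add0n; lia.
Qed.

Lemma increasing_eq (p n : nat) (th et : {ffun 'I_p -> 'I_n}) :
  increasing th -> increasing et -> (th @: 'I_p = et @: 'I_p)%SET -> th = et.
Proof.
move=> h k e.
have key (a b : {ffun 'I_p -> 'I_n}) : increasing a -> increasing b ->
    (b @: 'I_p = a @: 'I_p)%SET -> 
    forall j : 'I_p, (forall i : 'I_p, (i < j)%N -> a i = b i) ->
    (a j <= b j)%N.
  move=> ha hb ab j IH.
  have : b j \in (a @: 'I_p)%SET by rewrite -ab imset_f.
  case/imsetP => i _ bi; rewrite bi; case: (ltngtP i j) => ij.
  - by have ib := IH i ij; have := increasing_inj hb (etrans bi ib) => ji;
    rewrite ji ltnn in ij.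
  - by apply: ltnW; move/increasingP: ha; exact.
  - by rewrite (ord_inj ij).
have main : forall m (j : 'I_p), (j < m)%N -> th j = et j.
  elim=> // m IH j jm; apply: ord_inj; apply/eqP; rewrite eqn_leq.
  have IH' (i : 'I_p) : (i < j)%N -> th i = et i by move=> ij; apply: IH; lia.
  by rewrite !key // => i ij; rewrite IH'.
by apply/ffunP => j; exact: (main p).
Qed.

Lemma increasing_ex (n : nat) (S : {set 'I_n}) (p : nat) : #|S| = p ->
  exists2 th : {ffun 'I_p -> 'I_n}, increasing th & (th @: 'I_p = S)%SET.
Proof.
move=> <-; exists [ffun i => enum_val i].
  apply/increasingP => i j ij; rewrite !ffunE.
  have n0 : 'I_n by exact: (enum_val i).
  rewrite !(enum_val_nth n0).
  have srt : sorted (fun x y : 'I_n => (x < y)%N) (enum S).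
    rewrite /enum_mem; apply: sorted_filter.
      by move=> x y z; exact: ltn_trans.
    by have := iota_ltn_sorted 0 n; rewrite -val_enum_ord sorted_map enumT.
  apply: (sorted_ltn_nth _ _ srt) => //; rewrite ?inE -?cardE //.
  by move=> x y z; exact: ltn_trans.
apply/setP => u; apply/imsetP/idP => [[i _ ->]|uS].
  by rewrite ffunE enum_valP.
by exists (enum_rank_in uS u) => //; rewrite ffunE enum_rankK_in.
Qed.

Lemma sum_lift (n : nat) (v : 'I_n.+1) (T : {set 'I_n.+1} -> 'F_2) :
  \sum_(A : {set 'I_n}) T (lift v @: A)%SET =
  \sum_(B : {set 'I_n.+1} | v \notin B) T B.
Proof.
rewrite [RHS](reindex_onto (fun A : {set 'I_n} => (lift v @: A)%SET)
  (fun B : {set 'I_n.+1} => (lift v @^-1: B)%SET)) /=; last first.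
  move=> B vB; apply/setP => x; apply/imsetP/idP => [[y]|xB].
    by rewrite inE => yB ->.
  case: (unliftP v x) => [y xy|xv]; last by rewrite xv (negbTE vB) in xB.
  by exists y => //; rewrite inE -xy.
apply: eq_bigl => A; apply/esym/andP; split.
  by apply/imsetP => -[y _ /eqP]; rewrite (negbTE (neq_lift _ _)).
by apply/eqP/setP => x; rewrite inE mem_imset //; exact: lift_inj.
Qed.

Lemma ltn_lift (n : nat) (v : 'I_n.+1) (a b : 'I_n) :
  (lift v a < lift v b)%N = (a < b)%N.
Proof. by rewrite /= !ltnNge leq_bump2. Qed.

Lemma nbelow_lift (n : nat) (v : 'I_n.+1) (A : {set 'I_n}) (u : 'I_n) :
  nbelow (lift v @: A)%SET (lift v u) = nbelow A u.
Proof.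
rewrite /nbelow -[RHS](card_imset _ (@lift_inj _ v)); congr #|pred_of_set _|.
apply/setP => x; rewrite inE; apply/andP/imsetP => [[/imsetP[y yA ->] l]|].
  by exists y => //; rewrite inE yA; rewrite ltn_lift in l.
case=> y; rewrite inE => /andP[yA yu] ->; split; first exact: imset_f.
by rewrite ltn_lift.
Qed.

Lemma evens_lift (n : nat) (v : 'I_n.+1) (A : {set 'I_n}) :
  (lift v @: evens A = evens (lift v @: A) :\ v)%SET.
Proof.
apply/setP => x; rewrite !inE; case: (unliftP v x) => [y ->|->].
  rewrite mem_imset; last exact: lift_inj.
  rewrite inE nbelow_lift mem_imset; last exact: lift_inj.
  by rewrite eq_sym neq_lift.
by rewrite eqxx /=; apply/imsetP => -[y _ /eqP]; rewrite (negbTE (neq_lift _ _)).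
Qed.

Lemma odds_lift (n : nat) (v : 'I_n.+1) (A : {set 'I_n}) :
  (lift v @: odds A = odds (lift v @: A) :\ v)%SET.
Proof.
apply/setP => x; rewrite !inE; case: (unliftP v x) => [y ->|->].
  rewrite mem_imset; last exact: lift_inj.
  rewrite inE nbelow_lift mem_imset; last exact: lift_inj.
  by rewrite eq_sym neq_lift.
by rewrite eqxx /=; apply/imsetP => -[y _ /eqP]; rewrite (negbTE (neq_lift _ _)).
Qed.

Lemma telescopeF2 (P : nat -> 'F_2) (N : nat) :
  \sum_(v < N) (P v + P v.+1) = P 0 + P N.
Proof.
elim: N => [|N IH]; first by rewrite big_ord0 addF2.
by rewrite big_ord_recr /= IH addrA -(addrA (P 0)) addF2 addr0.
Qed.

Section CupFormula.
Variables (N : nat) (F G : {set 'I_N} -> 'F_2).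
Implicit Types A B : {set 'I_N}.

(* evens A and odds A with roles exchanged from vertex c on *)
Let cutl A (c : nat) : {set 'I_N} :=
  [set u | (u \in A) || (odd (nbelow A u) == (c <= u)%N)]%SET.
Let cutr A (c : nat) : {set 'I_N} :=
  [set u | (u \in A) || (odd (nbelow A u) != (c <= u)%N)]%SET.

Lemma nbelow_setU1 (v : 'I_N) A (u : 'I_N) : v \notin A ->
  nbelow (v |: A)%SET u = (nbelow A u + (v < u))%N.
Proof.
move=> vA; rewrite /nbelow.
have -> : [set a in (v |: A) | (a < u)%N]%SET =
   if (v < u)%N then (v |: [set a in A | (a < u)%N])%SET
   else [set a in A | (a < u)%N]%SET.
  apply/setP => x; case: ifP => vu; rewrite !inE; case: eqVneq => //= ->.
    by rewrite vu.
  by rewrite vu andbF.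
case: ifP => vu; last by rewrite addn0.
by rewrite cardsU1 inE (negbTE vA) /= addnC.
Qed.

Lemma cut_step (v : 'I_N) A : v \notin A ->
  F (evens (v |: A) :\ v)%SET * G (odds (v |: A)%SET) +
  F (evens (v |: A)%SET) * G (odds (v |: A) :\ v)%SET =
  F (cutl A v) * G (cutr A v) + F (cutl A v.+1) * G (cutr A v.+1).
Proof.
move=> vA.
have E u : (u \in evens (v |: A)%SET) =
    [|| u == v, u \in A | ~~ odd (nbelow A u + (v < u))].
  by rewrite !inE nbelow_setU1 // orbA.
have O u : (u \in odds (v |: A)%SET) =
    [|| u == v, u \in A | odd (nbelow A u + (v < u))].
  by rewrite !inE nbelow_setU1 // orbA.
have lt_v (u : 'I_N) : u != v -> (v <= u)%N = (v < u)%N.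
  by move=> uv; rewrite leq_eqVlt [X in X || _](_ : _ = false) //;
     apply/negbTE; rewrite eq_sym.
have lt_vv (u : 'I_N) : (v.+1 <= u)%N = (v < u)%N by [].
have cl u c : (u \in cutl A c) = (u \in A) || (odd (nbelow A u) == (c <= u)%N).
  by rewrite inE.
have cr u c : (u \in cutr A c) = (u \in A) || (odd (nbelow A u) != (c <= u)%N).
  by rewrite inE.
case ov: (odd (nbelow A v)); first rewrite [RHS]addrC;
  congr (F _ * G _ + F _ * G _); apply/setP => u;
  rewrite ?in_setD1 ?E ?O ?cl ?cr;
  case: (eqVneq u v) => [->|uv] /=;
  rewrite ?leqnn ?ltnn ?(negbTE vA) ?ov //= ?lt_v // ?oddD ?oddb;
  by case: (u \in A) => //; case: (odd _) => //; case: (v < u)%N.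
Qed.

Let tele A : \sum_(v < N) (F (cutl A v) * G (cutr A v) +
    F (cutl A v.+1) * G (cutr A v.+1)) =
  F (odds A) * G (evens A) + F (evens A) * G (odds A).
Proof.
rewrite (telescopeF2 (fun c => F (cutl A c) * G (cutr A c))).
congr (F _ * G _ + F _ * G _); apply/setP => u; rewrite !inE.
- by case: (odd _).
- by case: (odd _).
- by rewrite leqNgt ltn_ord; case: (odd _).
- by rewrite leqNgt ltn_ord; case: (odd _).
Qed.

Lemma cup_swap :
  \sum_(A : {set 'I_N}) \sum_(v in A) (F (evens A :\ v)%SET * G (odds A) +
                        F (evens A) * G (odds A :\ v)%SET) =
  \sum_(A : {set 'I_N}) (F (odds A) * G (evens A) + F (evens A) * G (odds A)).
Proof.
rewrite (exchange_big_dep predT) //=.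
transitivity (\sum_(v < N) \sum_(A : {set 'I_N} | v \notin A)
   (F (cutl A v) * G (cutr A v) + F (cutl A v.+1) * G (cutr A v.+1))).
  apply: eq_bigr => v _.
  rewrite (reindex_onto (fun A => v |: A)%SET (fun A => A :\ v)%SET) /=; last first.
    by move=> A vA; exact: finset.setD1K.
  apply: eq_big => [A|A /andP[_ /eqP eA]].
    rewrite finset.setU11 /=; apply/eqP/idP => [<-|vA]; first by rewrite !inE eqxx.
    by rewrite finset.setU1K.
  by apply: cut_step; rewrite -eA !inE eqxx.
rewrite (exchange_big_dep predT) //=; apply: eq_bigr => A _.
rewrite -tele [RHS](bigID (fun v => v \notin A)) /= [X in _ + X]big1 ?addr0 //.
move=> v; rewrite negbK => vA; rewrite [X in X + _](_ : _ =
  F (cutl A v.+1) * G (cutr A v.+1)) ?addF2 //.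
congr (F _ * G _); apply/setP => u; rewrite !inE; case: (eqVneq u v) => [->|uv];
  rewrite ?vA //; congr (_ || _); rewrite [(v <= u)%N]leq_eqVlt;
  rewrite [X in X || _](_ : _ = false) //; apply/negbTE; rewrite eq_sym //.
Qed.

End CupFormula.

Lemma cup_boundary (n : nat) (F G : {set 'I_n.+1} -> 'F_2) :
  \sum_(v < n.+1) \sum_(A : {set 'I_n})
     F (lift v @: evens A)%SET * G (lift v @: odds A)%SET =
  \sum_(A : {set 'I_n.+1})
    ((\sum_(v in evens A) F (evens A :\ v)%SET) * G (odds A) +
     F (evens A) * (\sum_(v in odds A) G (odds A :\ v)%SET) +
     F (evens A) * G (odds A) + F (odds A) * G (evens A)).
Proof.
transitivity (\sum_(A : {set 'I_n.+1}) \sum_(v < n.+1 | v \notin A)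
   F (evens A :\ v)%SET * G (odds A :\ v)%SET).
  rewrite [RHS](exchange_big_dep predT) //=; apply: eq_bigr => v _.
  rewrite -sum_lift; apply: eq_bigr => A _.
  by rewrite evens_lift odds_lift.
transitivity (\sum_(A : {set 'I_n.+1})
    ((\sum_(v in evens A) F (evens A :\ v)%SET) * G (odds A) +
     F (evens A) * (\sum_(v in odds A) G (odds A :\ v)%SET)) +
   \sum_(A : {set 'I_n.+1}) \sum_(v in A) (F (evens A :\ v)%SET * G (odds A) +
                        F (evens A) * G (odds A :\ v)%SET)); last first.
  rewrite cup_swap -big_split /=; apply: eq_bigr => A _.
  by rewrite -[RHS]addrA [X in _ = _ + X]addrC.
rewrite -big_split; apply: eq_bigr => A _ /=.
have subE : {subset A <= evens A} by move=> v vA; rewrite inE vA.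
have subO : {subset A <= odds A} by move=> v vA; rewrite inE vA.
have split (H : {set 'I_n.+1} -> 'F_2) (S : {set 'I_n.+1}) :
    {subset A <= S} -> \sum_(v in S) H (S :\ v)%SET =
    \sum_(v in A) H (S :\ v)%SET + \sum_(v in S | v \notin A) H (S :\ v)%SET.
  move=> AS; rewrite (bigID (fun v => v \in A)) /=; congr (_ + _).
  by apply: eq_bigl => v; case vA: (v \in A); rewrite ?andbF // AS.
rewrite (split F _ subE) (split G _ subO) mulrDl mulrDr.
rewrite big_split /= -mulr_suml -mulr_sumr.
set a := _ * G (odds A); set b := (\sum_(i in evens A | _) _) * _.
set c := F (evens A) * _; set d := F (evens A) * _.
have -> : a + b + (c + d) + (a + c) = b + d.
  by rewrite [X in X + _]addrACA [LHS]addrC addrA addF2 add0r.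
rewrite /b /d mulr_suml mulr_sumr [in X in X + _]big_mkcond.
rewrite [in X in _ + X]big_mkcond -big_split [LHS]big_mkcond /=.
apply: eq_bigr => v _; case vA: (v \in A); rewrite /= ?andbF ?addr0 //.
rewrite !andbT !inE vA /=; case ov: (odd _); rewrite /= ?add0r ?addr0;
  congr (F _ * G _); apply/setP => u; rewrite in_setD1; case: eqVneq => //= ->;
  by rewrite !inE vA ov.
Qed.

Section Faces.
Variables (R : realType) (X : topologicalType).

Lemma onface_image (p n : nat) (f : cochain R X p) (s : simplex R X n)
    (th : 'I_p -> 'I_n) : increasing th ->
  onface f s (th @: 'I_p)%SET = f (sface th s).
Proof.
move=> h; have eth : finfun th =1 th by move=> i; rewrite ffunE.
have hf : increasing (finfun th).
  by apply/increasingP => i j ij; rewrite !ffunE; move/increasingP: h; exact.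
have im : (finfun th @: 'I_p = th @: 'I_p)%SET by exact: eq_imset.
rewrite /onface (big_pred1 (finfun th)) => [|et].
  by congr (f (sface _ s)); apply/funext.
apply/andP/eqP => [[k /eqP e]|->]; last by rewrite im.
by apply: increasing_eq => //; rewrite im.
Qed.

Lemma onface_card (p n : nat) (f : cochain R X p) (s : simplex R X n)
    (S : {set 'I_n}) : #|S| != p -> onface f s S = 0.
Proof.
move=> Sp; rewrite /onface big_pred0 // => th; apply/negP => /andP[h /eqP e].
by move: Sp; rewrite -e card_imset ?card_ord ?eqxx //; exact: increasing_inj.
Qed.

Lemma onface_lift (p n : nat) (f : cochain R X p) (s : simplex R X n.+1)
    (v : 'I_n.+1) (S : {set 'I_n}) :
  onface f (sface (lift v) s) S = onface f s (lift v @: S)%SET.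
Proof.
case: (eqVneq #|S| p) => [/increasing_ex[th h <-]|Sp]; last first.
  by rewrite !onface_card // card_imset //; exact: lift_inj.
rewrite onface_image // sface_comp -imset_comp onface_image //.
by apply: increasing_comp => //; exact: increasing_lift.
Qed.

Lemma onface_codiff (p n : nat) (f : cochain R X p) (s : simplex R X n)
    (S : {set 'I_n}) :
  onface (codiff f) s S = \sum_(v in S) onface f s (S :\ v)%SET.
Proof.
case: (eqVneq #|S| p.+1) => [/increasing_ex[th h <-]|Sp]; last first.
  rewrite onface_card // big1 // => v vS; rewrite onface_card //.
  by apply: contra_neq Sp => <-; rewrite (cardsD1 v S) vS.
rewrite onface_image // big_imset /=; last first.
  by move=> i j _ _; exact: increasing_inj.
apply: eq_bigr => i _; rewrite sface_comp -onface_image; last first.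
  by apply: increasing_comp => //; exact: increasing_lift.
congr (onface f s _); rewrite imset_comp; apply/setP => u; rewrite !inE.
apply/imsetP/andP => [[k /imsetP[j _ ->] ->]|[ui /imsetP[k _ uk]]].
  split; last exact: imset_f.
  apply/negP => /eqP/(increasing_inj h)/eqP.
  by rewrite eq_sym (negbTE (neq_lift _ _)).
exists k => //; apply/imsetP; case: (unliftP i k) => [j ->|ki]; first by exists j.
by move: ui; rewrite uk ki eqxx.
Qed.

(* Steenrod's coboundary formula: cup on the right is, in terms of degrees,
   cup-i in the first two terms and cup-(i - 1) in the last two ones. *)
Lemma codiff_cup (p q n : nat) (f : cochain R X p) (g : cochain R X q) :
  codiff (cup f g : cochain R X n) =
  cup (codiff f) g + cup f (codiff g) + cup f g + cup g f.
Proof.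
apply/funext => s.
rewrite /codiff {1}/cup.
under eq_bigr => v _.
  under eq_bigr => A _ do rewrite !onface_lift.
  over.
rewrite (cup_boundary (onface f s) (onface g s)) -[RHS]/(cup (codiff f) g s +
  cup f (codiff g) s + cup f g s + cup g f s) /cup -!big_split /=.
apply: eq_bigr => A _; rewrite !onface_codiff.
by congr (_ + _); rewrite mulrC.
Qed.

Lemma cupDl (p q n : nat) (f f' : cochain R X p) (g : cochain R X q) :
  cup (f + f') g = cup f g + cup f' g :> cochain R X n.
Proof.
apply/funext => s; rewrite -[RHS]/(cup f g s + cup f' g s) /cup -big_split /=.
by apply: eq_bigr => A _; rewrite -mulrDl /onface big_split.
Qed.

Lemma cupDr (p q n : nat) (f : cochain R X p) (g g' : cochain R X q) :
  cup f (g + g') = cup f g + cup f g' :> cochain R X n.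
Proof.
apply/funext => s; rewrite -[RHS]/(cup f g s + cup f g' s) /cup -big_split /=.
by apply: eq_bigr => A _; rewrite -mulrDr /onface big_split.
Qed.

Lemma cup0l (p q n : nat) (g : cochain R X q) :
  cup (0 : cochain R X p) g = 0 :> cochain R X n.
Proof.
by apply/funext => s; rewrite /cup big1 // => A _; rewrite {1}/onface big1 // mul0r.
Qed.

Lemma cup0r (p q n : nat) (f : cochain R X p) :
  cup f (0 : cochain R X q) = 0 :> cochain R X n.
Proof.
apply/funext => s; rewrite /cup big1 // => A _.
by rewrite {2}/onface [X in _ * X]big1 // mulr0.
Qed.

Lemma addcF2 (n : nat) (f : cochain R X n) : f + f = 0.
Proof. by apply/funext => s; exact: addF2. Qed.

Lemma codiff_is_linear (n : nat) : linear (@codiff R X n).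
Proof.
move=> k f g; apply/funext => s.
rewrite -[RHS]/(k * codiff f s + codiff g s) /codiff mulr_sumr -big_split.
by [].
Qed.

HB.instance Definition _ (n : nat) :=
  GRing.isLinear.Build _ _ _ _ (@codiff R X n) (@codiff_is_linear n).

End Faces.

Section LmodQuotient.
Variables (K : pzRingType) (V : lmodType K) (B : submodClosed V).

Definition subspace_pred : {pred V} := B.

Fact subspace_pred_submod : submod_closed subspace_pred.
Proof. by split=> [|a u v uB vB]; rewrite ?rpred0 // rpredD // rpredZ. Qed.

HB.instance Definition _ :=
  GRing.isSubmodClosed.Build _ _ subspace_pred subspace_pred_submod.

Definition lquot : Type := Quotient.quot subspace_pred.

HB.instance Definition _ :=
  GRing.Zmodule.copy lquot (Quotient.quot subspace_pred).

Definition lquot_pi (x : V) : lquot :=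
  (\pi_(Quotient.quot subspace_pred) x)%qT.
Definition lquot_repr (x : lquot) : V :=
  repr (x : Quotient.quot subspace_pred).

Lemma lquot_reprK : cancel lquot_repr lquot_pi.
Proof. by move=> x; exact: reprK. Qed.

Lemma lquot_piP (x y : V) : reflect (lquot_pi x = lquot_pi y) (x - y \in B).
Proof.
have -> : (x - y \in B) = (lquot_pi x == lquot_pi y); last exact: eqP.
exact: (@Quotient.idealrBE V subspace_pred x y).
Qed.

Lemma lquot_piD : {morph lquot_pi : x y / x + y}.
Proof.
move=> x y.
exact: (raddfD (\pi_(Quotient.quot subspace_pred)%qT : {additive V -> _})).
Qed.

Definition lquot_scale (a : K) (x : lquot) : lquot :=
  lquot_pi (a *: lquot_repr x).

Lemma lquot_piZ a (x : V) : lquot_pi (a *: x) = lquot_scale a (lquot_pi x).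
Proof.
apply/lquot_piP; rewrite -scalerBr; apply: rpredZ.
by apply/lquot_piP; rewrite lquot_reprK.
Qed.

Fact lquot_scaleA a b v : lquot_scale a (lquot_scale b v) = lquot_scale (a * b) v.
Proof. by rewrite -[v]lquot_reprK -!lquot_piZ scalerA. Qed.
Fact lquot_scale1 : left_id 1 lquot_scale.
Proof. by move=> v; rewrite -[v]lquot_reprK -lquot_piZ scale1r. Qed.
Fact lquot_scaleDr : right_distributive lquot_scale +%R.
Proof.
move=> a u v; rewrite -[u]lquot_reprK -[v]lquot_reprK -lquot_piD -!lquot_piZ.
by rewrite scalerDr lquot_piD.
Qed.
Fact lquot_scaleDl v : {morph lquot_scale^~ v : a b / a + b}.
Proof.
by move=> a b; rewrite -[v]lquot_reprK -!lquot_piZ -lquot_piD scalerDl.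
Qed.

HB.instance Definition _ := GRing.Zmodule_isLmodule.Build K lquot
  lquot_scaleA lquot_scale1 lquot_scaleDr lquot_scaleDl.

End LmodQuotient.

Section Cohomology.
Variables (R : realType) (X : topologicalType).

Definition cocycle (N : nat) : {pred cochain R X N} :=
  fun f => codiff f == 0.

Fact cocycle_submod (N : nat) : submod_closed (@cocycle N).
Proof.
split=> [|k f g]; rewrite !unfold_in ?linear0 // => /eqP f0 /eqP g0.
by rewrite codiff_is_linear f0 g0 scaler0 addr0.
Qed.

HB.instance Definition _ (N : nat) :=
  GRing.isSubmodClosed.Build _ _ (@cocycle N) (@cocycle_submod N).

Record cocycles (N : nat) : Type :=
  Cocycle { cocycle_val :> cochain R X N; _ : cocycle_val \in @cocycle N }.

HB.instance Definition _ (N : nat) := [isSub for @cocycle_val N].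
HB.instance Definition _ (N : nat) := [Choice of cocycles N by <:].
HB.instance Definition _ (N : nat) :=
  [SubChoice_isSubLmodule of cocycles N by <:].

Definition is_coboundary (N : nat) : cochain R X N -> Prop :=
  match N with
  | 0 => fun f => f = 0
  | M.+1 => fun f => exists g : cochain R X M, f = codiff g
  end.

Definition coboundary (N : nat) : {pred cocycles N} :=
  fun z => `[< is_coboundary (cocycle_val z) >].

Fact coboundary_submod (N : nat) : submod_closed (@coboundary N).
Proof.
split=> [|k f g]; rewrite !unfold_in.
  apply/asboolP; case: N => [|N] //=; by exists 0; rewrite linear0.
move=> /asboolP hf /asboolP hg; apply/asboolP.
case: N f g hf hg => [|N] f g /=; first by move=> -> ->; rewrite scaler0 addr0.
by case=> a -> [b ->]; exists (k *: a + b); rewrite linearP.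
Qed.

HB.instance Definition _ (N : nat) :=
  GRing.isSubmodClosed.Build _ _ (@coboundary N) (@coboundary_submod N).

Definition cohomology (N : nat) : lmodType 'F_2 := lquot (@coboundary N).

Fact cup_cocycle (p n : nat) (z : cocycles p) :
  (cup z z : cochain R X n) \in @cocycle n.
Proof.
case: z => z /= /eqP z0; apply/eqP.
by rewrite codiff_cup z0 cup0l cup0r add0r add0r addcF2.
Qed.

Definition cocycle_sq (p n : nat) (z : cocycles p) : cocycles n :=
  Cocycle (cup_cocycle n z).

Definition coh_sq (p n : nat) (x : cohomology p) : cohomology n :=
  lquot_pi _ (cocycle_sq n (lquot_repr x)).

Lemma codiffD (N : nat) (f g : cochain R X N) :
  codiff (f + g) = codiff f + codiff g.
Proof. by rewrite -[f in LHS]scale1r codiff_is_linear scale1r. Qed.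

Lemma is_coboundaryD (N : nat) (f g : cochain R X N) :
  is_coboundary f -> is_coboundary g -> is_coboundary (f + g).
Proof.
case: N f g => [|N] f g /=; first by move=> -> ->; rewrite addr0.
by case=> a -> [b ->]; exists (a + b); rewrite linearD.
Qed.

Lemma cup_comm (p n : nat) (y z : cocycles p) :
  is_coboundary (cup y z + cup z y : cochain R X n).
Proof.
case: n => [|n] /=.
  apply/funext => s; rewrite -[LHS]/(cup y z s + cup z y s) /cup -big_split /=.
  apply: big1 => A _.
  have -> : odds A = evens A by apply/setP => -[].
  by rewrite [X in _ + X]mulrC addF2.
exists (cup y z); rewrite codiff_cup.
case: y z => y /= /eqP y0 [z /= /eqP z0].
by rewrite y0 z0 cup0l cup0r !add0r.
Qed.

Lemma cup_cobound (p n : nat) (z : cochain R X p) :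
  is_coboundary z -> codiff z = 0 -> is_coboundary (cup z z : cochain R X n).
Proof.
case: p z => [|p] z /=.
  move=> -> _; rewrite cup0l; by case: n => //= n; exists 0; rewrite linear0.
case=> e ze z0; case: n => [|n] /=.
  apply/funext => s; rewrite /cup big1 // => A _.
  rewrite (@onface_card _ _ p.+1 0) ?mul0r //.
  by apply/negP => /eqP h; have := max_card (mem (evens A)); rewrite card_ord h.
exists (cup e z + cup e e); rewrite codiffD !codiff_cup -ze z0 cup0r addr0.
rewrite -(addrA _ (cup e e)) addcF2 addr0 [X in _ + X]addrC.
by rewrite -[X in X + _]addrA -addrA addcF2 addr0.
Qed.

Lemma coh_sq_pi (p n : nat) (z : cocycles p) :
  coh_sq n (lquot_pi (@coboundary p) z) =
  lquot_pi (@coboundary n) (cocycle_sq n z).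
Proof.
rewrite /coh_sq; apply/lquot_piP.
set y := lquot_repr _.
have /lquot_piP : lquot_pi (@coboundary p) y = lquot_pi (@coboundary p) z.
  by rewrite lquot_reprK.
rewrite !unfold_in => /asboolP yz; apply/asboolP.
rewrite -[cocycle_val _]/(cup y y - cup z z : cochain R X n).
have valB : cocycle_val (y - z) = cocycle_val y - cocycle_val z by [].
have yz0 : codiff (cocycle_val (y - z)) = 0.
  by case: (y - z) => w /= /eqP.
have -> : cup y y - cup z z = cup (y - z) (y - z) +
    (cup (y - z) z + cup z (y - z)) :> cochain R X n.
  have -> : cocycle_val y = cocycle_val (y - z) + cocycle_val z.
    by rewrite valB subrK.
  by rewrite cupDl !cupDr !addrA addrK.
by apply: is_coboundaryD; [exact: cup_cobound|exact: cup_comm].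
Qed.

Lemma coh_sq_is_linear (p n : nat) : linear (@coh_sq p n).
Proof.
have add : {morph @coh_sq p n : x y / x + y}.
  move=> x y; rewrite -[x]lquot_reprK -[y]lquot_reprK -lquot_piD !coh_sq_pi.
  rewrite -lquot_piD; apply/lquot_piP; rewrite unfold_in; apply/asboolP.
  set f := lquot_repr x; set g := lquot_repr y.
  rewrite -[cocycle_val _]/(cup (cocycle_val f + cocycle_val g)
    (cocycle_val f + cocycle_val g) - (cup f f + cup g g) : cochain R X n).
  rewrite cupDl !cupDr.
  have -> : cup f f + cup f g + (cup g f + cup g g) - (cup f f + cup g g) =
    cup f g + cup g f :> cochain R X n.
    apply/eqP; rewrite subr_eq addrACA [cup f g + cup g f]addrC.
    by rewrite [X in _ == X]addrACA [cup g f + cup f f]addrC.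
  exact: cup_comm.
move=> k x y; rewrite add; congr (_ + _).
have : k = 0 \/ k = 1 by case: k => -[|[|]] // i; [left|right]; exact: val_inj.
case=> ->; rewrite ?scale1r // !scale0r.
apply: (addrI (coh_sq n 0)); rewrite addr0.
by have h := add 0 0; rewrite addr0 in h; exact: esym h.
Qed.

HB.instance Definition _ (p n : nat) :=
  GRing.isLinear.Build _ _ _ _ (@coh_sq p n) (@coh_sq_is_linear p n).

End Cohomology.

(* A Z-graded F_2-vector space with linear operations Sq^k of degree k for all
   k >= 0.  To avoid transports along equalities of degrees, Sq^(b - a) from
   degree a to degree b is called stm_op M a b; it is irrelevant for b < a.
   The mod 2 Steenrod algebra being the algebra generated by the Sq^k subject
   to Sq^0 = 1 and the Adem relations, its modules are the steenrodModules on
   which these relations hold, and they form a full subcategory: a morphism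
   of modules over the Steenrod algebra is a linear map of degree 0 that
   commutes with all the Sq^k. *)
Record steenrodModule : Type := SteenrodModule {
  stm_deg :> int -> lmodType 'F_2;
  stm_op : forall a b : int, {linear stm_deg a -> stm_deg b}
}.

Definition Sq (M : steenrodModule) (k : nat) (n : int) : M n -> M (n + k%:Z) :=
  stm_op M n (n + k%:Z).

Definition steenrod_iso (M L : steenrodModule) : Prop :=
  exists phi : forall n : int, {linear M n -> L n},
    (forall n, bijective (phi n)) /\
    (forall (k : nat) (n : int) (x : M n),
      phi (n + k%:Z) (Sq k x) = Sq k (phi n x)).

Definition suspension (M : steenrodModule) : steenrodModule :=
  {| stm_deg := fun n => M (n - 1);
     stm_op := fun a b => stm_op M (a - 1) (b - 1) |}.

(* As I is finite, the direct sum is the product. *)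
Section DirectSum.
Variables (I : finType) (V : I -> lmodType 'F_2).

Definition dsum : Type := forall i, V i.

HB.instance Definition _ := gen_eqMixin dsum.
HB.instance Definition _ := gen_choiceMixin dsum.

Definition dsum_add (x y : dsum) : dsum := fun i => x i + y i.
Definition dsum_opp (x : dsum) : dsum := fun i => - x i.
Definition dsum_scale (a : 'F_2) (x : dsum) : dsum := fun i => a *: x i.

Fact dsum_addA : associative dsum_add.
Proof. by move=> x y z; apply: functional_extensionality_dep => i; exact: addrA. Qed.
Fact dsum_addC : commutative dsum_add.
Proof. by move=> x y; apply: functional_extensionality_dep => i; exact: addrC. Qed.
Fact dsum_add0 : left_id (fun i => 0 : V i) dsum_add.
Proof. by move=> x; apply: functional_extensionality_dep => i; exact: add0r. Qed.
Fact dsum_addN : left_inverse (fun i => 0 : V i) dsum_opp dsum_add.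
Proof. by move=> x; apply: functional_extensionality_dep => i; exact: addNr. Qed.

HB.instance Definition _ :=
  GRing.isZmodule.Build dsum dsum_addA dsum_addC dsum_add0 dsum_addN.

Fact dsum_scaleA a b v : dsum_scale a (dsum_scale b v) = dsum_scale (a * b) v.
Proof. by apply: functional_extensionality_dep => i; exact: scalerA. Qed.
Fact dsum_scale1 : left_id 1 dsum_scale.
Proof. by move=> v; apply: functional_extensionality_dep => i; exact: scale1r. Qed.
Fact dsum_scaleDr : right_distributive dsum_scale +%R.
Proof.
by move=> a u v; apply: functional_extensionality_dep => i; exact: scalerDr.
Qed.
Fact dsum_scaleDl v : {morph dsum_scale^~ v : a b / a + b}.
Proof.
by move=> a b; apply: functional_extensionality_dep => i; exact: scalerDl.
Qed.

HB.instance Definition _ := GRing.Zmodule_isLmodule.Build 'F_2 dsum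
  dsum_scaleA dsum_scale1 dsum_scaleDr dsum_scaleDl.
End DirectSum.

Section DirectSumMap.
Variables (I : finType) (V W : I -> lmodType 'F_2).
Variable f : forall i, {linear V i -> W i}.

Definition dsum_map (x : dsum V) : dsum W := fun i => f i (x i).

Fact dsum_map_is_linear : linear dsum_map.
Proof.
by move=> a x y; apply: functional_extensionality_dep => i; exact: linearP.
Qed.

HB.instance Definition _ :=
  GRing.isLinear.Build _ _ _ _ dsum_map dsum_map_is_linear.
End DirectSumMap.

Definition steenrod_sum (I : finType) (M : I -> steenrodModule) : steenrodModule :=
  {| stm_deg := fun n => dsum (fun i => M i n) : lmodType 'F_2;
     stm_op := fun a b => dsum_map (fun i => stm_op (M i) a b) |}.

Section Reduced.
Variables (R : realType) (X : topologicalType).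

Definition vcoh (k : int) : lmodType 'F_2 :=
  match k with
  | Posz N => cohomology R X N
  | Negz _ => 'rV['F_2]_0
  end.

Definition vcoh_sq (a b : int) : {linear vcoh a -> vcoh b} :=
  match a, b return {linear vcoh a -> vcoh b} with
  | Posz p, Posz n => @coh_sq R X p n
  | _, _ => \0
  end.

Definition reduced_cohomology : steenrodModule :=
  {| stm_deg := fun n => vcoh (n + 1);
     stm_op := fun a b => vcoh_sq (a + 1) (b + 1) |}.
End Reduced.

(* As usual for complexes on [m], {i} need not belong to K. *)
Definition simplicial_complex (m : nat) (K : {set {set 'I_m}}) : Prop :=
  finset.set0 \in K /\
  forall s t : {set 'I_m}, s \in K -> (t \subset s)%SET -> t \in K.

Definition full_subcomplex (m : nat) (K : {set {set 'I_m}}) (J : {set 'I_m}) :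
  {set {set 'I_m}} := [set s in K | s \subset J]%SET.

(* Barycentric coordinates; for K = {set0} this is empty. *)
Definition realization_set (R : realType) (m : nat) (K : {set {set 'I_m}}) :
  set 'rV[R]_m :=
  [set t : 'rV[R]_m | [/\ forall i, 0 <= t 0 i, \sum_i t 0 i = 1 &
     [set i | t 0 i != 0]%SET \in K]]%classic.

Definition disk (R : realType) : set 'rV[R]_2 :=
  [set x : 'rV[R]_2 | x 0 0 ^+ 2 + x 0 1 ^+ 2 <= 1]%classic.
Definition circle (R : realType) : set 'rV[R]_2 :=
  [set x : 'rV[R]_2 | x 0 0 ^+ 2 + x 0 1 ^+ 2 = 1]%classic.

(* Points of (R^2)^m are m x 2 matrices, the i-th row being the i-th factor. *)
Definition moment_angle_set (R : realType) (m : nat) (K : {set {set 'I_m}}) :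
  set 'M[R]_(m, 2) :=
  [set z : 'M[R]_(m, 2) | exists2 s, s \in K &
    forall i, if i \in s then disk (row i z) else circle (row i z)]%classic.

Definition realization (R : realType) (m : nat) (K : {set {set 'I_m}}) :
  topologicalType := set_type (@realization_set R m K).

Definition moment_angle (R : realType) (m : nat) (K : {set {set 'I_m}}) :
  topologicalType := set_type (@moment_angle_set R m K).

Arguments reduced_cohomology R X : clear implicits.
Arguments realization R {m} K.
Arguments moment_angle R {m} K.

(* Main.v *)
(* For J a subset of [m], let p_J be the self-map of Z_K replacing by 1 the
   coordinates outside J.  These commuting idempotents split singular cochains by
   inclusion-exclusion: f = sum_J p_J^* f_J, where f_J = sum_(L <= J) p_L^* f
   vanishes on the simplices with some coordinate in J constantly 1.  Hence the
   cohomology of Z_K is the direct sum of the cohomologies of the polyhedral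
   products Z_(K_J) relative to the union over j in J of the singular simplices of
   {z_j = 1}.  If J is in K this pair is contractible.  Otherwise each coordinate
   pair (disk, circle) relative to 1 is turned, by homotopies, excisions and one
   connecting isomorphism of degree 1, into a pair of convex sets (strip, half
   strip) relative to another half strip.  After all coordinates are processed the
   ambient set is contractible, and a last connecting isomorphism leads to a union
   of half spaces homotopy equivalent to |K_J|.  All these isomorphisms come from
   maps of cochains or connecting maps, which commute with the Steenrod squares by
   the coboundary formula for cup-i products. *)
Require Import Defs.
From HB Require Import structures.
From mathcomp Require Import all_boot all_order all_algebra.
From mathcomp Require Import zify ring lra.
From mathcomp Require Import all_classical all_reals all_analysis.
Import Order.TTheory GRing.Theory Num.Theory.
Import numFieldNormedType.Exports.
Set Implicit Arguments.
Unset Strict Implicit.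
Unset Printing Implicit Defensive.
Local Open Scope ring_scope.

(** * Chains of affine simplices *)

(** The obstacle is that cohomology is taken relative to a family of sets, not to a subspace: the
    components [f_J] vanish on simplices lying in a single face {z_j = 1}, not on all simplices of
    the union of these faces. So a pair consists of two families [P], [Q] of subsets of one space of
    matrices, and cochains are functions on all its simplices, read only on those of [P].
    Restricting, enlarging or intersecting then never changes the type of a cochain, and excision
    and homotopy invariance have to be proved for families. Some of the isomorphisms are
    restrictions that must be inverted, so all are kept as relations between cocycles and become
    maps only at the end. Coordinates are treated one at a time with the others as parameters, which
    replaces a Künneth or smash product argument: a desuspension uses only straight-line homotopies
    moving a single row. Strips and half planes serve this purpose better than disks, since their
    convexity makes stability under such homotopies a matter of linear inequalities. *)

Lemma lift_lift_comm (N i j : nat) (i1 j2 : 'I_N.+2) (j1 i2 : 'I_N.+1) :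
  i1 = i :> nat -> i2 = i :> nat -> j1 = j :> nat -> j2 = j.+1 :> nat ->
  (i <= j)%N -> lift i1 \o lift j1 = lift j2 \o lift i2.
Proof.
move=> ei ei' ej ej' ij; apply/funext => k; apply: val_inj => /=.
by rewrite /= ei ei' ej ej' /bump; lia.
Qed.

(** Each face omitting two vertices arises from the two orders of omission: the pairs [(i, j)] with
    [i <= j] are matched with the pairs [(j + 1, i)]. *)
Lemma sum_lift_lift (N : nat) (G : ('I_N -> 'I_N.+2) -> 'F_2) :
  \sum_(i < N.+2) \sum_(j < N.+1) G (lift i \o lift j) = 0.
Proof.
rewrite pair_big /= (bigID (fun p : 'I_N.+2 * 'I_N.+1 => p.1 <= p.2)%N) /=.
rewrite [X in X + _](reindex_onto
  (fun p : 'I_N.+2 * 'I_N.+1 => (inord p.2, inord p.1.-1))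
  (fun p => (inord p.2.+1, inord p.1))) /=; last first.
  move=> [i j] /= ij; rewrite !inordK /=.
  - by rewrite !inord_val.
  - by have := ltn_ord j; lia.
  - by have := ltn_ord j; lia.
rewrite (eq_bigl (fun p : 'I_N.+2 * 'I_N.+1 => ~~ (p.1 <= p.2)%N)); last first.
  move=> [i j] /=; have i2 := ltn_ord i; have j2 := ltn_ord j.
  rewrite !inordK; try lia.
  case: (leqP i j) => ij /=; last first.
    rewrite prednK ?inord_val; last lia.
    by rewrite eqxx andbT; lia.
  apply/negbTE/negP => /andP[h /eqP[hi hj]].
  by have := congr1 val hi; rewrite /= inordK; lia.
rewrite [X in X + _](eq_bigr (fun p : 'I_N.+2 * 'I_N.+1 => G (lift p.1 \o lift p.2))).
  exact: addF2.
move=> [i j] /= ij; have i2 := ltn_ord i; have j2 := ltn_ord j.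
congr (G _); apply: (@lift_lift_comm N j i.-1) => //.
- by rewrite inordK //; lia.
- by rewrite inordK //; lia.
- lia.
- lia.
Qed.

Section Chains.
Variable R : realType.

(** The rows are points of the standard simplex, so such a matrix is an affine map of standard
    simplices, given by the images of the vertices; composition is the matrix product. *)
Definition stochastic (p q : nat) (M : 'M[R]_(p, q)) : Prop :=
  forall i, (forall j, 0 <= M i j) /\ \sum_j M i j = 1.

Lemma stochastic_mul (p q r : nat) (M : 'M[R]_(p, q)) (L : 'M[R]_(q, r)) :
  stochastic M -> stochastic L -> stochastic (M *m L).
Proof.
move=> hM hL i; have [M0 M1] := hM i; split=> [j|].
  by rewrite mxE; apply: sumr_ge0 => k _; rewrite mulr_ge0 //; case: (hL k).
under eq_bigr do rewrite mxE.
rewrite exchange_big -[RHS]M1 /=; apply: eq_bigr => k _.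
by rewrite -mulr_sumr; case: (hL k) => _ ->; rewrite mulr1.
Qed.

Lemma stochastic1 (n : nat) : stochastic (1%:M : 'M[R]_n).
Proof.
move=> i; split=> [j|]; first by rewrite mxE ler0n.
by rewrite (bigD1 i) //= big1 ?mxE ?eqxx ?addr0 // => j ji; rewrite mxE eq_sym (negbTE ji).
Qed.

Lemma stochastic_vertex (p n : nat) (th : 'I_p -> 'I_n) :
  stochastic (vertex_mx R th).
Proof.
move=> i; split=> [j|]; first by rewrite mxE ler0n.
rewrite (bigD1 (th i)) //= big1 ?mxE ?eqxx ?addr0 // => j ji.
by rewrite mxE eq_sym (negbTE ji).
Qed.

Lemma vertex_mx_comp (p q n : nat) (la : 'I_p -> 'I_q) (th : 'I_q -> 'I_n) :
  vertex_mx R la *m vertex_mx R th = vertex_mx R (th \o la) :> 'M[R]_(p, n).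
Proof.
apply/matrixP => j i; rewrite !mxE.
rewrite (bigD1 (la j)) //= !mxE eqxx mul1r big1 ?addr0 // => k kj.
by rewrite mxE eq_sym (negbTE kj) mul0r.
Qed.

Lemma row'_mul (p q r : nat) (i : 'I_p.+1) (M : 'M[R]_(p.+1, q)) (L : 'M[R]_(q, r)) :
  row' i (M *m L) = row' i M *m L.
Proof. by apply/matrixP => k l; rewrite !mxE; apply: eq_bigr => u _; rewrite mxE. Qed.

Lemma row'_vertex (p q : nat) (i : 'I_p.+1) (M : 'M[R]_(p.+1, q)) :
  row' i M = vertex_mx R (lift i) *m M.
Proof.
apply/matrixP => k l; rewrite !mxE (bigD1 (lift i k)) //= big1 ?addr0.
  by rewrite mxE eqxx mul1r.
by move=> u uk; rewrite mxE eq_sym (negbTE uk) mul0r.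
Qed.

Definition bd (p q : nat) (f : 'M[R]_(p, q) -> 'F_2) (M : 'M[R]_(p.+1, q)) : 'F_2 :=
  \sum_(i < p.+1) f (row' i M).

Definition cone (p q : nat) (b : 'rV[R]_q) (M : 'M[R]_(p, q)) : 'M[R]_(p.+1, q) :=
  \matrix_(i, j) if unlift ord0 i is Some k then M k j else b 0 j.

Lemma stochastic_cone (p q : nat) (b : 'rV[R]_q) (M : 'M[R]_(p, q)) :
  stochastic b -> stochastic M -> stochastic (cone b M).
Proof.
move=> hb hM i; case: (unliftP ord0 i) => [k ->|->].
  have [M0 M1] := hM k; split=> [j|]; first by rewrite mxE liftK.
  by under eq_bigr do rewrite mxE liftK.
have [b0 b1] := hb 0; split=> [j|]; first by rewrite mxE unlift_none.
by under eq_bigr do rewrite mxE unlift_none.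
Qed.

Lemma row'0_cone (p q : nat) (b : 'rV[R]_q) (M : 'M[R]_(p, q)) :
  row' ord0 (cone b M) = M.
Proof. by apply/matrixP => i j; rewrite !mxE liftK. Qed.

Lemma bd_cone0 (q : nat) (b : 'rV[R]_q) (f : 'M[R]_(0, q) -> 'F_2) (M : 'M[R]_(0, q)) :
  bd f (cone b M) = f M.
Proof. by rewrite /bd big_ord1 row'0_cone. Qed.

(** Mod 2, the boundary of a cone is its base plus the cone over the boundary of the base. A base
    without vertices has no boundary term, whence the separate [bd_cone0]. *)
Lemma bd_coneS (p q : nat) (b : 'rV[R]_q) (f : 'M[R]_(p.+1, q) -> 'F_2)
    (M : 'M[R]_(p.+1, q)) :
  bd f (cone b M) = f M + bd (fun L => f (cone b L)) M.
Proof.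
rewrite /bd big_ord_recl row'0_cone; congr (_ + _); apply: eq_bigr => i _.
congr f; apply/matrixP => k j; rewrite !mxE.
case: (unliftP ord0 k) => [l ->|->].
  have -> : lift (lift ord0 i) (lift ord0 l) = lift ord0 (lift i l).
    by apply: val_inj => /=; rewrite /bump /=; lia.
  by rewrite !liftK mxE.
have -> : lift (lift ord0 i) (ord0 : 'I_p.+1) = ord0 by exact: val_inj.
by rewrite !unlift_none.
Qed.

(* Chains mod 2 are lists of matrices, whose rows are the vertices of the affine
   simplices; two chains are equal when [evc] does not distinguish them. *)
Definition evc (p q : nat) (L : seq 'M[R]_(p, q)) (f : 'M[R]_(p, q) -> 'F_2) : 'F_2 :=
  \sum_(M <- L) f M.

Lemma evc_cat (p q : nat) (L L' : seq 'M[R]_(p, q)) f :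
  evc (L ++ L') f = evc L f + evc L' f.
Proof. exact: big_cat. Qed.

Lemma evcD (p q : nat) (L : seq 'M[R]_(p, q)) f g :
  evc L (fun M => f M + g M) = evc L f + evc L g.
Proof. exact: big_split. Qed.

Lemma evc_map (p q p' q' : nat) (u : 'M[R]_(p', q') -> 'M[R]_(p, q)) L f :
  evc (map u L) f = evc L (f \o u).
Proof. exact: big_map. Qed.

Definition push (n p q r : nat) (D : 'I_n -> 'M[R]_(q, r)) (L : seq 'M[R]_(p, q)) :
  seq 'M[R]_(p, r) := [seq M *m D i | i <- enum 'I_n, M <- L].

Lemma evc_push (n p q r : nat) (D : 'I_n -> 'M[R]_(q, r)) (L : seq 'M[R]_(p, q)) f :
  evc (push D L) f = \sum_(i < n) evc L (fun M => f (M *m D i)).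
Proof. by rewrite /evc /push big_allpairs_dep /= big_enum. Qed.

Lemma bd_push (n p q r : nat) (D : 'I_n -> 'M[R]_(q, r)) (L : seq 'M[R]_(p.+1, q)) f :
  evc (push D L) (bd f) = \sum_(i < n) evc L (bd (fun M => f (M *m D i))).
Proof.
rewrite evc_push; apply: eq_bigr => i _; apply: eq_bigr => M _.
by apply: eq_bigr => j _; rewrite row'_mul.
Qed.

Definition stochastics (p q : nat) (L : seq 'M[R]_(p, q)) : Prop :=
  forall M, M \in L -> stochastic M.

Lemma stochastics_push (n p q r : nat) (D : 'I_n -> 'M[R]_(q, r)) (L : seq 'M[R]_(p, q)) :
  (forall i, stochastic (D i)) -> stochastics L -> stochastics (push D L).
Proof.
by move=> hD hL M /allpairsP[[i M'] /= [_ /hL h ->]]; exact: stochastic_mul.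
Qed.

Lemma stochastics_cone (p q : nat) (b : 'rV[R]_q) (L : seq 'M[R]_(p, q)) :
  stochastic b -> stochastics L -> stochastics (map (cone b) L).
Proof. by move=> hb hL M /mapP[M' /hL h ->]; exact: stochastic_cone. Qed.

(* Acyclic models: a chain map [c] from the simplices to the models
   [W N], vanishing on the empty simplex, is null-homotopic. *)
Section Models.
Variables (W : nat -> nat) (D : forall N, 'I_N.+1 -> 'M[R]_(W N, W N.+1)).
Variable b : forall N, 'rV[R]_(W N.+1).
Variable c : forall N, seq 'M[R]_(N, W N).
Hypothesis DD : forall N (f : 'M[R]_(W N, W N.+2) -> 'F_2),
  \sum_(i < N.+2) \sum_(j < N.+1) f (D j *m D i) = 0.
Hypothesis c0 : forall f, evc (c 0) f = 0.
Hypothesis bd_c : forall N f,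
  evc (c N.+1) (bd f) = \sum_(i < N.+1) evc (c N) (fun M => f (M *m D i)).

Fixpoint htpy (N : nat) : seq 'M[R]_(N.+1, W N) :=
  if N is N'.+1 then map (cone (b N')) (c N'.+1 ++ push (@D N') (htpy N'))
  else [::].

(** The chain [c N.+1 ++ push D (htpy N)] is a cycle: by induction the boundaries of its two parts
    both give [c N] on the faces, and the remaining double sum vanishes by [DD]. Coning off this
    cycle gives the primitive. *)
Lemma bd_htpy (N : nat) f :
  evc (htpy N.+1) (bd f) =
  evc (c N.+1) f + \sum_(i < N.+1) evc (htpy N) (fun M => f (M *m D i)).
Proof.
elim: N f => [|N IH] f.
all: match goal with |- evc (htpy ?n.+1) _ = _ =>
  have -> : evc (htpy n.+1) (bd f) = evc (c n.+1 ++ push (@D n) (htpy n))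
    (fun M => f M + bd (fun L => f (cone (b n) L)) M)
    by rewrite [htpy n.+1]/= evc_map; apply: eq_bigr => M _; exact: bd_coneS end.
all: rewrite evcD evc_cat evc_push [X in _ + X]evc_cat bd_c bd_push -big_split /=.
all: rewrite [X in _ + X](_ : _ = 0) ?addr0 //.
  by apply: big1 => i _; rewrite c0 add0r /evc big_nil.
under eq_bigr do rewrite IH addrA addF2 add0r.
under eq_bigr do rewrite exchange_big /=.
rewrite exchange_big /=; apply: big1 => M _.
by under eq_bigr do under eq_bigr do rewrite -mulmxA;
   exact: (DD (fun L => f (cone _ (M *m L)))).
Qed.

Lemma stochastics_htpy :
  (forall N i, stochastic (@D N i)) -> (forall N, stochastic (b N)) ->
  (forall N, stochastics (c N)) -> forall N, stochastics (htpy N).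
Proof.
move=> hD hb hc; elim=> [|N IH] //=.
apply: stochastics_cone => // M; rewrite mem_cat => /orP[/hc //|].
by apply: stochastics_push.
Qed.

End Models.

(** * Barycentric subdivision and its homotopy to the identity *)

Definition face (N : nat) (i : 'I_N.+1) : 'M[R]_(N, N.+1) := vertex_mx R (lift i).

Lemma face_face (N : nat) (f : 'M[R]_(N, N.+2) -> 'F_2) :
  \sum_(i < N.+2) \sum_(j < N.+1) f (face j *m face i) = 0.
Proof.
under eq_bigr do under eq_bigr do rewrite vertex_mx_comp.
exact: (sum_lift_lift (f \o @vertex_mx R _ _)).
Qed.

Definition bary (N : nat) : 'rV[R]_N := const_mx N%:R^-1.

Lemma stochastic_bary (N : nat) : stochastic (bary N.+1).
Proof.
move=> i; split=> [j|]; first by rewrite mxE invr_ge0 ler0n.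
under eq_bigr do rewrite mxE.
by rewrite sumr_const card_ord -[X in X = _]mulr_natr mulVf // pnatr_eq0.
Qed.

Fixpoint sd (N : nat) : seq 'M[R]_N :=
  if N is N'.+1 return seq 'M[R]_N then map (cone (bary N'.+1)) (push (@face N') (sd N'))
  else [:: 0].

Lemma bd_sd (N : nat) f :
  evc (sd N.+1) (bd f) = \sum_(i < N.+1) evc (sd N) (fun M => f (M *m face i)).
Proof.
elim: N f => [|N IH] f.
  by rewrite /= evc_map -evc_push; apply: eq_bigr => M _; exact: bd_cone0.
have -> : evc (sd N.+2) (bd f) = evc (push (@face N.+1) (sd N.+1))
    (fun M => f M + bd (fun L => f (cone (bary N.+2) L)) M).
  by rewrite [sd N.+2]/= evc_map; apply: eq_bigr => M _; exact: bd_coneS.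
rewrite evcD evc_push bd_push [X in _ + X](_ : _ = 0) ?addr0 //.
under eq_bigr do rewrite IH.
under eq_bigr do rewrite exchange_big /=.
rewrite exchange_big /=; apply: big1 => M _.
by under eq_bigr do under eq_bigr do rewrite -mulmxA;
   exact: (face_face (fun L => f (cone _ (M *m L)))).
Qed.

Lemma stochastics_sd (N : nat) : stochastics (sd N).
Proof.
elim: N => [M|N IH]; first by move=> _ [].
apply: stochastics_cone; first exact: stochastic_bary.
by apply: stochastics_push => // i; exact: stochastic_vertex.
Qed.

(** The chain map made null-homotopic is the sum of the identity and of the subdivision; it vanishes
    on the empty simplex because the two agree there. *)
Definition sdT : forall N, seq 'M[R]_(N.+1, N) :=
  htpy (@face) (fun N => bary N.+1) (fun N => 1%:M :: sd N).

Lemma bd_sdT (N : nat) f :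
  evc (sdT N.+1) (bd f) = f 1%:M + evc (sd N.+1) f +
    \sum_(i < N.+1) evc (sdT N) (fun M => f (M *m face i)).
Proof.
rewrite (bd_htpy _ face_face) /=; last 2 first.
- move=> g; rewrite /evc !big_cons big_nil addr0.
  rewrite (_ : 1%:M = 0) ?addF2 //; exact: flatmx0.
- move=> M g; rewrite {1}/evc big_cons -/(evc _ _) bd_sd -big_split /=.
  apply: eq_bigr => i _; rewrite /evc big_cons mul1mx; congr (g _ + _).
  by rewrite row'_vertex mulmx1.
by rewrite {1}/evc big_cons.
Qed.

Lemma stochastics_sdT (N : nat) : stochastics (sdT N).
Proof.
apply: stochastics_htpy.
- by move=> M i; exact: stochastic_vertex.
- by move=> M; exact: stochastic_bary.
- move=> M L; rewrite inE => /predU1P[->|]; first exact: stochastic1.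
  exact: stochastics_sd.
Qed.

(** * The prism operator *)

Definition dmap (p n : nat) (th : 'I_p -> 'I_n) (k : 'I_(p + p)) : 'I_(n + n) :=
  match fintype.split k with inl j => lshift n (th j) | inr j => rshift n (th j) end.

Lemma dmap_comp (p q n : nat) (la : 'I_p -> 'I_q) (th : 'I_q -> 'I_n) :
  dmap th \o dmap la = dmap (th \o la).
Proof.
apply/funext => k; rewrite /dmap /=; case: (fintype.split k) => j.
  by rewrite -[lshift q (la j)]/(unsplit (inl (la j))) unsplitK.
by rewrite -[rshift q (la j)]/(unsplit (inr (la j))) unsplitK.
Qed.

Definition dface (N : nat) (i : 'I_N.+1) : 'M[R]_(N + N, N.+1 + N.+1) :=
  vertex_mx R (dmap (lift i)).

Definition prism_ends (N : nat) : seq 'M[R]_(N, N + N) :=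
  [:: vertex_mx R (lshift N); vertex_mx R (@rshift N N)].

(** The operator is built in the simplex on [N + N] vertices, the join of the two ends, rather than
    in a product with an interval: there coning makes sense and the acyclic models argument applies.
    This simplex is mapped to the actual prism by [prism_fun]. *)
Definition prism : forall N, seq 'M[R]_(N.+1, N + N) :=
  @htpy (fun N => N + N)%N (@dface) (fun N => vertex_mx R (fun=> ord0)) prism_ends.

Lemma bd_prism (N : nat) f :
  evc (prism N.+1) (bd f) =
  f (vertex_mx R (lshift N.+1)) + f (vertex_mx R (@rshift N.+1 N.+1)) +
    \sum_(i < N.+1) evc (prism N) (fun M => f (M *m dface i)).
Proof.
rewrite (bd_htpy (W := fun N => (N + N)%N)) /=.
- by rewrite {1}/evc !big_cons big_nil addr0.
- move=> M g; under eq_bigr do under eq_bigr do rewrite vertex_mx_comp dmap_comp.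
  exact: (sum_lift_lift (fun th => g (vertex_mx R (dmap th)))).
- move=> g; rewrite /evc !big_cons big_nil addr0.
  by rewrite [X in g X + _]flatmx0 [X in _ + g X]flatmx0 addF2.
- move=> M g; rewrite {1}/evc !big_cons big_nil addr0 /bd -big_split /=.
  apply: eq_bigr => i _; rewrite /evc !big_cons big_nil addr0.
  rewrite !row'_vertex !vertex_mx_comp.
  congr (g (vertex_mx _ _) + g (vertex_mx _ _)); apply/funext => k /=.
    by rewrite /dmap -[lshift M k]/(unsplit (inl k)) unsplitK.
  by rewrite /dmap -[rshift M k]/(unsplit (inr k)) unsplitK.
Qed.

Lemma stochastics_prism (N : nat) : stochastics (prism N).
Proof.
apply: (@stochastics_htpy (fun N => N + N)%N).
- by move=> M i; exact: stochastic_vertex.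
- by move=> M; exact: stochastic_vertex.
- by move=> M L; rewrite !inE => /orP[] /eqP ->; exact: stochastic_vertex.
Qed.

(* All rows of an element of [sd N] have weight at least [1/N] on a common
   vertex, so that composing with it shrinks simplices by [1 - 1/N]. *)
Lemma sd_pivot (N : nat) (M : 'M[R]_N.+1) : M \in sd N.+1 ->
  exists j, forall i, N.+1%:R^-1 <= M i j.
Proof.
elim: N M => [|N IH] M /mapP[L /allpairsP[[i L'] /= [_ L's ->]] ->].
  exists 0 => k; rewrite mxE; case: unliftP => [[]//|_]; by rewrite mxE.
(* The pivot of the subdivided face [L'] stays a pivot: its weights are at least [N.+1%:R^-1], and
   the added barycenter has all its weights equal to [N.+2%:R^-1]. *)
have [j hj] := IH _ L's; exists (lift i j) => k; rewrite mxE.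
case: unliftP => [l _|_]; last by rewrite mxE.
rewrite mxE (bigD1 j) //= mxE eqxx mulr1.
rewrite (le_trans _ (_ : L' l j <= _)) //.
  by apply: le_trans (hj l); rewrite lef_pV2 ?posrE ?ltr0n // ler_nat.
rewrite lerDl; apply: sumr_ge0 => u _; rewrite mulr_ge0 //.
  by have := stochastics_sd L's => /(_ l)[].
by rewrite mxE ler0n.
Qed.

Definition osc_le (p q : nat) (M : 'M[R]_(p, q)) (d : R) : Prop :=
  forall i k j, `|M i j - M k j| <= d.

(** The common weight [1/(N+1)] on the pivot contributes the same term to every row of the product.
    What remains are averages, of total weight [1 - 1/(N+1)], of the rows of [L], and these differ
    by at most that fraction of [d]. *)
Lemma osc_sd (N q : nat) (M : 'M[R]_N.+1) (L : 'M[R]_(N.+1, q)) (d : R) :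
  M \in sd N.+1 -> osc_le L d -> osc_le (M *m L) ((1 - N.+1%:R^-1) * d).
Proof.
move=> Ms hL i k j; have [c hc] := sd_pivot Ms.
have st := stochastics_sd Ms.
set e := N.+1%:R^-1 in hc *.
pose A l u : R := M l u - e * (u == c)%:R.
have A0 l u : 0 <= A l u.
  rewrite /A; case: eqVneq => [->|_]; first by rewrite mulr1 subr_ge0.
  by rewrite mulr0 subr0; case: (st l).
have A1 l : \sum_u A l u = 1 - e.
  rewrite big_split /= (proj2 (st l)); congr (_ + _).
  rewrite (bigD1 c) //= eqxx mulr1 big1 ?addr0 // => u uc.
  by rewrite (negbTE uc) mulr0 oppr0.
have ML l : (M *m L) l j = e * L c j + \sum_u A l u * L u j.
  have -> : e * L c j = \sum_u e * (u == c)%:R * L u j.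
    rewrite (bigD1 c) //= eqxx mulr1 [X in _ = _ + X]big1 ?addr0 // => u uc.
    by rewrite (negbTE uc) mulr0 mul0r.
  rewrite mxE -big_split /=; apply: eq_bigr => u _.
  by rewrite /A mulrBl addrCA subrr addr0.
have up l x : (forall u, L u j <= x) -> \sum_u A l u * L u j <= (1 - e) * x.
  by move=> h; rewrite -(A1 l) mulr_suml ler_sum // => u _; rewrite ler_wpM2l.
have lo l x : (forall u, x <= L u j) -> (1 - e) * x <= \sum_u A l u * L u j.
  by move=> h; rewrite -(A1 l) mulr_suml ler_sum // => u _; rewrite ler_wpM2l.
have e1 : 0 <= 1 - e by rewrite -(A1 0) sumr_ge0.
have [u hu] : exists u, forall v, L v j <= L u j.
  case: (@Order.TotalTheory.arg_maxP _ R _ 0 xpredT (fun u => L u j) isT) => u _ hu.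
  by exists u => v; exact: hu.
have [v hv] : exists v, forall u, L v j <= L u j.
  case: (@Order.TotalTheory.arg_minP _ R _ 0 xpredT (fun u => L u j) isT) => v _ hv.
  by exists v => w; exact: hv.
have key l l' : \sum_u A l u * L u j - \sum_u A l' u * L u j <= (1 - e) * d.
  apply: le_trans (_ : (1 - e) * (L u j - L v j) <= _).
    by rewrite mulrBr; apply: lerB; [exact: up | exact: lo].
  by rewrite ler_wpM2l //; have := hL u v j; rewrite ler_norml => /andP[].
rewrite !ML opprD addrACA subrr add0r ler_norml key andbT.
by rewrite lerNl opprB key.
Qed.

End Chains.

Lemma stdsimplex_stochastic (R : realType) (p q : nat) (M : 'M[R]_(p, q))
    (t : 'rV[R]_p) :
  stochastic M -> t \in stdsimplex R p -> t *m M \in stdsimplex R q.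
Proof.
move=> hM; rewrite !inE => -[t0 t1].
have [] := @stochastic_mul R 1 p q t M _ hM 0 => //.
by move=> i; rewrite ord1.
Qed.

Definition amap (R : realType) (p q : nat) (M : 'M[R]_(p, q)) (h : stochastic M)
    (t : stdsimplex R p) : stdsimplex R q :=
  exist _ (val t *m M) (stdsimplex_stochastic h (valP t)).

Lemma amap_continuous (R : realType) (p q : nat) (M : 'M[R]_(p, q))
  (h : stochastic M) : continuous (amap h).
Proof.
apply: continuous_comp_initial => t.
apply: (@continuous_comp _ _ _ (val : stdsimplex R p -> 'rV[R]_p)
  (fun s => s *m M)).
  exact: initial_continuous.
exact: mulmxr_continuous.
Qed.

HB.instance Definition _ (R : realType) (p q : nat) (M : 'M[R]_(p, q))
  (h : stochastic M) :=
  isContinuous.Build _ _ (amap h) (amap_continuous (h := h)).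

(** * Singular simplices and subdivision *)

Lemma stdsimplex_compact (R : realType) (N : nat) : compact (stdsimplex R N).
Proof.
have -> : stdsimplex R N = ([set t : 'rV[R]_N | forall i, `[(0 : R), (1 : R)]%classic (t ord0 i)] `&`
   (fun t : 'rV[R]_N => \sum_i t 0 i) @^-1` [set 1])%classic.
  rewrite eqEsubset; split=> t /=.
    case=> t0 t1; split=> // i; rewrite /= in_itv /= t0 -t1 (bigD1 i) //= lerDl.
    exact: sumr_ge0.
  by case=> h t1; split=> // i; have := h i; rewrite /= in_itv /= => /andP[].
apply: compact_closedI.
  by apply: (@rV_compact R N (fun=> `[(0 : R), (1 : R)]%classic)) => _; exact: segment_compact.
apply: closed_comp; last exact: closed_eq.
move=> t _; have add_cont : continuous (fun x : R * R => x.1 + x.2).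
  exact: add_continuous.
by apply: (continuous_big add_cont) => k _ u; exact: coord_continuous.
Qed.

Section Singular.
Variables (R : realType) (X : topologicalType).

Definition scomp (p q : nat) (s : simplex R X q) (M : 'M[R]_(p, q))
    (h : stochastic M) : simplex R X p := s \o amap h.

Lemma scomp_eq (p q : nat) (s : simplex R X q) (M M' : 'M[R]_(p, q))
    (h : stochastic M) (h' : stochastic M') : M = M' -> scomp s h = scomp s h'.
Proof. by move=> e; move: h h'; rewrite e => h h'; congr scomp; exact: Prop_irrelevance. Qed.

Lemma scomp_scomp (p q r : nat) (s : simplex R X r) (M : 'M[R]_(p, q))
    (L : 'M[R]_(q, r)) (hM : stochastic M) (hL : stochastic L) :
  scomp (scomp s hL) hM = scomp s (stochastic_mul hM hL).
Proof.
apply/continuousEP => t /=; congr (s _); apply: val_inj => /=.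
by rewrite mulmxA.
Qed.

Lemma sface_scomp (p q : nat) (s : simplex R X q) (th : 'I_p -> 'I_q) :
  sface th s = scomp s (stochastic_vertex R th).
Proof. by apply/continuousEP => t /=; congr (s _); apply: val_inj. Qed.

Lemma scomp1 (p : nat) (s : simplex R X p) : scomp s (@stochastic1 R p) = s.
Proof. by apply/continuousEP => t /=; congr (s _); apply: val_inj; rewrite /= mulmx1. Qed.

(** Extends by 0 the values of [f] on the affine simplices of [s], since the functions evaluated by
    [evc] are defined on all matrices. *)
Definition afun (p q : nat) (f : cochain R X p) (s : simplex R X q)
    (M : 'M[R]_(p, q)) : 'F_2 :=
  if pselect (stochastic M) is left h then f (scomp s h) else 0.

Lemma afunE (p q : nat) (f : cochain R X p) (s : simplex R X q)
    (M : 'M[R]_(p, q)) (h : stochastic M) : afun f s M = f (scomp s h).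
Proof.
by rewrite /afun; case: pselect => // h'; congr f; exact: scomp_eq.
Qed.

Lemma afun_scomp (p q r : nat) (f : cochain R X p) (s : simplex R X r)
    (M : 'M[R]_(p, q)) (L : 'M[R]_(q, r)) (hL : stochastic L) :
  stochastic M -> afun f (scomp s hL) M = afun f s (M *m L).
Proof.
by move=> hM; rewrite (afunE _ _ hM) (afunE _ _ (stochastic_mul hM hL)) scomp_scomp.
Qed.

Lemma codiff_scomp (p q : nat) (f : cochain R X p) (s : simplex R X q)
    (M : 'M[R]_(p.+1, q)) (h : stochastic M) :
  codiff f (scomp s h) = bd (afun f s) M.
Proof.
apply: eq_bigr => i _; rewrite sface_scomp scomp_scomp row'_vertex.
by rewrite -afunE.
Qed.

Lemma afun_codiff (p q : nat) (f : cochain R X p) (s : simplex R X q)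
    (M : 'M[R]_(p.+1, q)) : stochastic M ->
  afun (codiff f) s M = bd (afun f s) M.
Proof. by move=> h; rewrite (afunE _ _ h) codiff_scomp. Qed.

Definition cochain_op (p q : nat) (L : seq 'M[R]_(p, q)) (f : cochain R X p) :
  cochain R X q := fun s => evc L (afun f s).

Lemma cochain_op_scomp (p q r : nat) (L : seq 'M[R]_(p, q)) (f : cochain R X p)
    (s : simplex R X r) (M : 'M[R]_(q, r)) (h : stochastic M) :
  stochastics L -> cochain_op L f (scomp s h) = evc L (fun A => afun f s (A *m M)).
Proof. by move=> hL; apply: eq_big_seq => A /hL hA; rewrite afun_scomp. Qed.

Lemma cochain_op_codiff (p q : nat) (L : seq 'M[R]_(p.+1, q)) (f : cochain R X p)
    (s : simplex R X q) :
  stochastics L -> cochain_op L (codiff f) s = evc L (bd (afun f s)).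
Proof. by move=> hL; apply: eq_big_seq => A /hL hA; rewrite afun_codiff. Qed.

Lemma codiff_sd (N : nat) (f : cochain R X N) :
  codiff (cochain_op (sd R N) f) = cochain_op (sd R N.+1) (codiff f).
Proof.
apply/funext => s; rewrite cochain_op_codiff; last exact: stochastics_sd.
rewrite bd_sd; apply: eq_bigr => i _.
by rewrite sface_scomp cochain_op_scomp //; exact: stochastics_sd.
Qed.

Lemma sdT_htpy (N : nat) (f : cochain R X N.+1) (s : simplex R X N.+1) :
  cochain_op (sdT R N.+1) (codiff f) s =
  f s + cochain_op (sd R N.+1) f s + codiff (cochain_op (sdT R N) f) s.
Proof.
rewrite cochain_op_codiff; last exact: stochastics_sdT.
rewrite bd_sdT (afunE _ _ (@stochastic1 R _)) scomp1; congr (_ + _).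
by apply: eq_bigr => i _; rewrite sface_scomp cochain_op_scomp //; exact: stochastics_sdT.
Qed.

(** The simplex has to lie in a single member of [P]. The complex of a family is thus in general
    smaller than that of its union; [racyclic_cover] compares the two. *)
Definition Sing (P : set (set X)) (N : nat) (s : simplex R X N) : Prop :=
  exists2 A, P A & forall t, A (s t).

Lemma Sing_scomp (P : set (set X)) (p q : nat) (s : simplex R X q)
    (M : 'M[R]_(p, q)) (h : stochastic M) : Sing P s -> Sing P (scomp s h).
Proof. by case=> A PA hA; exists A => // t; exact: hA. Qed.

Lemma Sing_sface (P : set (set X)) (p q : nat) (s : simplex R X q)
    (th : 'I_p -> 'I_q) : Sing P s -> Sing P (sface th s).
Proof. by rewrite sface_scomp; exact: Sing_scomp. Qed.

(* Cochains on the simplices of [P] that vanish on those of [Q] are represented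
   by cochains on all simplices, whose values off [Sing P] are irrelevant. *)
Definition vanish (P Q : set (set X)) (N : nat) (f : cochain R X N) : Prop :=
  forall s, Sing P s -> Sing Q s -> f s = 0.

Definition rcocycle (P Q : set (set X)) (N : nat) (f : cochain R X N) : Prop :=
  vanish P Q f /\ forall s, Sing P s -> codiff f s = 0.

Definition rcobound (P Q : set (set X)) (N : nat) : cochain R X N -> Prop :=
  match N with
  | 0 => fun f => forall s, Sing P s -> f s = 0
  | M.+1 => fun f => exists2 g : cochain R X M, vanish P Q g &
      forall s, Sing P s -> f s = codiff g s
  end.

Definition racyclic (P Q : set (set X)) : Prop :=
  forall N (f : cochain R X N), rcocycle P Q f -> rcobound P Q f.

(* All the simplices of the n-fold subdivision of [s] lie in members of [Q]. *)
Fixpoint small (Q : set (set X)) (n N : nat) (s : simplex R X N) : Prop :=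
  if n is n'.+1 then
    forall M (h : stochastic M), M \in sd R N -> small Q n' (scomp s h)
  else Sing Q s.

Lemma smallS (Q : set (set X)) (n N : nat) (s : simplex R X N) :
  small Q n s -> small Q n.+1 s.
Proof.
elim: n s => [|n IH] s /= hs M h Ms; first exact: Sing_scomp.
by apply: IH; exact: hs.
Qed.

Lemma small_leq (Q : set (set X)) (n k N : nat) (s : simplex R X N) :
  (n <= k)%N -> small Q n s -> small Q k s.
Proof.
by move=> /subnK <-; elim: (k - n)%N => [//|d IH] /IH; rewrite addSn; exact: smallS.
Qed.

(** A piece [M] of the subdivided face is itself a face of a piece of the subdivision of [s], namely
    of the cone over [M] from the barycenter. *)
Lemma small_face (Q : set (set X)) (n N : nat) (s : simplex R X N.+1) (i : 'I_N.+1) :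
  small Q n s -> small Q n (sface (lift i) s).
Proof.
elim: n s i => [|n IH] s i; first exact: Sing_sface.
move=> hs M h Ms; rewrite sface_scomp scomp_scomp.
have hb : stochastic (bary R N.+1) by exact: stochastic_bary.
have hC := stochastic_cone hb (stochastic_mul h (stochastic_vertex R (lift i))).
have Cs : cone (bary R N.+1) (M *m vertex_mx R (lift i)) \in sd R N.+1.
  rewrite /=; apply: map_f; apply/allpairsP; exists (i, M) => /=.
  by split=> //; rewrite mem_enum.
have := IH _ ord0 (hs _ hC Cs); rewrite sface_scomp scomp_scomp.
congr small; apply: scomp_eq.
by rewrite -row'_vertex row'0_cone.
Qed.

Lemma iter_sd_small (P Q : set (set X)) (N n : nat) (f : cochain R X N)
    (s : simplex R X N) :
  vanish P Q f -> Sing P s -> small Q n s -> iter n (cochain_op (sd R N)) f s = 0.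
Proof.
move=> f0; elim: n s => [|n IH] s Ps; first exact: f0.
move=> hs; rewrite iterS /cochain_op /evc big1_seq // => M /= Ms.
have h := stochastics_sd Ms; rewrite (afunE _ _ h).
by apply: IH; [exact: Sing_scomp | exact: hs].
Qed.

Lemma codiff_iter_sd (N n : nat) (f : cochain R X N) :
  codiff (iter n (cochain_op (sd R N)) f) = iter n (cochain_op (sd R N.+1)) (codiff f).
Proof. by elim: n => //= n IH; rewrite codiff_sd IH. Qed.

Lemma small_osc (Q : set (set X)) (N n : nat) (s : simplex R X N.+1) :
  (forall (M : 'M[R]_N.+1) (h : stochastic M), osc_le M ((1 - N.+1%:R^-1) ^+ n) -> Sing Q (scomp s h)) ->
  small Q n s.
Proof.
set c := 1 - _ => hs.
suff gen k (M0 : 'M[R]_N.+1) (h0 : stochastic M0) l : (l + k)%N = n -> osc_le M0 (c ^+ l) ->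
    small Q k (scomp s h0).
  have := @gen n _ (@stochastic1 R _) 0 erefl; rewrite scomp1; apply.
  move=> i k j; rewrite !mxE expr0.
  case: (i == j); case: (k == j); rewrite /= ?mulr1n ?mulr0n;
  by rewrite ?subrr ?subr0 ?sub0r ?normrN ?normr1 ?normr0 ?ler01 ?lexx.
elim: k M0 h0 l => [|k IH] M0 h0 l; first by rewrite addn0 => -> o; exact: hs.
move=> e o M h Ms; rewrite scomp_scomp; apply: (IH _ _ l.+1).
  by rewrite -e addnS addSn.
by rewrite exprS; exact: osc_sd.
Qed.

Lemma small_ex (Q : set (set X)) (N : nat) (s : simplex R X N) :
  (exists B, Q B) ->
  (forall t, exists2 B, Q B & exists2 U, nbhs (s t) U & forall t', U (s t') -> B (s t')) ->
  exists n, small Q n s.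
Proof.
case: N s => [|N] s [B0 QB0] cov.
  exists 0%N, B0 => // -[t ht]; exfalso; move: ht; rewrite inE => -[_].
  by rewrite big_ord0 => /eqP; rewrite eq_sym oner_eq0.
pose c : R := 1 - N.+1%:R^-1.
have c1 : `|c| < 1.
  have h0 : 0 < (N.+1%:R : R)^-1 by rewrite invr_gt0 ltr0n.
  have h1 : (N.+1%:R : R)^-1 <= 1 by rewrite invf_le1 ?ltr0n // ler1n.
  by rewrite ger0_norm /c ?subr_ge0 // gtrBl.
(* Lebesgue number argument: [P n t] concerns the pieces with first vertex [t] and oscillation at
   most [c ^+ n]. Near each point it holds for large [n], and compactness makes [n] uniform. *)
pose P n (t : 'rV[R]_N.+1) := forall (M : 'M[R]_N.+1) (h : stochastic M),
  osc_le M (c ^+ n) -> row 0 M = t -> Sing Q (scomp s h).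
have ncov := proj1 (compact_near_coveringP _) (@stdsimplex_compact R N.+1) nat
  (\oo)%classic P _.
have [|n _ hn] := ncov _.
  move=> x Kx; have Kx' : x \in stdsimplex R N.+1 by rewrite inE.
  pose x' : stdsimplex R N.+1 := exist _ x Kx'.
  have [B QB [U sU UB]] := cov x'.
  have /= : nbhs x' (s @^-1` U)%classic by exact: (@cts_fun _ _ s x').
  case=> W [[V oV VW] Wx WU].
  have /nbhs_ballP[e /= e0 eV] : nbhs x V.
    by move: Wx; rewrite -VW /= => Vx; exact: open_nbhs_nbhs.
  exists ([set t | ball x (e / 2) t], [set n | `|c ^+ n| < e / 2])%classic => /=.
    split; first by apply: nbhsx_ballx; rewrite divr_gt0.
    have /cvgr0Pnorm_lt/(_ (e / 2)) := cvg_expr c1.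
    by apply; rewrite divr_gt0.
  case=> t n /= [[_ xt] cn] M h o r0; exists B => // u.
  apply: UB; apply: (WU (amap h u)); rewrite -VW /=; apply: eV.
  split=> // i j; rewrite ord1 -ball_normE /=.
  case: u => u hu /=; rewrite mxE; have [u0 u1] : stdsimplex R N.+1 u by rewrite inE in hu.
  rewrite -[x 0 j]mul1r -u1 mulr_suml -sumrB.
  apply: le_lt_trans (ler_norm_sum _ _ _) _.
  have le1 k : `|u 0 k * x 0 j - u 0 k * M k j| <= u 0 k * (`|x 0 j - t 0 j| + c ^+ n).
    rewrite -mulrBr normrM ger0_norm // ler_wpM2l //.
    have -> : x 0 j - M k j = (x 0 j - t 0 j) + (M 0 j - M k j).
      by rewrite -r0 mxE addrA subrK.
    by apply: le_trans (ler_normD _ _) _; rewrite lerD2l.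
  apply: le_lt_trans (ler_sum _ (fun k _ => le1 k)) _.
  rewrite -mulr_suml u1 mul1r [e]splitr ltrD //.
    exact: xt.
  by apply: le_lt_trans cn; exact: ler_norm.
exists n; apply: small_osc => M h o; apply: (hn n _ (row 0 M)) => //=.
have [M0 M1] := h 0; split=> [i|]; first by rewrite mxE.
by under eq_bigr do rewrite mxE.
Qed.

(* With T the homotopy from the identity to the subdivision Sd, and n(s) the least
   n such that the n-fold subdivision of s is [Q]-small, a primitive of f is
   s |-> sum_(k < n(s)) (Sd^k T f)(s). *)
Lemma racyclic_cover (P Q : set (set X)) :
  (forall A, P A -> exists B, Q B) ->
  (forall A z, P A -> A z -> exists2 B, Q B & exists2 U, nbhs z U &
     forall z', A z' -> U z' -> B z') ->
  racyclic P Q.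
Proof.
move=> Q0 cov N f [f0 df].
have sm M (s : simplex R X M) : Sing P s -> exists n, `[< small Q n s >].
  case=> A PA sA; have [n hn] : exists n, small Q n s.
    apply: small_ex; first exact: Q0 PA.
    move=> t; have [B QB [U Uz UB]] := cov A _ PA (sA t).
    by exists B => //; exists U => // t' Ut'; apply: UB.
  by exists n; apply/asboolP.
pose ns M (s : simplex R X M) : nat :=
  if pselect (Sing P s) is left h then ex_minn (sm M s h) else 0%N.
have nsP M (s : simplex R X M) : Sing P s -> small Q (ns M s) s.
  by move=> h; rewrite /ns; case: pselect => // h'; case: ex_minnP => n /asboolP.
have nsm M (s : simplex R X M) n : Sing P s -> small Q n s -> (ns M s <= n)%N.
  move=> h hs; rewrite /ns; case: pselect => // h'; case: ex_minnP => k _; apply.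
  by apply/asboolP.
case: N f f0 df => [|N] f f0 df /=.
  (* The empty simplex lies in every set, in particular in a member of [Q]. *)
  move=> s Ps; apply: f0 => //; case: Ps => A PA _; have [B QB] := Q0 A PA.
  exists B => // -[t ht]; exfalso; move: ht; rewrite inE => -[_].
  by rewrite big_ord0 => /eqP; rewrite eq_sym oner_eq0.
pose u := cochain_op (sdT R N) f.
have u0 : vanish P Q u.
  move=> s Ps Qs; rewrite /u /cochain_op /evc big1_seq // => M /= Ms.
  have h := stochastics_sdT Ms; rewrite (afunE _ _ h).
  by apply: f0; exact: Sing_scomp.
have du s : Sing P s -> codiff u s = f s + cochain_op (sd R N.+1) f s.
  move=> Ps; have := sdT_htpy f s.
  rewrite (_ : cochain_op _ (codiff f) s = 0); last first.
    rewrite /cochain_op /evc big1_seq // => M /= Ms.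
    have h := stochastics_sdT Ms; rewrite (afunE _ _ h).
    by apply: df; exact: Sing_scomp.
  move=> e; apply: (addrI (codiff u s)).
  by rewrite addF2 e addrC.
(* As [f] is a cocycle, [u] is a primitive of the sum of [f] and its subdivision; subdividing [k]
   times gives differences that telescope. *)
have dk s k : Sing P s -> codiff (iter k (cochain_op (sd R N)) u) s =
    iter k (cochain_op (sd R N.+1)) f s + iter k.+1 (cochain_op (sd R N.+1)) f s.
  move=> Ps; rewrite codiff_iter_sd; elim: k s Ps => [|k IH] s Ps; first exact: du.
  rewrite !iterS /cochain_op /evc -big_split /=; apply: eq_big_seq => M Ms.
  have h := stochastics_sd Ms; rewrite !(afunE _ _ h).
  by apply: IH; exact: Sing_scomp.
exists (fun s => \sum_(k < ns N s) iter k (cochain_op (sd R N)) u s).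
  move=> s Ps Qs; have -> : ns N s = 0%N by apply/eqP; rewrite -leqn0; exact: nsm.
  by rewrite big_ord0.
move=> s Ps; set n := ns N.+1 s.
have sn : small Q n s by exact: nsP.
transitivity (\sum_(k < n) codiff (iter k (cochain_op (sd R N)) u) s).
  under eq_bigr do rewrite dk //.
  rewrite (telescopeF2 (fun k => iter k (cochain_op (sd R N.+1)) f s)) /=.
  by rewrite (iter_sd_small f0) ?addr0.
rewrite /codiff exchange_big /=; apply: eq_bigr => i _.
have Pi : Sing P (sface (lift i) s) by exact: Sing_sface.
have le : (ns N (sface (lift i) s) <= n)%N by apply: nsm => //; exact: small_face.
(* A face may become small before [s] does. The extra terms are zero, because [u] vanishes on the
   simplices of [Q]. *)
rewrite (big_ord_widen n (fun k => iter k (cochain_op (sd R N)) u (sface (lift i) s)) le).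
rewrite [RHS]big_mkcond /=; apply: eq_bigr => k _; case: ltnP => // lk.
apply: (iter_sd_small u0) => //.
by apply: small_leq lk _; exact: nsP.
Qed.

End Singular.

(** * Relative cohomology *)

Lemma pair_continuous (T U V : topologicalType) (f : T -> U) (g : T -> V) :
  continuous f -> continuous g -> continuous (fun x => (f x, g x)).
Proof. by move=> cf cg x; exact: (cvg_pair (cf x) (cg x)). Qed.

Section Relative.
Variables (R : realType) (X : topologicalType).
Implicit Types P Q T : set (set X).

Lemma cochainDE N (f g : cochain R X N) s : (f + g) s = f s + g s. Proof. by []. Qed.

Lemma codiff_codiff (N : nat) (f : cochain R X N) : codiff (codiff f) = 0.
Proof.
apply/funext => s; rewrite /codiff.
under eq_bigr do under eq_bigr do rewrite sface_comp.
exact: (sum_lift_lift (fun th => f (sface th s))).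
Qed.

Lemma codiff_eq P N (f g : cochain R X N) :
  (forall s, Sing P s -> f s = g s) -> forall s, Sing P s -> codiff f s = codiff g s.
Proof. by move=> h s Ps; apply: eq_bigr => i _; apply: h; exact: Sing_sface. Qed.

Lemma codiff_vanish P Q N (f : cochain R X N) : vanish P Q f -> vanish P Q (codiff f).
Proof. by move=> h s Ps Qs; apply: big1 => i _; apply: h; exact: Sing_sface. Qed.

Lemma onface_eq P p n (f g : cochain R X p) (s : simplex R X n) S :
  (forall s, Sing P s -> f s = g s) -> Sing P s -> onface f s S = onface g s S.
Proof. by move=> h Ps; apply: eq_bigr => th _; apply: h; exact: Sing_sface. Qed.

Lemma cup_eq P p q n (f f' : cochain R X p) (g g' : cochain R X q) :
  (forall s, Sing P s -> f s = f' s) -> (forall s, Sing P s -> g s = g' s) ->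
  forall s, Sing P s -> (cup f g : cochain R X n) s = (cup f' g' : cochain R X n) s.
Proof.
move=> hf hg s Ps; apply: eq_bigr => A _.
by rewrite (onface_eq _ hf) // (onface_eq _ hg).
Qed.

Lemma cup_vanish P Q p q n (f : cochain R X p) (g : cochain R X q) :
  vanish P Q f -> vanish P Q (cup f g : cochain R X n).
Proof.
move=> h s Ps Qs; apply: big1 => A _.
rewrite {1}/onface big1 ?mul0r // => th _; apply: h; exact: Sing_sface.
Qed.

Lemma vanishD P Q N (f g : cochain R X N) :
  vanish P Q f -> vanish P Q g -> vanish P Q (f + g).
Proof. by move=> hf hg s Ps Qs; rewrite cochainDE hf // hg // addr0. Qed.

Lemma rcocycleD P Q N (f g : cochain R X N) :
  rcocycle P Q f -> rcocycle P Q g -> rcocycle P Q (f + g).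
Proof.
move=> [f0 df] [g0 dg]; split; first exact: vanishD.
by move=> s Ps; rewrite codiffD cochainDE df // dg // addr0.
Qed.

Lemma rcoboundD P Q N (f g : cochain R X N) :
  rcobound P Q f -> rcobound P Q g -> rcobound P Q (f + g).
Proof.
case: N f g => [|N] f g /=; first by move=> hf hg s Ps; rewrite cochainDE hf // hg // addr0.
move=> [a a0 ha] [b b0 hb]; exists (a + b); first exact: vanishD.
by move=> s Ps; rewrite codiffD !cochainDE ha // hb.
Qed.

Lemma rcobound_eq P Q N (f g : cochain R X N) :
  (forall s, Sing P s -> f s = g s) -> rcobound P Q f -> rcobound P Q g.
Proof.
case: N f g => [|N] f g /= fg; first by move=> h s Ps; rewrite -fg // h.
by move=> [a a0 ha]; exists a => // s Ps; rewrite -fg // ha.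
Qed.

Lemma rcobound0 P Q N (f : cochain R X N) :
  (forall s, Sing P s -> f s = 0) -> rcobound P Q f.
Proof.
case: N f => [|N] f //= h; exists (fun=> 0) => // s Ps; rewrite h //.
by rewrite /codiff big1.
Qed.

Lemma rcobound_add2 P Q N (f : cochain R X N) : rcobound P Q (f + f).
Proof. by rewrite addcF2; apply: rcobound0. Qed.

Lemma rcobound_addl P Q N (f g : cochain R X N) :
  rcobound P Q (f + g) -> rcobound P Q f -> rcobound P Q g.
Proof. by move=> h hf; have := rcoboundD hf h; rewrite addrA addcF2 add0r. Qed.

Lemma rcobound_addr P Q N (f g : cochain R X N) :
  rcobound P Q (f + g) -> rcobound P Q g -> rcobound P Q f.
Proof. by rewrite addrC; exact: rcobound_addl. Qed.

Lemma rcobound_codiff P Q N (f : cochain R X N) :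
  vanish P Q f -> rcobound P Q (codiff f).
Proof. by exists f. Qed.

Lemma rcocycle_codiff P Q N (f : cochain R X N) :
  vanish P Q f -> rcocycle P Q (codiff f).
Proof.
by move=> h; split=> [|s _]; [exact: codiff_vanish|rewrite codiff_codiff].
Qed.

Lemma rcocycle_sq P Q p n (f : cochain R X p) :
  rcocycle P Q f -> rcocycle P Q (cup f f : cochain R X n).
Proof.
move=> [f0 df]; split=> [|s Ps]; first exact: cup_vanish.
rewrite codiff_cup -addrA addcF2 addr0 cochainDE.
have h0 : forall s, Sing P s -> codiff f s = (0 : cochain R X p.+1) s by exact: df.
rewrite (cup_eq (P := P) h0 (fun _ _ => erefl)) // cup0l.
rewrite (cup_eq (P := P) (fun _ _ => erefl) h0) // cup0r; exact: addr0.
Qed.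

(** The two mixed terms in the coboundary of [cup e (codiff e)] are the coboundary of [cup e e].
    This explicit primitive makes squares compatible with coboundaries and with connecting maps. *)
Lemma codiff_cup_codiff p n (e : cochain R X p) :
  codiff (cup e (codiff e) + cup e e : cochain R X n) = cup (codiff e) (codiff e).
Proof.
rewrite codiffD !codiff_cup codiff_codiff cup0r addr0.
rewrite -(addrA _ (cup e e)) addcF2 addr0 [X in _ + X]addrC.
by rewrite -[X in X + _]addrA -addrA addcF2 addr0.
Qed.

Lemma cup_deg0 p q (f : cochain R X p) (g : cochain R X q) (s : simplex R X 0) :
  (p != 0)%N -> (cup f g : cochain R X 0) s = 0.
Proof.
move=> p0; apply: big1 => A _; rewrite onface_card ?mul0r //.
by have := max_card (mem (evens A)); rewrite card_ord leqn0 => /eqP ->; rewrite eq_sym.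
Qed.

Lemma rcobound_cup_comm P Q p n (y z : cochain R X p) :
  rcocycle P Q y -> rcocycle P Q z ->
  rcobound P Q (cup y z + cup z y : cochain R X n).
Proof.
move=> [y0 dy] [z0 dz]; case: n => [|n].
  move=> s _; rewrite cochainDE /cup -big_split /=; apply: big1 => A _.
  have -> : odds A = evens A by apply/setP => -[].
  by rewrite [X in _ + X]mulrC addF2.
exists (cup y z); first exact: cup_vanish.
move=> s Ps; rewrite codiff_cup -addrA [RHS]cochainDE.
rewrite [X in _ = X + _](_ : _ = 0) ?add0r // cochainDE.
rewrite (cup_eq (P := P) (f' := 0) (g' := z)) // cup0l.
rewrite (cup_eq (P := P) (f' := y) (g' := 0)) // cup0r; exact: addr0.
Qed.

Lemma rcobound_sq P Q p n (x : cochain R X p) :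
  rcobound P Q x -> rcobound P Q (cup x x : cochain R X n).
Proof.
case: p x => [|p] x /=.
  move=> x0; apply: rcobound0 => s Ps.
  by rewrite (cup_eq (P := P) (f' := 0) (g' := 0)) // cup0l.
case=> e e0 he; apply: rcobound_eq (_ : rcobound P Q (cup (codiff e) (codiff e))).
  by move=> s Ps; apply: cup_eq Ps => t Pt; rewrite he.
case: n => [|n]; first by move=> s _; exact: cup_deg0.
rewrite -codiff_cup_codiff; apply: rcobound_codiff.
by apply: vanishD; exact: cup_vanish.
Qed.

Lemma rcobound_sqD P Q p n (x y : cochain R X p) :
  rcocycle P Q x -> rcocycle P Q y -> rcobound P Q (x + y) ->
  rcobound P Q (cup x x + cup y y : cochain R X n).
Proof.
move=> hx hy hxy; set w := x + y.
have hw : rcocycle P Q w by exact: rcocycleD.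
have -> : cup x x + cup y y = cup w w + (cup w y + cup y w) :> cochain R X n.
  have -> : x = w + y by rewrite /w -addrA addcF2 addr0.
  by rewrite cupDl !cupDr -!addrA addcF2 addr0.
apply: rcoboundD; first exact: rcobound_sq.
exact: rcobound_cup_comm.
Qed.

Lemma SingU P Q N (s : simplex R X N) : Sing (P `|` Q)%classic s <-> Sing P s \/ Sing Q s.
Proof.
split; first by case=> A [PA|QA] h; [left|right]; exists A.
by case=> -[A h1 h2]; exists A => //; [left|right].
Qed.

Lemma vanishU P Q T N (f : cochain R X N) :
  vanish P (Q `|` T)%classic f <-> vanish P Q f /\ vanish P T f.
Proof.
split=> [h|[h h'] s Ps /SingU[]]; [|exact: h|exact: h'].
by split=> s Ps Qs; apply: h => //; apply/SingU; [left|right].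
Qed.

(** Surjectivity of restriction to [T] on relative cochains: as [y] has values on all simplices, it
    only has to be set to 0 on those of [Q]. *)
Lemma vanish_extend P Q T N (y : cochain R X N) : vanish T Q y ->
  exists2 e : cochain R X N, vanish P Q e & forall s, Sing T s -> e s = y s.
Proof.
move=> y0; exists (fun s => if pselect (Sing Q s) then 0 else y s).
  by move=> s Ps Qs; case: pselect.
by move=> s Ts; case: pselect => //= Qs; rewrite y0.
Qed.

End Relative.

(** * Functoriality of relative cohomology *)

Section Pull.
Variables (R : realType) (X Y : topologicalType) (g : continuousType X Y).

Definition spush N (s : simplex R X N) : simplex R Y N := g \o s.
Definition pull N (f : cochain R Y N) : cochain R X N := fun s => f (spush s).

Lemma sface_spush p n (th : 'I_p -> 'I_n) (s : simplex R X n) :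
  sface th (spush s) = spush (sface th s).
Proof. exact/continuousEP. Qed.

Lemma codiff_pull N (f : cochain R Y N) : codiff (pull f) = pull (codiff f).
Proof. by apply/funext => s; apply: eq_bigr => i _; rewrite sface_spush. Qed.

Lemma onface_pull p n (f : cochain R Y p) (s : simplex R X n) S :
  onface (pull f) s S = onface f (spush s) S.
Proof. by apply: eq_bigr => th _; rewrite sface_spush. Qed.

Lemma cup_pull p q n (f : cochain R Y p) (h : cochain R Y q) :
  cup (pull f) (pull h) = pull (cup f h) :> cochain R X n.
Proof. by apply/funext => s; apply: eq_bigr => A _; rewrite !onface_pull. Qed.

Lemma pullD N (f h : cochain R Y N) : pull (f + h) = pull f + pull h.
Proof. by []. Qed.

Definition sends (P : set (set X)) (P' : set (set Y)) : Prop :=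
  forall A, P A -> exists2 B, P' B & forall x, A x -> B (g x).

Lemma Sing_spush P P' N (s : simplex R X N) : sends P P' -> Sing P s -> Sing P' (spush s).
Proof. by move=> h [A /h[B PB AB] sA]; exists B => // t; apply: AB; exact: sA. Qed.

Variables (P Q : set (set X)) (P' Q' : set (set Y)).
Hypotheses (hP : sends P P') (hQ : sends Q Q').

Lemma vanish_pull N (f : cochain R Y N) : vanish P' Q' f -> vanish P Q (pull f).
Proof.
by move=> h s Ps Qs; apply: h; [apply: Sing_spush hP _|apply: Sing_spush hQ _].
Qed.

Lemma rcocycle_pull N (f : cochain R Y N) : rcocycle P' Q' f -> rcocycle P Q (pull f).
Proof.
move=> [f0 df]; split; first exact: vanish_pull.
by move=> s Ps; rewrite codiff_pull; apply: df; apply: Sing_spush hP _.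
Qed.

Lemma rcobound_pull N (f : cochain R Y N) : rcobound P' Q' f -> rcobound P Q (pull f).
Proof.
case: N f => [|N] f /=; first by move=> h s Ps; apply: h; apply: Sing_spush hP _.
case=> k k0 hk; exists (pull k); first exact: vanish_pull.
by move=> s Ps; rewrite codiff_pull; apply: hk; apply: Sing_spush hP _.
Qed.

End Pull.

(** * Isomorphisms of relative cohomology as correspondences *)

Record cpair : Type := CPair {
  cpT : topologicalType; cpP : set (set cpT); cpQ : set (set cpT) }.

Arguments cpP : clear implicits.
Arguments cpQ : clear implicits.

Section Corr.
Variable R : realType.

Notation coch C N := (cochain R (cpT C) N).
Notation cocy C f := (rcocycle (cpP C) (cpQ C) f).
Notation cobo C f := (rcobound (cpP C) (cpQ C) f).

(* A linear correspondence between cocycles that induces an isomorphism of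
   cohomology lowering degrees by [k] and compatible with Steenrod squares;
   composing correspondences avoids quotients except at the two ends. *)
Record is_corr (k : nat) (C D : cpair)
    (r : forall M, coch C (k + M) -> coch D M -> Prop) : Prop := IsCorr {
  corrZ : forall M x y, r M x y -> cocy C x /\ cocy D y;
  corr_l : forall M x, cocy C x -> exists y, r M x y;
  corr_r : forall M y, cocy D y -> exists x, r M x y;
  corrD : forall M x y x' y', r M x y -> r M x' y' -> r M (x + x') (y + y');
  corrB : forall M x y, r M x y -> (cobo C x <-> cobo D y);
  corr_sq : forall M x y n, r M x y -> r n (cup x x) (cup y y);
  corr_low : forall N (x : coch C N), (N < k)%N -> cocy C x -> cobo C x
}.

Definition corr (k : nat) (C D : cpair) : Prop := exists r, @is_corr k C D r.

Lemma corr_sym (C D : cpair) : corr 0 C D -> corr 0 D C.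
Proof.
case=> r [hZ hl hr hD hB hs _]; exists (fun M x y => r M y x); split=> //.
- by move=> M x y /hZ[].
- by move=> M x y x' y'; exact: hD.
- by move=> M x y /hB [].
- by move=> M x y n; exact: hs.
Qed.

(** Composition is stated for a first shift equal to 0 or 1, where [0 + (k + M)] and [1 + (k + M)]
    compute, so that cochains need no transport between degrees. *)
Lemma corr_trans0 (k : nat) (C D E : cpair) : corr 0 C D -> corr k D E -> corr k C E.
Proof.
case=> r [hZ hl hr hD hB hs _] [r' [hZ' hl' hr' hD' hB' hs' hlow]].
exists (fun M x y => exists2 z, r (k + M)%N x z & r' M z y); split.
- by move=> M x y [z /hZ[? ?] /hZ'[]].
- by move=> M x /hl[z h]; have [_ /hl'[y h']] := hZ _ _ _ h; exists y, z.
- by move=> M y /hr'[z h]; have [/hr[x h'] _] := hZ' _ _ _ h; exists x, z.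
- move=> M x y x' y' [z h1 h2] [z' h1' h2']; exists (z + z'); last exact: hD'.
  exact: hD h1 h1'.
- by move=> M x y [z /hB h /hB' h']; rewrite (iff_trans h h').
- by move=> M x y n [z h h']; exists (cup z z); [exact: hs h|exact: hs'].
- move=> N x Nk /hl[z h]; have [_ hz] := hZ _ _ _ h.
  by apply/(hB _ _ _ h); exact: hlow.
Qed.

Lemma corr_trans1 (k : nat) (C D E : cpair) : corr 1 C D -> corr k D E -> corr k.+1 C E.
Proof.
case=> r [hZ hl hr hD hB hs hlow1] [r' [hZ' hl' hr' hD' hB' hs' hlow]].
exists (fun M x y => exists2 z, r (k + M)%N x z & r' M z y); split.
- by move=> M x y [z /hZ[? ?] /hZ'[]].
- by move=> M x /hl[z h]; have [_ /hl'[y h']] := hZ _ _ _ h; exists y, z.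
- by move=> M y /hr'[z h]; have [/hr[x h'] _] := hZ' _ _ _ h; exists x, z.
- move=> M x y x' y' [z h1 h2] [z' h1' h2']; exists (z + z'); last exact: hD'.
  exact: hD h1 h1'.
- by move=> M x y [z /hB h /hB' h']; rewrite (iff_trans h h').
- by move=> M x y n [z h h']; exists (cup z z); [exact: hs h|exact: hs'].
- case=> [|N] x Nk; first exact: hlow1.
  move=> /(hl N)[z h]; have [_ hz] := hZ _ _ _ h.
  by apply/(hB _ _ _ h); apply: hlow.
Qed.

Section OneSpace.
Variable X : topologicalType.
Implicit Types P Q T : set (set X).
Local Notation "A :|| B" := (A `|` B)%classic (at level 50).

Lemma corr_ext P Q P' Q' :
  (forall N (s : simplex R X N), Sing P s <-> Sing P' s) ->
  (forall N (s : simplex R X N), Sing P s -> (Sing Q s <-> Sing Q' s)) ->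
  corr 0 (CPair P Q) (CPair P' Q').
Proof.
move=> hP hQ.
have hv N (f : cochain R X N) : vanish P Q f <-> vanish P' Q' f.
  split=> h s Ps Qs; apply: h.
  - exact/hP.
  - by apply/hQ => //; exact/hP.
  - exact/hP.
  - by apply/hQ.
have hZ N (f : cochain R X N) : rcocycle P Q f <-> rcocycle P' Q' f.
  by split=> -[/hv h d]; split=> // s /hP; exact: d.
have hB N (f : cochain R X N) : rcobound P Q f <-> rcobound P' Q' f.
  case: N f => [|N] f /=; first by split=> h s /hP; exact: h.
  by split=> -[g /hv h d]; exists g => // s /hP; exact: d.
exists (fun M x y => rcocycle P Q x /\ x = y); split=> //=.
- by move=> M x y [h <-]; split=> //; exact/hZ.
- by move=> M x h; exists x.
- by move=> M x /hZ h; exists x.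
- by move=> M x y x' y' [h <-] [h' <-]; split=> //; exact: rcocycleD.
- by move=> M x y [h <-].
- by move=> M x y n [h <-]; split=> //; exact: rcocycle_sq.
Qed.

Variables P Q T : set (set X).
Hypothesis sTP : forall N (s : simplex R X N), Sing T s -> Sing P s.

Lemma rcocycle_restr N (f : cochain R X N) : rcocycle P Q f -> rcocycle T Q f.
Proof. by move=> [f0 df]; split=> s /sTP; [exact: f0|exact: df]. Qed.

Lemma rcocycleU N (f : cochain R X N) :
  rcocycle P (Q :|| T) f <-> rcocycle P Q f /\ forall s, Sing T s -> f s = 0.
Proof.
split=> [[/vanishU[f0 fT] df]|[[f0 df] fT]].
  by split=> // s Ts; apply: fT => //; exact: sTP.
by split=> //; apply/vanishU; split=> // s _; exact: fT.
Qed.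

Lemma rcoboundU N (f : cochain R X N) : rcobound P (Q :|| T) f -> rcobound P Q f.
Proof. by case: N f => [|N] f //= [g /vanishU[g0 _] h]; exists g. Qed.

(* The next three lemmas come from the short exact sequence of cochains
   of (P; Q u T), (P; Q) and (T; Q). *)
Lemma corr_widen : racyclic R T Q -> corr 0 (CPair P (Q :|| T)) (CPair P Q).
Proof.
move=> ac; exists (fun M x y => [/\ rcocycle P (Q :|| T) x, rcocycle P Q y &
  rcobound P Q (x + y)]); split=> //=.
- by move=> M x y [].
- move=> M x hx; exists x; split=> //; last exact: rcobound_add2.
  by case/rcocycleU: hx.
- move=> M y hy; have [_ dy] := hy; have := ac _ _ (rcocycle_restr hy).
  case: M y hy dy => [|M] y hy dy h.
    exists y; split=> //; last exact: rcobound_add2.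
    exact/rcocycleU.
  have [g g0 hg] := h; have [e e0 he] := vanish_extend P g0.
  exists (y + codiff e); split=> //.
    apply/rcocycleU; split.
      by apply: rcocycleD => //; exact: rcocycle_codiff.
    move=> s Ts; rewrite cochainDE hg // -(codiff_eq he) // addF2 //.
  by rewrite addrAC addcF2 add0r; exact: rcobound_codiff.
- move=> M x y x' y' [h1 h2 h3] [h1' h2' h3']; split; try exact: rcocycleD.
  by rewrite addrACA; exact: rcoboundD.
- move=> M x y [h1 h2 h3]; split=> [/rcoboundU|hy]; first exact: rcobound_addl.
  have := rcobound_addr h3 hy; have [_ xT] := proj1 (rcocycleU _) h1.
  case: M x y {hy h2 h3} h1 xT => [|M] x y h1 xT //= [g g0 hg].
  have : rcobound T Q g.
    apply: ac; split=> s Ts; first by apply: g0; exact: sTP.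
    by rewrite -hg ?xT //; exact: sTP.
  case: M x y h1 xT g g0 hg => [|M] x y h1 xT g g0 hg /=.
    move=> gT; exists g => //; apply/vanishU; split=> // s _; exact: gT.
  case=> k k0 hk; have [e e0 he] := vanish_extend P k0.
  exists (g + codiff e); last first.
    by move=> s Ps; rewrite codiffD codiff_codiff addr0 hg.
  apply/vanishU; split; first by apply: vanishD => //; exact: codiff_vanish.
  by move=> s _ Ts; rewrite cochainDE hk // (codiff_eq he) // addF2.
- move=> M x y n [h1 h2 h3]; split; try exact: rcocycle_sq.
  by apply: rcobound_sqD => //; case/rcocycleU: h1.
Qed.

Lemma corr_delta : racyclic R P Q -> corr 1 (CPair P (Q :|| T)) (CPair T Q).
Proof.
move=> ac; exists (fun M x y => [/\ rcocycle P (Q :|| T) x, rcocycle T Q y &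
  exists e, [/\ vanish P Q e, forall s, Sing T s -> e s = y s &
                forall s, Sing P s -> x s = codiff e s]]); split=> //=.
- by move=> M x y [].
- move=> M x hx; have [hx' xT] := proj1 (rcocycleU _) hx.
  have [e e0 he] := ac _ _ hx'.
  exists e; split=> //; last by exists e.
  split=> s Ts; first by apply: e0; exact: sTP.
  by rewrite -he ?xT //; exact: sTP.
- move=> M y hy; have [y0 dy] := hy; have [e e0 he] := vanish_extend P y0.
  exists (codiff e); split=> //; last by exists e.
  apply/rcocycleU; split; first exact: rcocycle_codiff.
  by move=> s Ts; rewrite (codiff_eq he) // dy.
- move=> M x y x' y' [h1 h2 [e [a b c]]] [h1' h2' [e' [a' b' c']]].
  split; try exact: rcocycleD.
  exists (e + e'); split; first exact: vanishD.
    by move=> s Ts; rewrite !cochainDE b // b'.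
  by move=> s Ps; rewrite codiffD !cochainDE c // c'.
- move=> M x y [h1 h2 [e [e0 ey ex]]]; split.
    case=> g /vanishU[g0 gT] hg.
    have : rcobound P Q (e + g).
      apply: ac; split; first exact: vanishD.
      by move=> s Ps; rewrite codiffD cochainDE -ex // -hg // addF2.
    case: M x y h1 h2 e e0 ey ex g g0 gT hg
      => [|M] x y h1 h2 e e0 ey ex g g0 gT hg /= h.
      move=> s Ts; rewrite -ey //; have := h s (sTP Ts); rewrite cochainDE.
      by rewrite [g s]gT ?addr0 //; exact: sTP.
    case: h => k k0 hk; exists k; first by move=> s /sTP; exact: k0.
    move=> s Ts; rewrite -hk; last exact: sTP.
    by rewrite cochainDE [g s]gT ?addr0 ?ey //; exact: sTP.
  case: M x y h1 h2 e e0 ey ex => [|M] x y h1 h2 e e0 ey ex /=.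
    move=> y0; exists e => //; apply/vanishU; split=> // s _ Ts.
    by rewrite ey // y0.
  case=> g g0 hg; have [k k0 hk] := vanish_extend P g0.
  exists (e + codiff k); last by move=> s Ps; rewrite codiffD codiff_codiff addr0 ex.
  apply/vanishU; split; first by apply: vanishD => //; exact: codiff_vanish.
  by move=> s _ Ts; rewrite cochainDE ey // hg // (codiff_eq hk) // addF2.
- move=> M x y n [h1 h2 [e [e0 ey ex]]]; split; try exact: rcocycle_sq.
  have [_ xT] := proj1 (rcocycleU _) h1.
  (* A primitive of the square of [x] by [codiff_cup_codiff]; on [T], where [codiff e = x = 0], it
     restricts to [cup e e], the square of [y]. *)
  exists (cup e (codiff e) + cup e e); split.
  + by apply: vanishD; exact: cup_vanish.
  + move=> s Ts; rewrite cochainDE [X in X + _](_ : _ = 0) ?add0r.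
      exact: (cup_eq ey ey).
    rewrite (cup_eq (P := T) (f' := e) (g' := 0)) ?cup0r // => t Tt.
    by rewrite -ex ?xT //; exact: sTP.
  + by move=> s Ps; rewrite codiff_cup_codiff; apply: (cup_eq ex ex).
- case=> [|//] x _ hx; apply: (ac 0%N x); by case/rcocycleU: hx.
Qed.

Lemma corr_restr : racyclic R P (Q :|| T) -> corr 0 (CPair P Q) (CPair T Q).
Proof.
move=> ac; exists (fun M x y => [/\ rcocycle P Q x, rcocycle T Q y &
  rcobound T Q (x + y)]); split=> //=.
- by move=> M x y [].
- move=> M x hx; exists x; split=> //; last exact: rcobound_add2.
  exact: rcocycle_restr.
- move=> M y hy; have [y0 dy] := hy; have [e e0 he] := vanish_extend P y0.
  have [|g /vanishU[g0 gT] hg] := ac _ (codiff e).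
    apply/rcocycleU; split; first exact: rcocycle_codiff.
    by move=> s Ts; rewrite (codiff_eq he) // dy.
  exists (e + g); split=> //.
    split; first exact: vanishD.
    by move=> s Ps; rewrite codiffD cochainDE hg // addF2.
  apply: rcobound0 => s Ts; rewrite !cochainDE he // [g s]gT ?addr0 ?addF2 //.
  exact: sTP.
- move=> M x y x' y' [h1 h2 h3] [h1' h2' h3']; split; try exact: rcocycleD.
  by rewrite addrACA; exact: rcoboundD.
- move=> M x y [h1 h2 h3]; split.
    move=> hx; apply: rcobound_addl h3 _.
    case: M x y {h1 h2} hx => [|M] x y /=; first by move=> x0 s /sTP; exact: x0.
    by case=> g g0 hg; exists g => s /sTP; [exact: g0|exact: hg].
  move=> hy; have := rcobound_addr h3 hy.
  case: M x y {hy h2 h3} h1 => [|M] x y h1 /=.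
    by move=> x0; apply: (ac 0%N x); apply/rcocycleU.
  case=> g g0 hg; have [e e0 he] := vanish_extend P g0.
  have [|k /vanishU[k0 kT] hk] := ac _ (x + codiff e).
    apply/rcocycleU; split.
      by apply: rcocycleD => //; exact: rcocycle_codiff.
    by move=> s Ts; rewrite cochainDE hg // (codiff_eq he) // addF2.
  exists (e + k); first exact: vanishD.
  by move=> s Ps; rewrite codiffD cochainDE -hk // cochainDE addrC -addrA addF2 addr0.
- move=> M x y n [h1 h2 h3]; split; try exact: rcocycle_sq.
  by apply: rcobound_sqD => //; exact: rcocycle_restr.
Qed.

(** Exactness in the middle of the long exact sequence of the triple: make [f] vanish on [T] by a
    coboundary, then use [ac]. *)
Lemma racyclic_triple : racyclic R P (Q :|| T) -> racyclic R T Q -> racyclic R P Q.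
Proof.
move=> ac acT N f hf; have := acT _ _ (rcocycle_restr hf).
case: N f hf => [|N] f hf /=.
  by move=> f0; apply: (ac 0%N f); apply/rcocycleU.
case=> g g0 hg; have [e e0 he] := vanish_extend P g0.
have [|k /vanishU[k0 kT] hk] := ac _ (f + codiff e).
  apply/rcocycleU; split.
    by apply: rcocycleD => //; exact: rcocycle_codiff.
  by move=> s Ts; rewrite cochainDE hg // (codiff_eq he) // addF2.
exists (e + k); first exact: vanishD.
by move=> s Ps; rewrite codiffD cochainDE -hk // cochainDE addrC -addrA addF2 addr0.
Qed.

End OneSpace.

Lemma stdsimplex0 (t : stdsimplex R 0) : False.
Proof.
case: t => t ht; move: ht; rewrite inE => -[_].
by rewrite big_ord0 => /eqP; rewrite eq_sym oner_eq0.
Qed.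

Definition foldI (N : nat) (k : 'I_(N + N)) : 'I_N :=
  match fintype.split k with inl j => j | inr j => j end.

Definition top_weight (N : nat) (t : 'rV[R]_(N + N)) : R := \sum_k t 0 (rshift N k).

Lemma top_weight_continuous (N : nat) : continuous (@top_weight N).
Proof.
move=> t; have add_cont : continuous (fun x : R * R => x.1 + x.2).
  exact: add_continuous.
by apply: (continuous_big add_cont) => k _ u; exact: coord_continuous.
Qed.

Lemma top_weight_itv (N : nat) (t : stdsimplex R (N + N)) :
  0 <= top_weight (val t) <= 1.
Proof.
case: t => t /= h; have [t0 t1] : stdsimplex R (N + N) t by rewrite inE in h.
rewrite sumr_ge0 //= -t1 big_split_ord /= lerDr; exact: sumr_ge0.
Qed.

Section Homotopy.
Variable X : topologicalType.
Variable H : R * X -> X.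
Hypothesis cH : continuous H.

(* The simplex with N + N vertices maps onto the prism over the one with N
   vertices, (a, b) going to (|b|, a + b). *)
Definition prism_fun (N : nat) (s : simplex R X N) (t : stdsimplex R (N + N)) : X :=
  let _ := cH in
  H (top_weight (val t), s (amap (stochastic_vertex R (@foldI N)) t)).

Lemma prism_fun_continuous N (s : simplex R X N) : continuous (prism_fun s).
Proof.
move=> t; apply: (@continuous_comp _ _ _ (fun t : stdsimplex R (N + N) =>
  (top_weight (val t), s (amap (stochastic_vertex R (@foldI N)) t))) H); last exact: cH.
apply: pair_continuous => u.
  apply: (@continuous_comp _ _ _ (val : stdsimplex R (N + N) -> 'rV[R]_(N + N))
    (@top_weight N)); first exact: initial_continuous.
  exact: top_weight_continuous.
by apply: continuous_comp; exact: cts_fun.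
Qed.

HB.instance Definition _ N (s : simplex R X N) :=
  isContinuous.Build _ _ (prism_fun s) (prism_fun_continuous (s := s)).

Definition prism_simplex N (s : simplex R X N) : simplex R X (N + N) := prism_fun s.

Lemma vertex_mxE (p n : nat) (th : 'I_p -> 'I_n) (t : 'rV[R]_p) (i : 'I_n) :
  (t *m vertex_mx R th) 0 i = \sum_(j | th j == i) t 0 j.
Proof.
rewrite mxE [RHS]big_mkcond /=; apply: eq_bigr => j _; rewrite mxE.
by case: eqP; rewrite ?mulr1 ?mulr0.
Qed.

Lemma prism_face N (s : simplex R X N.+1) (i : 'I_N.+1) :
  prism_simplex (sface (lift i) s) =
  scomp (prism_simplex s) (stochastic_vertex R (dmap (lift i))).
Proof.
apply/continuousEP => t /=; congr (H (_, s _)); last first.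
  apply: val_inj => /=; rewrite -!mulmxA !vertex_mx_comp; congr (_ *m vertex_mx R _).
  apply/funext => k /=; rewrite /foldI /dmap; case: (fintype.split k) => j.
    by rewrite -[lshift N.+1 _]/(unsplit (inl (lift i j))) unsplitK.
  by rewrite -[rshift N.+1 _]/(unsplit (inr (lift i j))) unsplitK.
rewrite /top_weight; under [RHS]eq_bigr do rewrite vertex_mxE.
rewrite (exchange_big_dep predT) //= big_split_ord /=.
rewrite [X in _ = X + _]big1 ?add0r; last first.
  move=> j _; apply: big1 => k; rewrite /dmap -[lshift N j]/(unsplit (inl j)) unsplitK.
  by rewrite eq_lrshift.
apply: eq_bigr => j _; rewrite /dmap -[rshift N j in RHS]/(unsplit (inr j)).
rewrite (big_pred1 (lift i j)) // => k; rewrite unsplitK.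
by rewrite eq_sym (inj_eq (@rshift_inj _ _)).
Qed.

Variable g : continuousType X X.
Hypothesis H0 : forall x, H (0, x) = x.
Hypothesis H1 : forall x, H (1, x) = g x.

Lemma prism_bot N (s : simplex R X N) :
  scomp (prism_simplex s) (stochastic_vertex R (lshift N)) = s.
Proof.
apply/continuousEP => t; rewrite -[RHS]H0 /=; congr (H (_, s _)).
  rewrite /top_weight; apply: big1 => k _; rewrite vertex_mxE big_pred0 // => j.
  by rewrite eq_lrshift.
apply: val_inj => /=; rewrite -mulmxA vertex_mx_comp -[RHS]mulmx1; congr (_ *m _).
apply/matrixP => i j; rewrite !mxE /= /foldI -[lshift N i]/(unsplit (inl i)) unsplitK.
by case: (i == j).
Qed.

Lemma prism_top N (s : simplex R X N) :
  scomp (prism_simplex s) (stochastic_vertex R (@rshift N N)) = spush g s.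
Proof.
apply/continuousEP => t /=; rewrite -H1; congr (H (_, s _)).
  case: t => t ht /=; have [t0 t1] : stdsimplex R N t by rewrite inE in ht.
  rewrite -t1 /top_weight; apply: eq_bigr => k _; rewrite vertex_mxE.
  by rewrite (big_pred1 k) // => j; rewrite (inj_eq (@rshift_inj _ _)).
apply: val_inj => /=; rewrite -mulmxA vertex_mx_comp -[RHS]mulmx1; congr (_ *m _).
apply/matrixP => i j; rewrite !mxE /= /foldI -[rshift N i]/(unsplit (inr i)) unsplitK.
by case: (i == j).
Qed.

Definition stable (P : set (set X)) : Prop := forall A, P A ->
  forall t x, 0 <= t <= 1 -> A x -> A (H (t, x)).

Lemma Sing_prism P N (s : simplex R X N) : stable P -> Sing P s -> Sing P (prism_simplex s).
Proof.
move=> st [A PA hA]; exists A => // t; apply: st => //; exact: top_weight_itv.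
Qed.

Lemma homotopy_cobound P Q N (f : cochain R X N) :
  stable P -> stable Q -> rcocycle P Q f ->
  rcobound P Q (f + pull g f).
Proof.
move=> sP sQ [f0 df]; case: N f f0 df => [|N] f f0 df.
  (* There is only one simplex without vertices, so [g] fixes it. *)
  move=> s _; rewrite cochainDE /pull (_ : spush g s = s) ?addF2 //.
  by apply/continuousEP => t; case: (stdsimplex0 t).
exists (fun s => evc (prism R N) (afun f (prism_simplex s))).
  move=> s Ps Qs; rewrite /evc big1_seq // => M /= Ms.
  have h := stochastics_prism Ms; rewrite (afunE _ _ h).
  by apply: f0; apply: Sing_scomp; exact: Sing_prism.
move=> s Ps; have hs := @stochastics_prism R N.+1.
have : evc (prism R N.+1) (bd (afun f (prism_simplex s))) = 0.
  rewrite /evc big1_seq // => M /= Ms.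
  have h := stochastics_prism Ms; rewrite -(codiff_scomp _ _ h) df //.
  by apply: Sing_scomp; exact: Sing_prism.
rewrite bd_prism (afunE _ _ (stochastic_vertex R _)) prism_bot.
rewrite (afunE _ _ (stochastic_vertex R _)) prism_top => e.
rewrite cochainDE; apply/eqP; rewrite -subr_eq0 -[X in _ == X]e; apply/eqP.
congr (_ + _); rewrite oppr_pchar2 ?pchar_Fp //; apply: eq_bigr => i _.
rewrite prism_face; apply: eq_big_seq => M Ms.
by rewrite afun_scomp //; exact: stochastics_prism Ms.
Qed.

End Homotopy.
End Corr.

(** * Homotopy invariance *)

Section HomotopyEquivalence.
Variable R : realType.

Lemma pull_pull (X Y Z : topologicalType) (a : continuousType X Y) (b : continuousType Y Z)
  N (f : cochain R Z N) : pull a (pull b f) = pull (b \o a) f.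
Proof. by apply/funext => s; congr f; exact/continuousEP. Qed.

Lemma pull_id (X : topologicalType) (a : continuousType X X) N (f : cochain R X N) :
  (forall x, a x = x) -> pull a f = f.
Proof. by move=> h; apply/funext => s; congr f; apply/continuousEP => t /=; exact: h. Qed.

Lemma corr_heq (X Y : topologicalType) (P Q : set (set X)) (P' Q' : set (set Y))
    (a : continuousType X Y) (b : continuousType Y X) :
  sends a P P' -> sends a Q Q' -> sends b P' P -> sends b Q' Q ->
  (forall N (f : cochain R X N), rcocycle P Q f -> rcobound P Q (f + pull a (pull b f))) ->
  (forall N (f : cochain R Y N), rcocycle P' Q' f -> rcobound P' Q' (f + pull b (pull a f))) ->
  corr R 0 (CPair P Q) (CPair P' Q').
Proof.
move=> aP aQ bP bQ hX hY.
exists (fun M x y => [/\ rcocycle P Q x, rcocycle P' Q' y &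
  rcobound P Q (x + pull a y)]); split=> //=.
- by move=> M x y [].
- by move=> M x hx; exists (pull b x); split=> //; [exact (rcocycle_pull bP bQ hx)|exact: hX].
- move=> M y hy; exists (pull a y); split=> //; first exact (rcocycle_pull aP aQ hy).
  exact: rcobound_add2.
- move=> M x y x' y' [h1 h2 h3] [h1' h2' h3']; split; try exact: rcocycleD.
  by rewrite pullD addrACA; exact: rcoboundD.
- move=> M x y [h1 h2 h3]; split=> [hx|hy].
    have := rcobound_pull bP bQ (rcobound_addl h3 hx).
    by apply: rcobound_addr; exact: hY.
  by apply: (rcobound_addr h3); exact (rcobound_pull aP aQ hy).
- move=> M x y n [h1 h2 h3]; split; try exact: rcocycle_sq.
  rewrite -cup_pull; apply: rcobound_sqD => //.
  exact (rcocycle_pull aP aQ h2).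
Qed.

Section Linear.
Variable X : normedModType R.
Implicit Types (P Q : set (set X)) (g : continuousType X X).

(** All homotopies are straight lines from the identity to a map [g], so that stability of a set
    under them is a condition on the segments from [x] to [g x]. *)
Definition lhtpy g (p : R * X) : X := (1 - p.1) *: p.2 + p.1 *: g p.2.

Lemma lhtpy_continuous g : continuous (lhtpy g).
Proof.
move=> p; apply: cvgD.
  apply: (@cvgZ _ _ _ (nbhs p)); last exact: cvg_snd.
  by apply: cvgB; [exact: cvg_cst | exact: cvg_fst].
apply: (@cvgZ _ _ _ (nbhs p)); first exact: cvg_fst.
apply: (@continuous_comp _ _ _ snd g); first exact: cvg_snd.
exact: cts_fun.
Qed.

Lemma lhtpy0 g x : lhtpy g (0, x) = x.
Proof. by rewrite /lhtpy subr0 scale1r scale0r addr0. Qed.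

Lemma lhtpy1 g x : lhtpy g (1, x) = g x.
Proof. by rewrite /lhtpy subrr scale0r scale1r add0r. Qed.

Definition lstable g P : Prop := stable (lhtpy g) P.

Lemma lstable_sends g P : lstable g P -> sends g P P.
Proof.
by move=> h A PA; exists A => // x Ax; rewrite -lhtpy1; apply: h; rewrite ?ler01 ?lexx.
Qed.

Lemma lhtpy_cobound g P Q N (f : cochain R X N) :
  lstable g P -> lstable g Q -> rcocycle P Q f -> rcobound P Q (f + pull g f).
Proof.
exact: (homotopy_cobound (lhtpy_continuous (g := g)) (lhtpy0 g) (lhtpy1 g)).
Qed.

(** The map [g] and the inclusion are inverse homotopy equivalences: the same straight-line homotopy
    serves in the large pair and in the small one. *)
Lemma corr_retract g P Q P' Q' :
  sends idfun P' P -> sends idfun Q' Q -> sends g P P' -> sends g Q Q' ->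
  lstable g P -> lstable g Q -> lstable g P' -> lstable g Q' ->
  corr R 0 (CPair P Q) (CPair P' Q').
Proof.
move=> iP iQ gP gQ sP sQ sP' sQ'.
have id_pull N (f : cochain R X N) : pull (idfun : continuousType X X) f = f.
  exact: pull_id.
apply: (@corr_heq X X P Q P' Q' g (idfun : continuousType X X)) => // N f h;
  rewrite id_pull; exact: lhtpy_cobound h.
Qed.

Lemma racyclic_htpy g P Q P' Q' :
  sends idfun P' P -> sends idfun Q' Q -> sends g P P' -> sends g Q Q' ->
  lstable g P -> lstable g Q -> racyclic R P' Q' -> racyclic R P Q.
Proof.
move=> iP iQ gP gQ sP sQ ac N f hf; apply: (rcobound_addr (lhtpy_cobound sP sQ hf)).
apply: (rcobound_pull gP gQ); apply: ac.
have := rcocycle_pull (g := idfun : continuousType X X) iP iQ hf.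
by rewrite pull_id.
Qed.

(** A cocycle is cohomologous to its pullback along [g], which is zero because [g] sends the
    simplices of [P] to simplices of [Q]. *)
Lemma racyclic_push g P Q :
  sends g P Q -> lstable g P -> lstable g Q -> racyclic R P Q.
Proof.
move=> gPQ sP sQ N f hf; apply: (rcobound_addr (lhtpy_cobound sP sQ hf)).
apply: rcobound0 => s Ps; apply: (proj1 hf); last exact: Sing_spush gPQ _.
exact: Sing_spush (lstable_sends sP) _.
Qed.

Lemma racyclic_contract g (A : set X) (z : X) : A z -> (forall x, g x = z) ->
  lstable g [set A]%classic -> racyclic R [set A]%classic set0.
Proof.
move=> Az gz sA N f hf; apply: (rcobound_addr (lhtpy_cobound sA _ hf)).
  by move=> ? [].
have cz M : continuous (fun _ : stdsimplex R M => z) by exact: cst_continuous.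
pose cs M : simplex R X M := HB.pack (fun _ : stdsimplex R M => z)
  (isContinuous.Build _ _ _ (cz M)).
have Acs M : Sing [set A]%classic (cs M) by exists A => // t; exact: Az.
have fc M (th : 'I_M -> 'I_M.+1) : sface th (cs M.+1) = cs M by apply/continuousEP => t.
have gf s : pull g f s = f (cs N).
  by congr f; apply/continuousEP => t /=; exact: gz.
case: hf => _ /(_ _ (Acs N.+1)); rewrite /codiff.
under eq_bigr do rewrite fc.
rewrite sumr_const card_ord => e.
case: N f e gf => [|N] f e gf /=; first by move=> s _; rewrite gf -e.
(* The coboundary of a constant cochain on [N] vertices is [N.+1] times the constant. By [e], [N.+2]
   times the value of [f] is 0, so mod 2 this coboundary is the value itself. *)
exists (fun=> f (cs N.+1)); first by move=> s _ [].
move=> s _; rewrite gf /codiff sumr_const card_ord.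
by apply: (addIr (f (cs N.+1))); rewrite addF2 -mulrSr e.
Qed.

End Linear.
End HomotopyEquivalence.

(** * Continuous maps of matrices acting on one row *)

Section MatrixTopology.
Variable R : realType.

Lemma continuous_mx (T : topologicalType) (m n : nat) (f : T -> 'M[R]_(m, n)) :
  (forall i j, continuous (fun x => f x i j)) -> continuous f.
Proof.
move=> cf t A [P HP HA]; apply: (filterS (P := fun s : T =>
  forall ij : 'I_m * 'I_n, P ij.1 ij.2 (f s ij.1 ij.2))).
  by move=> s Hs; apply: HA => i j; exact: (Hs (i, j)).
apply: (@filter_forall _ _ (fun ij (s : T) =>
  P ij.1 ij.2 (f s ij.1 ij.2)) (nbhs t)) => -[i j] /=.
exact: (cf i j t (P i j) (HP i j)).
Qed.

Definition rowmap (m : nat) (i : 'I_m) (u v : R * R -> R) (z : 'M[R]_(m, 2)) :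
    'M[R]_(m, 2) :=
  \matrix_(k, l) if k == i then (if l == 0 then u else v) (z i 0, z i 1) else z k l.

Lemma rowmap_continuous (m : nat) (i : 'I_m) (u v : R * R -> R) :
  continuous u -> continuous v -> continuous (rowmap i u v).
Proof.
move=> cu cv; apply: continuous_mx => k l.
have -> : (fun z : 'M[R]_(m, 2) => rowmap i u v z k l) =
   if k == i then (if l == 0 then u else v) \o (fun z : 'M[R]_(m, 2) => (z i 0, z i 1))
   else (fun z : 'M[R]_(m, 2) => z k l).
  by apply/funext => z; rewrite mxE; case: (k == i).
case: (k == i) => z; last exact: coord_continuous.
apply: continuous_comp; last by case: (l == 0); [exact: cu|exact: cv].
by apply: pair_continuous => y; exact: coord_continuous.
Qed.

End MatrixTopology.

Section CoordinateStep.
Variables (R : realType) (m : nat) (i : 'I_m).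
Local Notation mx := ('M[R]_(m, 2)).
Variables (G1 G2 : set mx) (Q0 : set (set mx)).

Definition off_row (G : set mx) : Prop :=
  forall z z' : mx, (forall k l, k != i -> z k l = z' k l) -> G z -> G z'.

Hypotheses (fG1 : off_row G1) (fG2 : off_row G2).
Hypothesis fQ0 : forall A, Q0 A -> off_row A.

Implicit Types M E F D : R -> R -> Prop.

(* The part of a polyhedral product seen by row [i]: the pair (M, E) for that row,
   [G1] (resp. [G2]) being the condition on the other rows when [i] belongs
   (resp. does not belong) to the simplex; cohomology is taken relative to [F] in
   row [i], and to [Q0] in the other rows. *)
Definition psp M E : set mx :=
  fun z => (M (z i 0) (z i 1) /\ G1 z) \/ (E (z i 0) (z i 1) /\ G2 z).
Definition fsp F : set mx := fun z => F (z i 0) (z i 1).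
Definition ffam F : set (set mx) := ([set fsp F] `|` Q0)%classic.
Definition cp M E F : cpair := CPair [set psp M E]%classic (ffam F).
Definition cacyclic M E F : Prop := racyclic R [set psp M E]%classic (ffam F).

Definition sub D D' : Prop := forall x y, D x y -> D' x y.

Variables (u v : R * R -> R).
Hypotheses (cu : continuous u) (cv : continuous v).

Definition maps D D' : Prop := forall x y, D x y -> D' (u (x, y)) (v (x, y)).
Definition cstable D : Prop := forall t x y, 0 <= t <= 1 -> D x y ->
  D ((1 - t) * x + t * u (x, y)) ((1 - t) * y + t * v (x, y)).

Definition rmap : mx -> mx := rowmap i u v.

HB.instance Definition _ := isContinuous.Build _ _ rmap (rowmap_continuous cu cv).

Lemma rmap_other z k l : k != i -> rmap z k l = z k l.
Proof. by move=> ki; rewrite mxE (negbTE ki). Qed.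

Lemma off_row_rmap G z : off_row G -> G z -> G (rmap z).
Proof. by move=> fG; apply: fG => k l ki; rewrite rmap_other. Qed.

Lemma rmap_i z : rmap z i 0 = u (z i 0, z i 1) /\ rmap z i 1 = v (z i 0, z i 1).
Proof. by rewrite !mxE eqxx. Qed.

Lemma off_row_lhtpy G t z : off_row G -> G z -> G (lhtpy rmap (t, z)).
Proof.
move=> fG; apply: fG => k l ki; rewrite /lhtpy !mxE /= (negbTE ki).
by rewrite -mulrDl subrK mul1r.
Qed.

Lemma lhtpy_i D t z : cstable D -> 0 <= t <= 1 -> fsp D z -> fsp D (lhtpy rmap (t, z)).
Proof.
move=> sD ht Dz; rewrite /fsp /lhtpy !mxE !eqxx /=; exact: sD.
Qed.

Lemma lstable_psp M E : cstable M -> cstable E -> lstable rmap [set psp M E]%classic.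
Proof.
move=> sM sE _ -> t z ht [[Mz Gz]|[Ez Gz]]; [left|right];
  by split; [exact: lhtpy_i|exact: off_row_lhtpy].
Qed.

Lemma lstable_ffam F : cstable F -> lstable rmap (ffam F).
Proof.
move=> sF A [->|QA] t z ht; first exact: lhtpy_i.
by apply: off_row_lhtpy; exact: fQ0.
Qed.

Lemma sends_psp M E M' E' : maps M M' -> maps E E' ->
  sends rmap [set psp M E]%classic [set psp M' E']%classic.
Proof.
move=> hM hE _ ->; exists (psp M' E') => // z.
have [e1 e2] := rmap_i z.
by move=> [[h Gz]|[h Gz]]; [left|right]; rewrite e1 e2; split;
  [exact: hM|exact: off_row_rmap|exact: hE|exact: off_row_rmap].
Qed.

Lemma sends_ffam F F' : maps F F' -> sends rmap (ffam F) (ffam F').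
Proof.
move=> hF A [->|QA].
  exists (fsp F'); first by left.
  by move=> z h; have [e1 e2] := rmap_i z; rewrite /fsp e1 e2; exact: hF.
by exists A; [right|move=> z; apply: off_row_rmap; exact: fQ0].
Qed.

Lemma sends_id_psp M E M' E' : sub M M' -> sub E E' ->
  sends idfun [set psp M E]%classic [set psp M' E']%classic.
Proof.
move=> hM hE _ ->; exists (psp M' E') => // z.
by move=> [[/hM ? ?]|[/hE ? ?]]; [left|right].
Qed.

Lemma sends_id_ffam F F' : sub F F' -> sends idfun (ffam F) (ffam F').
Proof.
move=> hF A [->|QA]; last by exists A => //; right.
by exists (fsp F'); [left|move=> z; exact: hF].
Qed.

Lemma cp_retract M E F M' E' F' :
  sub M' M -> sub E' E -> sub F' F -> maps M M' -> maps E E' -> maps F F' ->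
  cstable M -> cstable E -> cstable F -> cstable M' -> cstable E' -> cstable F' ->
  corr R 0 (cp M E F) (cp M' E' F').
Proof.
move=> iM iE iF hM hE hF sM sE sF sM' sE' sF'.
by apply: (@corr_retract R _ rmap); [apply: sends_id_psp|apply: sends_id_ffam|
  apply: sends_psp|apply: sends_ffam|apply: lstable_psp|apply: lstable_ffam|
  apply: lstable_psp|apply: lstable_ffam].
Qed.

Lemma cacyclic_htpy M E F M' E' F' :
  sub M' M -> sub E' E -> sub F' F -> maps M M' -> maps E E' -> maps F F' ->
  cstable M -> cstable E -> cstable F -> cacyclic M' E' F' -> cacyclic M E F.
Proof.
move=> iM iE iF hM hE hF sM sE sF ac.
by apply: (@racyclic_htpy R _ rmap _ _ _ _ _ _ _ _ _ _ ac);
  [apply: sends_id_psp|apply: sends_id_ffam|apply: sends_psp|apply: sends_ffam|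
   apply: lstable_psp|apply: lstable_ffam].
Qed.

Lemma cacyclic_push M E F : maps M F -> maps E F ->
  cstable M -> cstable E -> cstable F -> cacyclic M E F.
Proof.
move=> hM hE sM sE sF; apply: (@racyclic_push R _ rmap);
  [|by apply: lstable_psp|by apply: lstable_ffam].
move=> _ ->; exists (fsp F); first by left.
move=> z; have [e1 e2] := rmap_i z; rewrite /fsp e1 e2.
by move=> [[/hM]|[/hE]].
Qed.

End CoordinateStep.

Section CoordinateStep2.
Variables (R : realType) (m : nat) (i : 'I_m).
Local Notation mx := ('M[R]_(m, 2)).
Variables (G1 G2 : set mx) (Q0 : set (set mx)).
Implicit Types M E F D : R -> R -> Prop.
Local Notation cp := (cp i G1 G2 Q0).
Local Notation cacyclic := (cacyclic i G1 G2 Q0).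
Local Notation psp := (psp i G1 G2).
Local Notation ffam := (ffam i Q0).

Definition inter D D' : R -> R -> Prop := fun x y => D x y /\ D' x y.

Lemma psp_inter M E D z : psp (inter M D) (inter E D) z <-> psp M E z /\ fsp i D z.
Proof. by rewrite /psp /inter /fsp; tauto. Qed.

Lemma Sing_psp_inter M E D N (s : simplex R mx N) :
  Sing [set psp (inter M D) (inter E D)]%classic s ->
  Sing [set psp M E]%classic s.
Proof. by case=> _ -> h; exists (psp M E) => // t; have /psp_inter[] := h t. Qed.

(** Enlarging [F'] to [F] amounts to adjoining the polyhedral product whose row cells are cut down
    to [F]. That product has the same form, so the exact sequences used on one row stay within pairs
    of type [cp]. *)
Lemma Sing_ffamU M E F F' N (s : simplex R mx N) : sub F' F ->
  Sing [set psp M E]%classic s ->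
  (Sing (ffam F) s <->
   Sing (ffam F' `|` [set psp (inter M F) (inter E F)])%classic s).
Proof.
move=> hF [_ -> hs]; split.
  case=> A [->|QA] h; last by exists A => //; left; right.
  exists (psp (inter M F) (inter E F)); first by right.
  by move=> t; apply/psp_inter; split; [exact: hs|exact: h].
case=> A [[->|QA]|->] h.
- by exists (fsp i F); [left|move=> t; apply: hF; exact: h].
- by exists A => //; right.
- by exists (fsp i F); [left|move=> t; have /psp_inter[] := h t].
Qed.

Lemma cp_ext M E F M' E' F' :
  (forall x y, M x y <-> M' x y) -> (forall x y, E x y <-> E' x y) ->
  (forall x y, F x y <-> F' x y) -> cp M E F = cp M' E' F'.
Proof.
move=> hM hE hF; congr (cp _ _ _); apply/funext => x; apply/funext => y; exact/propext.
Qed.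

Lemma cp_widen M E F F' : sub F' F -> cacyclic (inter M F) (inter E F) F' ->
  corr R 0 (cp M E F) (cp M E F').
Proof.
move=> hF ac; apply: corr_trans0 (corr_widen _ ac); last exact: Sing_psp_inter.
by apply: corr_ext => // N s; exact: Sing_ffamU.
Qed.

Lemma cp_delta M E F F' : sub F' F -> cacyclic M E F' ->
  corr R 1 (cp M E F) (cp (inter M F) (inter E F) F').
Proof.
move=> hF ac; apply: corr_trans0 (corr_delta _ ac); last exact: Sing_psp_inter.
by apply: corr_ext => // N s; exact: Sing_ffamU.
Qed.

Lemma cacyclic_triple M E F F' : sub F' F -> cacyclic M E F ->
  cacyclic (inter M F) (inter E F) F' -> cacyclic M E F'.
Proof.
move=> hF ac acF; apply: (@racyclic_triple R mx _ _ _ _ _ acF).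
  exact: Sing_psp_inter.
move=> N f [f0 df]; have h : rcocycle [set psp M E]%classic (ffam F) f.
  by split=> // s Ps Fs; apply: f0 => //; apply/(Sing_ffamU hF).
have := ac N f h; case: N f f0 df h => [|N] f f0 df h //= [g g0 hg]; exists g => //.
by move=> s Ps /(Sing_ffamU hF Ps); exact: g0.
Qed.

Lemma coords_continuous : continuous (fun z : mx => (z i 0, z i 1)).
Proof. by apply: pair_continuous => z; exact: coord_continuous. Qed.

(** The interiors of [U] and [F] cover row [i], so [racyclic_cover] kills the cohomology relative to
    both, and restriction to [U] is an isomorphism. *)
Lemma cp_excise M E F U :
  (forall x y, M x y \/ E x y ->
    nbhs (x, y) [set p | U p.1 p.2]%classic \/ nbhs (x, y) [set p | F p.1 p.2]%classic) ->
  corr R 0 (cp M E F) (cp (inter M U) (inter E U) F).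
Proof.
move=> hU; apply: corr_restr; first exact: Sing_psp_inter.
apply: racyclic_cover; first by move=> _ _; exists (fsp i F); left; left.
move=> _ z -> Az.
have [|h|h] := hU (z i 0) (z i 1); first by case: Az => -[]; [left|right].
  exists (psp (inter M U) (inter E U)); first by right.
  exists [set z : mx | U (z i 0) (z i 1)]%classic; first exact: (coords_continuous h).
  by move=> z' Az' Uz'; apply/psp_inter.
exists (fsp i F); first by left; left.
by exists [set z : mx | F (z i 0) (z i 1)]%classic; first exact: (coords_continuous h).
Qed.

End CoordinateStep2.

(** * Desuspension of one coordinate *)

Section Convexity.
Variables (R : realType) (t a x w : R).
Hypothesis ht : 0 <= t <= 1.

Lemma cvx_ge : a <= x -> a <= w -> a <= (1 - t) * x + t * w.
Proof. by move: ht => /andP[? ?] *; nra. Qed.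
Lemma cvx_le : x <= a -> w <= a -> (1 - t) * x + t * w <= a.
Proof. by move: ht => /andP[? ?] *; nra. Qed.
Lemma cvx_gt : a < x -> a < w -> a < (1 - t) * x + t * w.
Proof.
move: ht => /andP[t0 t1] ax aw; have -> : a = (1 - t) * a + t * a by ring.
have [->|tn] := eqVneq t 0; first by rewrite !mul0r !addr0 subr0 !mul1r.
apply: ler_ltD; first by rewrite ler_wpM2l ?subr_ge0 // ltW.
by rewrite ltr_pM2l // lt_def tn.
Qed.
Lemma cvx_lt : x < a -> w < a -> (1 - t) * x + t * w < a.
Proof.
move: ht => /andP[t0 t1] ax aw; have -> : a = (1 - t) * a + t * a by ring.
have [->|tn] := eqVneq t 0; first by rewrite !mul0r !addr0 subr0 !mul1r.
apply: ler_ltD; first by rewrite ler_wpM2l ?subr_ge0 // ltW.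
by rewrite ltr_pM2l // lt_def tn.
Qed.
Lemma cvx_eq : x = a -> w = a -> (1 - t) * x + t * w = a.
Proof. by move=> -> ->; ring. Qed.
End Convexity.

Lemma max_continuous_fun (R : realType) (T : topologicalType) (f g : T -> R) :
  continuous f -> continuous g -> continuous (fun x => Num.max (f x) (g x)).
Proof.
move=> cf cg x.
rewrite (_ : (fun x => _) = (fun x => (f x + g x + `|f x - g x|) / 2)); last first.
  by apply/funext => y; rewrite maxr_absE.
apply: cvgM; last exact: cvg_cst.
apply: cvgD; first by apply: cvgD; [exact: cf|exact: cg].
by apply: cvg_norm; apply: cvgB; [exact: cf|exact: cg].
Qed.

Lemma add_continuous_fun (R : realType) (T : topologicalType) (f g : T -> R) :
  continuous f -> continuous g -> continuous (fun x => f x + g x).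
Proof. by move=> cf cg x; apply: cvgD; [exact: cf|exact: cg]. Qed.

Lemma mul_continuous_fun (R : realType) (T : topologicalType) (f g : T -> R) :
  continuous f -> continuous g -> continuous (fun x => f x * g x).
Proof. by move=> cf cg x; apply: cvgM; [exact: cf|exact: cg]. Qed.

Lemma div_continuous_fun (R : realType) (T : topologicalType) (f g : T -> R) :
  (forall x, g x != 0) -> continuous f -> continuous g ->
  continuous (fun x => f x / g x).
Proof. by move=> g0 cf cg x; apply: cvgM; [exact: cf|apply: cvgV; [|exact: cg]]. Qed.

(** * Cells in the plane and the radial retraction *)

Section Cells.
Variable R : realType.
Implicit Types (x y t : R) (p : R * R).

Definition whole x y := True.
Definition disk2 x y := x ^+ 2 + y ^+ 2 <= 1 : Prop.
Definition circ2 x y := x ^+ 2 + y ^+ 2 = 1.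
Definition base2 x y := x = 1 /\ y = 0.
Definition outer x y := 1 <= x ^+ 2 + y ^+ 2 : Prop.
(** The complement of an open square, not of a disk: a horizontal strip cuts it into two convex half
    strips. *)
Definition box x y := (1 <= x \/ x <= -1) \/ (1 <= y \/ y <= -1).
(** A convex set around the base point (1, 0), contained in [outer] and [box] and preserved by
    doubling, which the base point is not. *)
Definition quad x y := 1 <= x /\ 0 <= y.
Definition upper x y := -1 < y : Prop.
Definition lower x y := y < 1 : Prop.
Definition strip x y := -1 < y /\ y < 1.
Definition rstrip x y := 1 <= x /\ strip x y.
Definition pos x y := 0 < x : Prop.
Definition left1 x y := x < 1 : Prop.
Definition lstrip x y := x <= -1 /\ strip x y.

(** Division by [rad] is the radial retraction of the plane onto the disk; the maximum with 1 makes
    it the identity on the disk and avoids dividing by 0. *)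
Definition rad p : R := Num.max 1 (Num.sqrt (p.1 ^+ 2 + p.2 ^+ 2)).

Lemma rad_ge1 p : 1 <= rad p.
Proof. by rewrite /rad le_max lexx. Qed.

Lemma rad_gt0 p : 0 < rad p.
Proof. exact: lt_le_trans ltr01 (rad_ge1 p). Qed.

Lemma rad_in x y : x ^+ 2 + y ^+ 2 <= 1 -> rad (x, y) = 1.
Proof. by move=> h; rewrite /rad max_l //= -[leRHS]sqrtr1 ler_sqrt. Qed.

Lemma rad_out x y : 1 <= x ^+ 2 + y ^+ 2 -> rad (x, y) ^+ 2 = x ^+ 2 + y ^+ 2.
Proof.
move=> h; rewrite /rad max_r /=; last by rewrite -[leLHS]sqrtr1 ler_sqrt //; lra.
by rewrite sqr_sqrtr // (le_trans ler01).
Qed.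

Lemma rad_le x y : x ^+ 2 + y ^+ 2 <= rad (x, y) ^+ 2.
Proof.
have [/ltW h|h] := ltP (x ^+ 2 + y ^+ 2) 1; first by rewrite rad_in // expr1n.
by rewrite rad_out.
Qed.

Lemma rad_continuous : continuous rad.
Proof.
apply: max_continuous_fun => p; first exact: cvg_cst.
apply: (@continuous_comp _ _ _ (fun p : R * R => p.1 ^+ 2 + p.2 ^+ 2) Num.sqrt).
  apply: cvgD.
    by under eq_fun do rewrite expr2; apply: cvgM; exact: cvg_fst.
  by under eq_fun do rewrite expr2; apply: cvgM; exact: cvg_snd.
exact: sqrt_continuous.
Qed.

Definition rx p : R := p.1 / rad p.
Definition ry p : R := p.2 / rad p.

Lemma rx_continuous : continuous rx.
Proof.
apply: div_continuous_fun; [by move=> p; rewrite gt_eqF // rad_gt0| |exact: rad_continuous].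
by move=> p; exact: cvg_fst.
Qed.

Lemma ry_continuous : continuous ry.
Proof.
apply: div_continuous_fun; [by move=> p; rewrite gt_eqF // rad_gt0| |exact: rad_continuous].
by move=> p; exact: cvg_snd.
Qed.

Lemma fst_continuous : continuous (fst : R * R -> R).
Proof. by move=> p; exact: cvg_fst. Qed.
Lemma snd_continuous : continuous (snd : R * R -> R).
Proof. by move=> p; exact: cvg_snd. Qed.
Lemma cst2_continuous (a : R) : continuous (fun _ : R * R => a).
Proof. exact: cst_continuous. Qed.
Lemma dbl_fst_continuous : continuous (fun p : R * R => 2 * p.1).
Proof. by move=> p; apply: cvgM; [exact: cvg_cst|exact: cvg_fst]. Qed.
Lemma dbl_snd_continuous : continuous (fun p : R * R => 2 * p.2).
Proof. by move=> p; apply: cvgM; [exact: cvg_cst|exact: cvg_snd]. Qed.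

End Cells.

(* Row [i] goes from the disk and circle relative to 1 to ([strip], [lstrip])
   relative to [pos], losing one degree: [E] is first enlarged to the complement of
   an open box.  The plane relative to the upper half plane is then excised to the
   lower half plane relative to a strip in which [E] has two components; the
   connecting map of [step_delta] is an isomorphism because the lower half plane
   contracts onto the right component of [E], which disappears in turn. *)
Section Step.
Variables (R : realType) (m : nat) (i : 'I_m).
Local Notation mx := ('M[R]_(m, 2)).
Variables (G1 G2 : set mx) (Q0 : set (set mx)).
Hypotheses (fG1 : off_row i G1) (fG2 : off_row i G2).
Hypothesis fQ0 : forall A, Q0 A -> off_row i A.
Local Notation cp := (cp i G1 G2 Q0).
Local Notation cacyclic := (cacyclic i G1 G2 Q0).
Local Notation cretract cu cv := (@cp_retract R m i G1 G2 Q0 fG1 fG2 fQ0 _ _ cu cv).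
Local Notation chtpy cu cv := (@cacyclic_htpy R m i G1 G2 Q0 fG1 fG2 fQ0 _ _ cu cv).
Local Notation cpush cu cv := (@cacyclic_push R m i G1 G2 Q0 fG1 fG2 fQ0 _ _ cu cv).
Local Notation cst a := (@cst2_continuous R a).
Local Notation fst_c := (@fst_continuous R).
Local Notation snd_c := (@snd_continuous R).

Lemma step_disk : corr R 0 (cp (@disk2 R) (@circ2 R) (@base2 R))
  (cp (@whole R) (@outer R) (@base2 R)).
Proof.
apply: corr_sym; apply: (cretract (@rx_continuous R) (@ry_continuous R)).
- by [].
- by move=> x y; rewrite /circ2 /outer => ->.
- by [].
- move=> x y _; rewrite /disk2 /rx /ry /= !exprMn -mulrDl exprVn.
  by rewrite ler_pdivrMr ?exprn_gt0 ?rad_gt0 // mul1r rad_le.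
- move=> x y; rewrite /outer /circ2 /rx /ry /= => h.
  rewrite !exprMn -mulrDl exprVn rad_out // divff // gt_eqF //.
  exact: lt_le_trans ltr01 h.
- move=> x y [-> ->]; rewrite /base2 /rx /ry /= rad_in ?divr1 //.
  by rewrite expr1n expr0n addr0.
- by [].
- move=> t x y /andP[t0 t1]; rewrite /outer /rx /ry /= => h.
  set n := rad (x, y); set l := (1 - t) + t / n.
  have -> : (1 - t) * x + t * (x / n) = l * x by rewrite /l; ring.
  have -> : (1 - t) * y + t * (y / n) = l * y by rewrite /l; ring.
  rewrite !exprMn -mulrDr -rad_out // -exprMn -/n.
  have n1 : 1 <= n := rad_ge1 _.
  have -> : l * n = (1 - t) * n + t.
    by rewrite /l mulrDl mulrVK // unitfE gt_eqF // rad_gt0.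
  rewrite exprn_ege1 //; nra.
- move=> t x y ht [-> ->]; rewrite /base2 /rx /ry /= rad_in.
    by rewrite !divr1; split; ring.
  by rewrite expr1n expr0n addr0.
- move=> t x y ht h; rewrite /disk2 /rx /ry /= rad_in // !divr1.
  by rewrite -!mulrDl !subrK !mul1r.
- move=> t x y ht h; rewrite /circ2 /rx /ry /= rad_in; last by rewrite h.
  by rewrite !divr1 -!mulrDl !subrK !mul1r.
- move=> t x y ht [-> ->]; rewrite /base2 /rx /ry /= rad_in.
    by rewrite !divr1; split; ring.
  by rewrite expr1n expr0n addr0.
Qed.

Lemma step_base : corr R 0 (cp (@whole R) (@outer R) (@base2 R))
  (cp (@whole R) (@outer R) (@quad R)).
Proof.
apply: corr_sym; apply: cp_widen.
  by move=> x y [-> ->]; rewrite /quad; lra.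
have sq : cstable (fun=> 1) (fun=> 0) (@quad R).
  by move=> t x y ht [hx hy]; split; [exact: cvx_ge|exact: cvx_ge].
(* [quad] is convex and lies in [outer], so it contracts to the base point (1, 0) within both
   cells. *)
apply: (cpush (cst 1) (cst 0)).
- by [].
- by [].
- by move=> t x y ht [_ h]; split=> //; exact: sq.
- move=> t x y ht [_ h]; split; last exact: sq.
  have [h1 h2] := sq t x y ht h; rewrite /outer /=; nra.
- by move=> t x y ht [-> ->]; split; exact: cvx_eq.
Qed.

(** Doubling sends [outer] into [box]: a point whose coordinates are both less than 1/2 in absolute
    value has norm less than 1. *)
Lemma step_box : corr R 0 (cp (@whole R) (@outer R) (@quad R))
  (cp (@whole R) (@box R) (@quad R)).
Proof.
have sq : cstable (fun p : R * R => 2 * p.1) (fun p : R * R => 2 * p.2) (@quad R).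
  by move=> t x y ht [hx hy]; split; apply: cvx_ge => //=; lra.
apply: (cretract (@dbl_fst_continuous R) (@dbl_snd_continuous R)) => //.
- by move=> x y h; rewrite /outer; case: h => -[]; nra.
- move=> x y; rewrite /outer /box /= => h.
  have [h1|h1] := leP 1 (2 * x); first by left; left.
  have [h2|h2] := leP (2 * x) (-1); first by left; right.
  have [h3|h3] := leP 1 (2 * y); first by right; left.
  have [h4|h4] := leP (2 * y) (-1); first by right; right.
  exfalso; nra.
- by move=> x y [hx hy]; split => /=; lra.
- move=> t x y /andP[t0 t1]; rewrite /outer /= => h.
  have -> : (1 - t) * x + t * (2 * x) = (1 + t) * x by ring.
  have -> : (1 - t) * y + t * (2 * y) = (1 + t) * y by ring.
  rewrite !exprMn -mulrDr mulr_ege1 // exprn_ege1 //; lra.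
- move=> t x y ht [[h|h]|[h|h]].
  + by left; left; apply: cvx_ge => //=; lra.
  + by left; right; apply: cvx_le => //=; lra.
  + by right; left; apply: cvx_ge => //=; lra.
  + by right; right; apply: cvx_le => //=; lra.
Qed.

Lemma step_upper : corr R 0 (cp (@whole R) (@box R) (@quad R))
  (cp (@whole R) (@box R) (@upper R)).
Proof.
apply: corr_sym; apply: cp_widen.
  by move=> x y [_ h]; rewrite /upper; lra.
pose high (x y : R) : Prop := 1 <= y.
pose hquad (x y : R) : Prop := 1 <= x /\ 1 <= y.
(* Raising [y] to 2 preserves [box], since a point of [upper] is not in the part [y <= -1]. From
   height 1 on, the two cells coincide, and moving right to [x = 2] ends in the quadrant. *)
apply: (chtpy fst_c (cst 2) (M' := high) (E' := high) (F' := hquad)).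
- by move=> x y; rewrite /high => h; split=> //; rewrite /upper; lra.
- by move=> x y; rewrite /high => h; split; [right; left|rewrite /upper; lra].
- by move=> x y [h1 h2]; split=> //; lra.
- by move=> x y _; rewrite /high; lra.
- by move=> x y _; rewrite /high; lra.
- by move=> x y [h _]; split=> //=; lra.
- move=> t x y ht [_ h]; split=> //; rewrite /upper /=; apply: cvx_gt => //; lra.
- move=> t x y ht [h hu]; split.
    case: h => [[h|h]|[h|h]].
    + by left; left; exact: cvx_ge.
    + by left; right; exact: cvx_le.
    + by right; left; apply: cvx_ge => //; lra.
    + by move: hu; rewrite /upper; lra.
  by rewrite /upper /=; apply: cvx_gt => //; lra.
- by move=> t x y ht [h1 h2]; split; apply: cvx_ge => //; lra.
- apply: (cpush (cst 2) snd_c).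
  + by move=> x y h; split=> //=; lra.
  + by move=> x y h; split=> //=; lra.
  + by move=> t x y ht h; exact: cvx_ge.
  + by move=> t x y ht h; exact: cvx_ge.
  + by move=> t x y ht [h1 h2]; split; apply: cvx_ge => //=; lra.
Qed.

Lemma nbhs_gt2 (f : R * R -> R) (a : R) p : continuous f -> a < f p ->
  nbhs p [set q | a < f q]%classic.
Proof.
by move=> cf h; apply: (cf p [set y | a < y]%classic); exact: open_nbhs_nbhs.
Qed.

Lemma nbhs_lt2 (f : R * R -> R) (a : R) p : continuous f -> f p < a ->
  nbhs p [set q | f q < a]%classic.
Proof.
by move=> cf h; apply: (cf p [set y | y < a]%classic); exact: open_nbhs_nbhs.
Qed.

Local Notation M5 := (inter (@whole R) (@lower R)).
Local Notation E5 := (inter (@box R) (@lower R)).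

Lemma step_lower : corr R 0 (cp (@whole R) (@box R) (@upper R)) (cp M5 E5 (@upper R)).
Proof.
apply: cp_excise => x y _; have [h|h] := ltP y 1.
  by left; apply: (nbhs_lt2 (f := snd)) => //; exact: snd_c.
by right; apply: (nbhs_gt2 (f := snd)); [exact: snd_c|rewrite /=; lra].
Qed.

Lemma acyclic_lower : cacyclic M5 E5 (@rstrip R).
Proof.
(* [F] is an intermediate base: moving down to [y = -2] and then right to [x = 2] leads into it
   without entering the open square, and [F] itself flattens into [rstrip] by [y = 0]. *)
pose F (x y : R) : Prop := 1 <= x /\ y < 1.
apply: (@cacyclic_triple R m i G1 G2 Q0 _ _ F).
- by move=> x y [h [h1 h2]].
- pose low (x y : R) : Prop := y <= -1.
  pose lowr (x y : R) : Prop := 1 <= x /\ y <= -1.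
  apply: (chtpy fst_c (cst (-2)) (M' := low) (E' := low) (F' := lowr)).
  + by move=> x y; rewrite /low => h; split=> //; rewrite /lower; lra.
  + by move=> x y; rewrite /low => h; split; [right; right|rewrite /lower; lra].
  + by move=> x y [h1 h2]; split=> //; lra.
  + by move=> x y _; rewrite /low; lra.
  + by move=> x y _; rewrite /low; lra.
  + by move=> x y [h _]; split=> //=; lra.
  + move=> t x y ht [_ h]; split=> //; rewrite /lower /=; apply: cvx_lt => //; lra.
  + move=> t x y ht [h hu]; split.
      case: h => [[h|h]|[h|h]].
      * by left; left; exact: cvx_ge.
      * by left; right; exact: cvx_le.
      * by move: hu; rewrite /lower; lra.
      * by right; right; apply: cvx_le => //; lra.
    by rewrite /lower /=; apply: cvx_lt => //; lra.
  + by move=> t x y ht [h1 h2]; split; [exact: cvx_ge|apply: cvx_lt => //; lra].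
  + apply: (cpush (cst 2) snd_c).
    * by move=> x y h; split=> //=; lra.
    * by move=> x y h; split=> //=; lra.
    * by move=> t x y ht h; exact: cvx_le.
    * by move=> t x y ht h; exact: cvx_le.
    * by move=> t x y ht [h1 h2]; split; [apply: cvx_ge => //=; lra|exact: cvx_le].
- apply: (cpush fst_c (cst 0)).
  + by move=> x y [_ [h1 h2]]; split=> //; split=> /=; lra.
  + by move=> x y [_ [h1 h2]]; split=> //; split=> /=; lra.
  + move=> t x y ht [[_ h1] [h2 h3]]; split; first split=> //; last split.
    * by apply: cvx_lt => //; lra.
    * exact: cvx_ge.
    * by apply: cvx_lt => //; lra.
  + move=> t x y ht [[_ h1] [h2 h3]]; split; first split; last split.
    * by left; left; exact: cvx_ge.
    * by apply: cvx_lt => //; lra.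
    * exact: cvx_ge.
    * by apply: cvx_lt => //; lra.
  + move=> t x y ht [h1 [h2 h3]]; split; first exact: cvx_ge.
    by split; [apply: cvx_gt => //; lra|apply: cvx_lt => //; lra].
Qed.

Local Notation M6 := (inter M5 (@upper R)).
Local Notation E6 := (inter E5 (@upper R)).

Lemma step_delta : corr R 1 (cp M5 E5 (@upper R)) (cp M6 E6 (@rstrip R)).
Proof.
by apply: cp_delta; [move=> x y [_ []]|exact: acyclic_lower].
Qed.

Lemma E6P x y : E6 x y <-> (1 <= x \/ x <= -1) /\ strip x y.
Proof.
split; last first.
  by case=> h [h1 h2]; split=> //; split=> //; left.
case=> -[h h1] h2; split; last by split.
case: h => [//|[h|h]]; move: h1 h2; rewrite /lower /upper; lra.
Qed.

Lemma step_pos : corr R 0 (cp M6 E6 (@rstrip R)) (cp M6 E6 (@pos R)).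
Proof.
apply: corr_sym; apply: cp_widen.
  by move=> x y [h _]; rewrite /pos; lra.
have sM : cstable (fun=> 2) snd (inter M6 (@pos R)).
  move=> t x y ht [[[_ h1] h2] h3]; split; first split; first split=> //.
  - exact: cvx_lt.
  - exact: cvx_gt.
  - by apply: cvx_gt => //; lra.
apply: (cpush (cst 2) snd_c) => //.
- by move=> x y [[[_ h1] h2] h3]; split; [rewrite /=; lra|split].
- by move=> x y [[[_ h1] h2] h3]; split; [rewrite /=; lra|split].
- move=> t x y ht [h p]; have [h1 h2] := proj1 (E6P _ _) h.
  have hs : strip ((1 - t) * x + t * 2) ((1 - t) * y + t * y).
    by case: h2 => *; split; [exact: cvx_gt|exact: cvx_lt].
  split; last by apply: cvx_gt => //; lra.
  apply/E6P; split=> //; left; apply: cvx_ge => //; last lra.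
  by case: h1 => //; move: p; rewrite /pos; lra.
- move=> t x y ht [h [h1 h2]]; split; first by apply: cvx_ge => //; lra.
  by split; [exact: cvx_gt|exact: cvx_lt].
Qed.

(** The two pairs agree over [x < 1]. Excision to that region erases the right half strip, which
    lies in [pos]. *)
Lemma step_left : corr R 0 (cp M6 E6 (@pos R))
  (cp (@strip R) (@lstrip R) (@pos R)).
Proof.
have ex M E : corr R 0 (cp M E (@pos R))
    (cp (inter M (@left1 R)) (inter E (@left1 R)) (@pos R)).
  apply: cp_excise => x y _; have [h|h] := ltP x 1.
    by left; apply: (nbhs_lt2 (f := fst)) => //; exact: fst_c.
  by right; apply: (nbhs_gt2 (f := fst)); [exact: fst_c|rewrite /=; lra].
apply: corr_trans0 (ex _ _) _; apply: corr_sym; apply: corr_trans0 (ex _ _) _.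
rewrite (@cp_ext R m i G1 G2 Q0 _ _ _ (inter M6 (@left1 R)) (inter E6 (@left1 R)) (@pos R)).
- by apply: corr_ext.
- by move=> x y; rewrite /inter /strip /lower /upper /whole; tauto.
- move=> x y; split=> -[h1 h2]; split=> //.
    by case: h1 => h1 h3; apply/E6P; split=> //; right.
  have [h3 h4] := proj1 (E6P _ _) h1; split=> //.
  by case: h3 => // h3; move: h2; rewrite /left1; lra.
- by [].
Qed.

Lemma step_coordinate (k : nat) (D : cpair) :
  corr R k (cp (@strip R) (@lstrip R) (@pos R)) D ->
  corr R k.+1 (cp (@disk2 R) (@circ2 R) (@base2 R)) D.
Proof.
move=> h; apply: corr_trans0 step_disk _; apply: corr_trans0 step_base _.
apply: corr_trans0 step_box _; apply: corr_trans0 step_upper _.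
apply: corr_trans0 step_lower _; apply: corr_trans1 step_delta _.
by apply: corr_trans0 step_pos _; apply: corr_trans0 step_left _.
Qed.

End Step.

(** * From polyhedral products to the realization *)

Section Subspace.
Variables (R : realType) (X : topologicalType) (S : set X).

Definition incl (x : set_type S) : X := val x.

Lemma incl_continuous : continuous incl.
Proof. exact: initial_continuous. Qed.

HB.instance Definition _ := isContinuous.Build _ _ incl incl_continuous.

Lemma incl_in (x : set_type S) : S (incl x).
Proof. by have := valP x; rewrite inE. Qed.

Lemma simplex_lift N (s : simplex R X N) : (forall t, S (s t)) ->
  exists s' : simplex R (set_type S) N, spush incl s' = s.
Proof.
move=> hs; pose s0 (t : stdsimplex R N) : set_type S := exist _ (s t) (mem_set (hs t)).
have cs0 : continuous s0.
  by apply: continuous_comp_initial => t; exact: (@cts_fun _ _ s).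
pose s1 : simplex R (set_type S) N := HB.pack s0 (isContinuous.Build _ _ s0 cs0).
exists s1.
exact/continuousEP.
Qed.

Lemma spush_incl_inj N (s s' : simplex R (set_type S) N) :
  spush incl s = spush incl s' -> s = s'.
Proof.
move=> e; apply/continuousEP => t; apply: val_inj.
exact: (congr1 (fun s : simplex R X N => s t) e).
Qed.

(** Simplices of the subspace are the simplices of [X] with image in [S]. This serves at the two
    ends, for the moment-angle complex and the realization; everything between takes place in
    ambient spaces of matrices. *)
Lemma corr_subspace :
  corr R 0 (CPair [set S]%classic set0) (@CPair (set_type S) [set setT]%classic set0).
Proof.
have no N (s : simplex R X N) : ~ Sing set0 s by case.
have no' N (s : simplex R (set_type S) N) : ~ Sing set0 s by case.
have all' N (s : simplex R (set_type S) N) : Sing [set setT]%classic s by exists setT.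
have inc N (s : simplex R (set_type S) N) : Sing [set S]%classic (spush incl s).
  by exists S => // t; exact: incl_in.
have lift N (s : simplex R X N) : Sing [set S]%classic s ->
    exists s' : simplex R (set_type S) N, spush incl s' = s.
  by case=> _ -> /simplex_lift.
have cob N (x : cochain R X N) : rcobound [set S]%classic set0 x <->
    rcobound [set setT]%classic set0 (pull incl x).
  case: N x => [|N] x /=.
    split=> h s; first by move=> _; exact: h.
    by move=> /lift[s' <-]; exact: h.
  split; case=> g _ hg.
    exists (pull incl g); first by move=> ? _ /no'.
    by move=> s _; rewrite codiff_pull; exact: hg.
  have [g' hg'] : exists g' : cochain R X N, pull incl g' = g.
    exists (fun s => if pselect (exists s' : simplex R (set_type S) N, spush incl s' = s) is left e
      then g (projT1 (cid e)) else 0).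
    apply/funext => s; rewrite /pull; case: pselect => [e|[]]; last by exists s.
    by congr g; apply: spush_incl_inj; case: (cid e).
  exists g'; first by move=> ? _ /no.
  by move=> s /lift[s' <-]; have := hg s' (all' _ _); rewrite -hg' codiff_pull.
have cyc N (x : cochain R X N) : rcocycle [set S]%classic set0 x <->
    rcocycle [set setT]%classic set0 (pull incl x).
  split=> -[_ dx]; split; try by move=> ? _ [].
    by move=> s _; rewrite codiff_pull; exact: dx.
  by move=> s /lift[s' <-]; have := dx s' (all' _ _); rewrite codiff_pull.
exists (fun M x y => rcocycle [set S]%classic set0 x /\ pull incl x = y); split=> //=.
- by move=> M x y [h <-]; split=> //; exact/cyc.
- by move=> M x h; exists (pull incl x).
- move=> M y hy.
  exists (fun s => if pselect (exists s' : simplex R (set_type S) M, spush incl s' = s) is left e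
      then y (projT1 (cid e)) else 0).
  set x := (fun s : simplex R X M => _).
  have e : pull incl (x : cochain R X M) = y.
    apply/funext => s; rewrite /pull /x; case: pselect => [e|[]]; last by exists s.
    by congr y; apply: spush_incl_inj; case: (cid e).
  by split=> //; apply/cyc; rewrite e.
- move=> M x y x' y' [h <-] [h' <-]; split; last by rewrite pullD.
  exact: rcocycleD.
- by move=> M x y [h <-]; exact: cob.
- by move=> M x y n [h <-]; split; [exact: rcocycle_sq|rewrite cup_pull].
Qed.

End Subspace.

Section Polyhedral.
Variables (R : realType) (m : nat) (K : {set {set 'I_m}}).
Hypothesis hK : simplicial_complex K.
Variable J : {set 'I_m}.
Local Notation mx := ('M[R]_(m, 2)).
Implicit Types L : {set 'I_m}.

(* The cells of the i-th factor after the coordinates in [L] have been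
   desuspended. *)
Definition cellM L (j : 'I_m) : R -> R -> Prop :=
  if j \notin J then @base2 R else if j \in L then @strip R else @disk2 R.
Definition cellE L (j : 'I_m) : R -> R -> Prop :=
  if j \notin J then @base2 R else if j \in L then @lstrip R else @circ2 R.
Definition cellF L (j : 'I_m) : R -> R -> Prop :=
  if j \in L then @pos R else @base2 R.
Definition cell L (s : {set 'I_m}) (j : 'I_m) (z : mx) : Prop :=
  (if j \in s then cellM L j else cellE L j) (z j 0) (z j 1).

(** Both cells at a coordinate outside [J] are the base point, so only [s :&: J] matters: this is
    the polyhedral product over K_J, embedded in the space of all coordinates. *)
Definition pprod L : set mx := [set z | exists2 s, s \in K & forall j, cell L s j z]%classic.
Definition pfam L : set (set mx) :=
  [set S | exists2 j, j \in J & S = fsp j (cellF L j)]%classic.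
Definition stage L : cpair := CPair [set pprod L]%classic (pfam L).

Section AddCoordinate.
Variables (L : {set 'I_m}) (i : 'I_m).
Hypotheses (iJ : i \in J) (iL : i \notin L).

Let G (b : bool) : set mx :=
  [set z | exists2 s, s \in K & (i \in s) = b /\ forall j, j != i -> cell L s j z]%classic.
Let Q0 : set (set mx) :=
  [set S | exists2 j, j \in J & j != i /\ S = fsp j (cellF L j)]%classic.

Lemma off_row_G b : off_row i (G b).
Proof.
move=> z z' zz' [s sK [ib hs]]; exists s => //; split=> // j ji.
by have := hs j ji; rewrite /cell !zz'.
Qed.

Lemma off_row_Q0 A : Q0 A -> off_row i A.
Proof. by case=> j jJ [ji ->] z z' zz'; rewrite /fsp !zz'. Qed.

Lemma cell_add s j z : j != i -> cell (i |: L)%SET s j z = cell L s j z.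
Proof. by move=> ji; rewrite /cell /cellM /cellE !inE (negbTE ji). Qed.

Lemma stage_old : stage L = cp i (G true) (G false) Q0 (@disk2 R) (@circ2 R) (@base2 R).
Proof.
rewrite /stage /cp; congr CPair.
  congr ([set _]%classic); apply/seteqP; split=> z.
    case=> s sK hs; have := hs i; rewrite {1}/cell /cellM /cellE iJ (negbTE iL) /=.
    by case e: (i \in s) => h; [left|right]; split=> //; exists s.
  case=> -[h [s sK [e hs]]]; exists s => // j; case: (eqVneq j i) => [->|/hs//];
  by rewrite /cell /cellM /cellE e iJ (negbTE iL).
apply/seteqP; split=> S.
  case=> j jJ ->; case: (eqVneq j i) => [->|ji]; last by right; exists j.
  by left; rewrite /cellF (negbTE iL).
case=> [->|[j jJ [ji ->]]]; last by exists j.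
by exists i => //; rewrite /cellF (negbTE iL).
Qed.

Lemma stage_new : stage (i |: L)%SET =
  cp i (G true) (G false) Q0 (@strip R) (@lstrip R) (@pos R).
Proof.
have Fj j : j != i -> cellF (i |: L)%SET j = cellF L j.
  by move=> ji; rewrite /cellF !inE (negbTE ji).
rewrite /stage /cp; congr CPair.
  congr ([set _]%classic); apply/seteqP; split=> z.
    case=> s sK hs; have := hs i; rewrite {1}/cell /cellM /cellE iJ setU11 /=.
    have hs' j : j != i -> cell L s j z by move=> ji; rewrite -cell_add.
    by case e: (i \in s) => h; [left|right]; split=> //; exists s.
  case=> -[h [s sK [e hs]]]; exists s => // j;
  (case: (eqVneq j i) => [->|ji]; last by rewrite cell_add //; exact: hs);
  by rewrite /cell /cellM /cellE e iJ setU11.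
apply/seteqP; split=> S.
  case=> j jJ ->; case: (eqVneq j i) => [->|ji]; last by right; exists j => //; rewrite Fj.
  by left; rewrite /cellF setU11.
case=> [->|[j jJ [ji ->]]]; last by exists j => //; rewrite Fj.
by exists i => //; rewrite /cellF setU11.
Qed.

Lemma stage_add k (D : cpair) : corr R k (stage (i |: L)%SET) D -> corr R k.+1 (stage L) D.
Proof.
rewrite stage_old stage_new; apply: step_coordinate; try exact: off_row_G.
exact: off_row_Q0.
Qed.

End AddCoordinate.

Lemma stage_all k (D : cpair) : corr R k (stage J) D -> corr R (#|J| + k) (stage finset.set0) D.
Proof.
move=> h; suff gen n L : (L \subset J)%SET -> #|(J :\: L)%SET| = n -> corr R (n + k) (stage L) D.
  by apply: gen; [exact: finset.sub0set|rewrite finset.setD0].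
elim: n L => [|n IH] L LJ e.
  have -> : L = J; last by [].
  by apply/eqP; rewrite finset.eqEsubset LJ -finset.setD_eq0 -cards_eq0 e.
have /card_gt0P[i] : (0 < #|(J :\: L)%SET|)%N by rewrite e.
rewrite inE => /andP[iL iJ]; apply: (@stage_add _ i) => //; apply: IH.
  by rewrite finset.subUset finset.sub1set iJ.
move: e; rewrite (cardsD1 i) !inE iL iJ add1n => -[<-].
by congr #|pred_of_set _|; apply/setP => j; rewrite !inE negb_or; case: (j == i); case: (j \in L).
Qed.

Definition const_map (z : mx) (_ : mx) : mx := z.

Lemma const_map_continuous z : continuous (const_map z).
Proof. exact: cst_continuous. Qed.

HB.instance Definition _ z := isContinuous.Build _ _ (const_map z) (const_map_continuous (z := z)).

Definition apex (a : R) : mx :=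
  \matrix_(j, l) if l == 0 then (if j \in J then a else 1) else 0.

Lemma apex0 a j : apex a j 0 = if j \in J then a else 1.
Proof. by rewrite mxE. Qed.
Lemma apex1 a j : apex a j 1 = 0.
Proof. by rewrite mxE. Qed.

Lemma lhtpyE (g : continuousType mx mx) t z j l :
  lhtpy g (t, z) j l = (1 - t) * z j l + t * g z j l.
Proof. by rewrite /lhtpy !mxE. Qed.

Lemma base2_cvx (t x y : R) : base2 x y -> base2 ((1 - t) * x + t * 1) ((1 - t) * y + t * 0).
Proof. by move=> [-> ->]; split; ring. Qed.

Lemma disk_le1 (a b : R) : a ^+ 2 + b ^+ 2 <= 1 -> a <= 1.
Proof. nra. Qed.

Lemma poly_full z : J \in K -> pprod finset.set0 z <->
  forall j, (if j \in J then @disk2 R else @base2 R) (z j 0) (z j 1).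
Proof.
move=> JK; split=> [[s sK hs] j|h].
  have := hs j; rewrite /cell /cellM /cellE !inE /=.
  case: (j \in J) => /=; last by case: ifP.
  by case: ifP => // _; rewrite /circ2 /disk2 => ->.
exists J => // j; have := h j; rewrite /cell /cellM /cellE !inE /=.
by case: (j \in J).
Qed.

Lemma disk2_cvx (t x y : R) : 0 <= t <= 1 -> disk2 x y ->
  disk2 ((1 - t) * x + t * 1) ((1 - t) * y + t * 0).
Proof.
move=> /andP[t0 t1]; rewrite /disk2 => h; have x1 := disk_le1 h.
have h1 : (1 - t) ^+ 2 * (x ^+ 2 + y ^+ 2) <= (1 - t) ^+ 2.
  by rewrite ler_piMr // exprn_ge0 // subr_ge0.
have h2 : t * (1 - t) * x <= t * (1 - t).
  by rewrite ler_piMr // mulr_ge0 // subr_ge0.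
lra.
Qed.

Lemma stage_acyclic : J \in K -> racyclic R [set pprod finset.set0]%classic (pfam finset.set0).
Proof.
move=> JK; have st : lstable (const_map (apex 1)) [set pprod finset.set0]%classic.
  move=> _ -> t z ht /(poly_full _ JK) h; apply/(poly_full _ JK) => j.
  rewrite !lhtpyE /= apex0 apex1; have := h j; case: (j \in J).
    exact: disk2_cvx.
  exact: base2_cvx.
(* For empty [J] the set is a point relative to nothing, without reduced cohomology. Otherwise the
   contraction of the product of disks ends in a face {z_i = 1}. *)
have [J0|/finset.set0Pn[i iJ]] := eqVneq J finset.set0.
  have -> : pfam finset.set0 = set0.
    by apply/seteqP; split=> // S [j]; rewrite J0 inE.
  apply: (@racyclic_contract R _ (const_map (apex 1)) _ (apex 1)) => //.
  apply/(poly_full _ JK) => j; rewrite apex0 apex1 J0 inE /=; split=> //.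
apply: (@racyclic_push R _ (const_map (apex 1))) => //.
  move=> _ ->; exists (fsp i (cellF finset.set0 i)); first by exists i.
  by move=> z _; rewrite /fsp /cellF inE apex0 apex1; case: ifP.
move=> _ [j jJ ->] t z ht; rewrite /fsp /cellF inE !lhtpyE /= apex0 apex1 jJ.
exact: base2_cvx.
Qed.

Hypothesis JK : J \notin K.

Lemma J_nonempty : exists i, i \in J.
Proof.
apply/finset.set0Pn; apply: contraNneq JK => ->; exact: (proj1 hK).
Qed.

Lemma poly_contract : racyclic R [set pprod J]%classic set0.
Proof.
(* The point (-2, 0) lies in both convex cells [lstrip] and [strip], so the contraction preserves
   each product of cells. *)
apply: (@racyclic_contract R _ (const_map (apex (-2))) _ (apex (-2))) => //.
  exists finset.set0; first exact: (proj1 hK).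
  move=> j; rewrite /cell /cellE inE apex0 apex1; case: (j \in J) => //=.
  by split; [lra|split; lra].
move=> _ -> t z ht [s sK hs]; exists s => // j; have := hs j.
rewrite /cell /cellM /cellE !lhtpyE /= apex0 apex1; case: (j \in J) => /=; last first.
  by case: ifP => _; exact: base2_cvx.
case: ifP => _.
  by move=> [h1 h2]; split; [apply: cvx_gt|apply: cvx_lt] => //; lra.
move=> [h0 [h1 h2]]; split; first by apply: cvx_le => //; lra.
by split; [apply: cvx_gt|apply: cvx_lt] => //; lra.
Qed.

(* The pieces whose union [hpoly] is homotopy equivalent to |K_J|. *)
Definition hfam : set (set mx) :=
  [set S | exists2 j, j \in J & S = pprod J `&` fsp j (@pos R)]%classic.
Definition hpoly : set mx := [set z | pprod J z /\ exists2 j, j \in J & 0 < z j 0]%classic.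

Lemma stage_delta : corr R 1 (stage J) (CPair hfam set0).
Proof.
have sub N (s : simplex R mx N) : Sing hfam s -> Sing [set pprod J]%classic s.
  by case=> _ [j jJ ->] h; exists (pprod J) => // t; have [] := h t.
apply: corr_trans0 (corr_delta sub poly_contract).
apply: corr_ext => // N s [_ -> hs]; rewrite set0U; split.
  case=> _ [j jJ ->] h; exists (pprod J `&` fsp j (@pos R))%classic; first by exists j.
  move=> t; split; first exact: hs.
  by have := h t; rewrite /cellF jJ.
case=> _ [j jJ ->] h; exists (fsp j (cellF J j)); first by exists j.
by move=> t; rewrite /cellF jJ; have [] := h t.
Qed.

(** The pieces are open in [hpoly], so the simplices lying in a single piece compute the cohomology
    of the union. *)
Lemma hfam_union : corr R 0 (CPair hfam set0) (CPair [set hpoly]%classic set0).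
Proof.
apply/corr_sym/corr_restr.
  move=> N s [_ [j jJ ->]] h; exists hpoly => // t; have [h1 h2] := h t.
  by split=> //; exists j.
rewrite set0U; apply: racyclic_cover.
  have [i iJ] := J_nonempty.
  by move=> _ _; exists (pprod J `&` fsp i (@pos R))%classic, i.
move=> _ z -> [pz [j jJ zj]].
exists (pprod J `&` fsp j (@pos R))%classic; first by exists j.
exists [set z : mx | 0 < z j 0]%classic; last by move=> z' [] ? _ ?; split.
apply: (@coord_continuous R m 2 j 0 z [set y | 0 < y]%classic).
exact: open_nbhs_nbhs.
Qed.

(** It vanishes on [lstrip], so that a vertex of nonzero weight belongs to every simplex whose
    product of cells contains [z]. *)
Definition weight (z : mx) (j : 'I_m) : R := if j \in J then Num.max 0 (z j 0 + 1) else 0.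
Definition total (z : mx) : R := \sum_j weight z j.
(** The maximum with 1 makes the quotient continuous everywhere. On [hpoly] some coordinate is
    positive, so the total exceeds 1 and the weights are normalized. *)
Definition to_bary (z : mx) : 'rV[R]_m := \row_j (weight z j / Num.max 1 (total z)).
(** The factor [m.+1%:R] exceeds the number of vertices: on the realization some barycentric
    coordinate is at least 1/m and becomes positive, while a zero coordinate becomes -1, a point of
    [lstrip]. *)
Definition of_bary (t : 'rV[R]_m) : mx :=
  \matrix_(j, l) if l == 0 then (if j \in J then -1 + m.+1%:R * t 0 j else 1) else 0.

Lemma weight_continuous j : continuous (weight^~ j).
Proof.
rewrite /weight; case: (j \in J); last exact: cst_continuous.
apply: max_continuous_fun; first exact: cst_continuous.
by apply: add_continuous_fun => z; [exact: coord_continuous|exact: cst_continuous].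
Qed.

Lemma total_continuous : continuous total.
Proof.
have add_cont : continuous (fun x : R * R => x.1 + x.2) by exact: add_continuous.
by apply: (continuous_big add_cont) => k _; exact: weight_continuous.
Qed.

Lemma to_bary_continuous : continuous to_bary.
Proof.
apply: continuous_mx => i j; under eq_fun do rewrite mxE.
apply: div_continuous_fun; last apply: max_continuous_fun.
- by move=> z; rewrite gt_eqF // lt_max ltr01.
- exact: weight_continuous.
- exact: cst_continuous.
- exact: total_continuous.
Qed.

Lemma of_bary_continuous : continuous of_bary.
Proof.
apply: continuous_mx => j l; under eq_fun do rewrite mxE.
case: (l == 0); last exact: cst_continuous.
case: (j \in J); last exact: cst_continuous.
apply: add_continuous_fun; first exact: cst_continuous.
by apply: mul_continuous_fun => t; [exact: cst_continuous|exact: coord_continuous].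
Qed.

HB.instance Definition _ := isContinuous.Build _ _ to_bary to_bary_continuous.
HB.instance Definition _ := isContinuous.Build _ _ of_bary of_bary_continuous.

Local Notation KJ := (full_subcomplex K J).
Local Notation real := (@realization_set R m KJ).

Lemma weight_ge0 z j : 0 <= weight z j.
Proof. by rewrite /weight; case: ifP => // _; rewrite le_max lexx. Qed.

Lemma total_gt1 z : hpoly z -> 1 < total z.
Proof.
case=> _ [j jJ zj]; rewrite /total (bigD1 j) //=.
apply: ltr_wpDr; first by apply: sumr_ge0 => k _; exact: weight_ge0.
by rewrite /weight jJ lt_max; apply/orP; right; lra.
Qed.

Lemma to_baryE z j : hpoly z -> to_bary z 0 j = weight z j / total z.
Proof. by move=> /total_gt1 h; rewrite mxE max_r // ltW. Qed.

Lemma of_bary0 t j : j \in J -> of_bary t j 0 = -1 + m.+1%:R * t 0 j.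
Proof. by move=> h; rewrite mxE h. Qed.
Lemma of_bary0' t j : j \notin J -> of_bary t j 0 = 1.
Proof. by move=> h; rewrite mxE (negbTE h). Qed.
Lemma of_bary1 t j : of_bary t j 1 = 0.
Proof. by rewrite mxE. Qed.

Lemma to_bary_real : sends to_bary [set hpoly]%classic [set real]%classic.
Proof.
move=> _ ->; exists real => // z hz; have tz := total_gt1 hz.
have t0 : 0 < total z by exact: lt_trans ltr01 tz.
split.
- by move=> j; rewrite to_baryE // divr_ge0 ?weight_ge0 // ltW.
- under eq_bigr do rewrite to_baryE //.
  by rewrite -mulr_suml divff // gt_eqF.
- case: hz => -[s sK hs] _.
  have wJ j : to_bary z 0 j != 0 -> j \in J.
    by apply: contraNT => jJ; rewrite mxE /weight (negbTE jJ) mul0r.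
  rewrite !inE; apply/andP; split; last by apply/fintype.subsetP => j; rewrite inE; exact: wJ.
  apply: (proj2 hK) sK _; apply/fintype.subsetP => j; rewrite inE => h.
  have jJ := wJ _ h; move: h; apply: contraNT => js.
  have := hs j; rewrite /cell /cellE jJ (negbTE js) /= => -[h _].
  by rewrite mxE /weight jJ max_l ?mul0r //; lra.
Qed.

Lemma of_bary_hpoly : sends of_bary [set real]%classic [set hpoly]%classic.
Proof.
move=> _ ->; exists hpoly => // t [t0 t1]; set s := [set _ | _]%SET => sK.
move: sK; rewrite inE => /andP[sK sJ]; split.
  exists s => // j; rewrite /cell /cellM /cellE of_bary1.
  case jJ: (j \in J) => /=; last by rewrite of_bary0' ?jJ //; case: ifP.
  rewrite of_bary0 //; case js: (j \in s); first by split; lra.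
  move: js; rewrite inE => /negbFE/eqP ->; rewrite mulr0 addr0.
  by split=> //; split; lra.
have [j hj] : exists j, 1 < m.+1%:R * t 0 j.
  apply: contrapT => h.
  have : m.+1%:R * \sum_j t 0 j <= m%:R.
    rewrite mulr_sumr -[X in _ <= X%:R]card_ord -sum1_card natr_sum.
    by apply: ler_sum => j _; rewrite leNgt; apply/negP => ?; apply: h; exists j.
  by rewrite t1 mulr1 ler_nat ltnn.
have jJ : j \in J.
  apply: (fintype.subsetP sJ); rewrite inE; apply: contraTneq hj => ->.
  by rewrite mulr0 -leNgt ler01.
by exists j => //; rewrite of_bary0 //; lra.
Qed.

Lemma to_of_bary t : real t -> to_bary (of_bary t) = t.
Proof.
move=> rt; have hp : hpoly (of_bary t).
  have [_ -> ] := of_bary_hpoly (erefl : [set real]%classic real); exact.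
have [t0 t1] := rt; set s := [set _ | _]%SET => sK.
move: sK; rewrite inE => /andP[_ sJ].
have wE j : weight (of_bary t) j = m.+1%:R * t 0 j.
  rewrite /weight; case jJ: (j \in J).
    by rewrite of_bary0 // addrAC addNr add0r max_r // mulr_ge0.
  apply/esym/eqP; rewrite mulf_eq0; apply/orP; right.
  apply/negPn/negP => h; suff : j \in J by rewrite jJ.
  by apply: (fintype.subsetP sJ); rewrite inE.
have tE : total (of_bary t) = m.+1%:R.
  by rewrite /total; under eq_bigr do rewrite wE; rewrite -mulr_sumr t1 mulr1.
apply/rowP => j; rewrite to_baryE // wE tE mulrAC divff ?mul1r //.
Qed.

Lemma lstable_of_to : lstable (of_bary \o to_bary) [set hpoly]%classic.
Proof.
move=> _ -> t z ht hz; have tz := total_gt1 hz.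
have t0 : 0 < total z by exact: lt_trans ltr01 tz.
have [[s sK hs] [j0 j0J z0]] := hz.
have gE j : j \in J -> of_bary (to_bary z) j 0 = -1 + m.+1%:R * (weight z j / total z).
  by move=> jJ; rewrite of_bary0 // to_baryE.
split.
  exists s => // j; have := hs j; rewrite /cell /cellM /cellE !lhtpyE /= of_bary1.
  case jJ: (j \in J) => /=; last first.
    by rewrite of_bary0' ?jJ //; case: ifP => _; exact: base2_cvx.
  case: ifP => _.
    by move=> [h1 h2]; split; [apply: cvx_gt|apply: cvx_lt] => //; lra.
  move=> [h0 [h1 h2]]; split; last first.
    by split; [apply: cvx_gt|apply: cvx_lt] => //; lra.
  apply: cvx_le => //; rewrite gE // /weight jJ max_l; last lra.
  by rewrite mul0r mulr0 addr0.
(* At the largest coordinate [j] the whole segment is positive: the total is at most [m] times the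
   weight of [j], so [m.+1%:R] times its normalized weight exceeds 1. *)
case: (@Order.TotalTheory.arg_maxP _ R _ j0 (mem J) (fun j => z j 0) j0J) => j jJ0 jmax.
have jJ : j \in J by exact: jJ0.
exists j => //; have zj : 0 < z j 0 by apply: lt_le_trans z0 (jmax _ j0J).
rewrite lhtpyE /=; apply: cvx_gt => //; rewrite gE //.
have wj : weight z j = z j 0 + 1 by rewrite /weight jJ max_r //; lra.
have wle k : weight z k <= weight z j.
  rewrite wj /weight; case: ifP => kJ; last lra.
  by rewrite ge_max; apply/andP; split; [lra|rewrite lerD2r; exact: jmax].
have : total z <= m%:R * weight z j.
  rewrite mulr_natl -[X in _ *+ X]card_ord -sumr_const.
  by apply: ler_sum => k _; exact: wle.
move=> h; suff : 1 < m.+1%:R * (weight z j / total z) by lra.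
rewrite mulrA ltr_pdivlMr // mul1r; apply: le_lt_trans h _.
rewrite ltr_pM2r ?ltr_nat //; rewrite wj; lra.
Qed.

Lemma hpoly_real : corr R 0 (CPair [set hpoly]%classic set0) (CPair [set real]%classic set0).
Proof.
apply: (@corr_heq R _ _ _ _ _ _ (to_bary : continuousType _ _) (of_bary : continuousType _ _)).
- exact: to_bary_real.
- by move=> ? [].
- exact: of_bary_hpoly.
- by move=> ? [].
- move=> N f hf; rewrite pull_pull; apply: lhtpy_cobound => //; first exact: lstable_of_to.
- move=> N f hf; apply: rcobound0 => s [_ -> hs].
  rewrite cochainDE /pull (_ : spush _ (spush _ s) = s) ?addF2 //.
  by apply/continuousEP => t /=; exact: to_of_bary.
Qed.

Theorem stage_realization : corr R (#|J| + 1) (stage finset.set0)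
  (@CPair (realization R KJ) [set setT]%classic set0).
Proof.
apply: stage_all; apply: corr_trans1 stage_delta _.
apply: corr_trans0 hfam_union _; apply: corr_trans0 hpoly_real _.
exact: corr_subspace.
Qed.

End Polyhedral.

(** * Splitting of the moment-angle complex *)

Lemma sum_toggle (T : finType) (F : {set T} -> 'F_2) (i : T) :
  (forall A : {set T}, i \notin A -> F (i |: A)%SET = F A) -> \sum_A F A = 0.
Proof.
move=> h; rewrite (bigID (fun A : {set T} => i \in A)) /=.
rewrite (reindex_onto (fun A => i |: A)%SET (fun A => A :\ i)%SET) /=; last first.
  by move=> A iA; exact: finset.setD1K.
rewrite (eq_bigl (fun A : {set T} => i \notin A)).
  rewrite (eq_bigr F) ?addF2 // => A iA; exact: h.
move=> A; rewrite finset.setU11 /=; apply/eqP/idP => [<-|iA]; first by rewrite !inE eqxx.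
by rewrite finset.setU1K.
Qed.

Lemma sum_sig (T : finType) (P : pred T) (F : T -> 'F_2) :
  \sum_(x | P x) F x = \sum_(i : {x : T | P x}) F (val i).
Proof.
rewrite (reindex_omap (val : {x : T | P x} -> T) insub) /=; last first.
  by move=> x Px; rewrite insubT.
by apply: eq_bigl => i; rewrite valK (valP i) eqxx.
Qed.

Section CochainSums.
Variables (R : realType) (X : topologicalType).

Lemma cochain_sumE (I : Type) (r : seq I) N (a : I -> cochain R X N) s :
  (\sum_(i <- r) a i) s = \sum_(i <- r) a i s.
Proof.
by elim: r => [|i r IH]; rewrite ?big_nil // !big_cons cochainDE IH.
Qed.

Lemma rcocycle0 (P Q : set (set X)) N : rcocycle P Q (0 : cochain R X N).
Proof. by split=> [s _ _|s _] //; exact: big1. Qed.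

Lemma rcocycle_sum (I : Type) (r : seq I) (P Q : set (set X)) N (a : I -> cochain R X N) :
  (forall i, rcocycle P Q (a i)) -> rcocycle P Q (\sum_(i <- r) a i).
Proof.
move=> h; elim: r => [|i r IH]; first by rewrite big_nil; exact: rcocycle0.
by rewrite big_cons; exact: rcocycleD.
Qed.

Lemma rcobound_sum (I : Type) (r : seq I) (P Q : set (set X)) N (a : I -> cochain R X N) :
  (forall i, rcobound P Q (a i)) -> rcobound P Q (\sum_(i <- r) a i).
Proof.
move=> h; elim: r => [|i r IH]; first by rewrite big_nil; apply: rcobound0.
by rewrite big_cons; exact: rcoboundD.
Qed.

(** Squaring is additive up to coboundaries, the cross terms being killed by [rcobound_cup_comm]. *)
Lemma rcobound_sq_sum (I : Type) (r : seq I) (P Q : set (set X)) p n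
    (a : I -> cochain R X p) : (forall i, rcocycle P Q (a i)) ->
  rcobound P Q (cup (\sum_(i <- r) a i) (\sum_(i <- r) a i) +
                \sum_(i <- r) cup (a i) (a i) : cochain R X n).
Proof.
move=> h; elim: r => [|i r IH].
  by rewrite !big_nil cup0l addr0; apply: rcobound0.
rewrite !big_cons cupDl !cupDr; set S := \sum_(j <- r) a j in IH *.
have -> : cup (a i) (a i) + cup (a i) S + (cup S (a i) + cup S S) +
    (cup (a i) (a i) + \sum_(j <- r) cup (a j) (a j)) =
    (cup (a i) S + cup S (a i)) + (cup S S + \sum_(j <- r) cup (a j) (a j)) :> cochain R X n.
  apply/funext => s; rewrite !cochainDE.
  have F2 (b c d e g : 'F_2) : b + c + (d + e) + (b + g) = c + d + (e + g).
    by rewrite -[RHS]add0r -(addF2 b); ring.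
  exact: F2.
apply: rcoboundD => //; apply: rcobound_cup_comm => //.
exact: rcocycle_sum.
Qed.

End CochainSums.

Section Decomposition.
Variables (R : realType) (m : nat) (K : {set {set 'I_m}}).
Local Notation mx := ('M[R]_(m, 2)).
Local Notation ZK := (@moment_angle_set R m K).
Implicit Types J L : {set 'I_m}.

Definition pm L (z : mx) : mx :=
  \matrix_(j, l) if j \in L then z j l else (l == 0)%:R.

Lemma pm_continuous L : continuous (pm L).
Proof.
apply: continuous_mx => j l; under eq_fun do rewrite mxE.
by case: (j \in L) => z; [exact: coord_continuous|exact: cst_continuous].
Qed.

HB.instance Definition _ L := isContinuous.Build _ _ (pm L) (pm_continuous (L := L)).

Lemma pm_pm J L z : pm J (pm L z) = pm (J :&: L)%SET z.
Proof. by apply/matrixP => j l; rewrite !mxE inE; case: (j \in J). Qed.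

Lemma spush_pm J L N (s : simplex R mx N) :
  spush (pm J) (spush (pm L) s) = spush (pm (J :&: L)%SET) s.
Proof. by apply/continuousEP => t /=; exact: pm_pm. Qed.

Lemma pmT z : pm [set: 'I_m]%SET z = z.
Proof. by apply/matrixP => j l; rewrite mxE inE. Qed.

Local Notation pprod J := (@pprod R m K J finset.set0).
Local Notation fam J := (@pfam R m J finset.set0).
Local Notation P J := ([set pprod J]%classic).
Local Notation Z := ([set ZK]%classic).

Lemma momentP z : ZK z <-> exists2 s, s \in K &
  forall j, (if j \in s then @disk2 R else @circ2 R) (z j 0) (z j 1).
Proof.
split=> -[s sK hs]; exists s => // j; have := hs j;
by case: (j \in s); rewrite /disk /circle /= !mxE.
Qed.

Lemma base_circ (x y : R) : base2 x y -> circ2 x y.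
Proof. by move=> [-> ->]; rewrite /circ2 expr1n expr0n addr0. Qed.

Lemma base_disk (x y : R) : base2 x y -> disk2 x y.
Proof. by move=> /base_circ h; rewrite /disk2 h. Qed.

Lemma pm_out L z j : j \notin L -> base2 (pm L z j 0) (pm L z j 1).
Proof. by move=> h; rewrite !mxE (negbTE h). Qed.

Lemma pm_in L z j l : j \in L -> pm L z j l = z j l.
Proof. by move=> h; rewrite mxE h. Qed.

Lemma pm_moment L : sends (pm L) Z Z.
Proof.
move=> _ ->; exists ZK => // z /momentP[s sK hs]; apply/momentP; exists s => // j.
case jL: (j \in L); first by rewrite !pm_in //; exact: hs.
have := @pm_out L z j; rewrite jL => /(_ isT) h.
by case: (j \in s); [exact: base_disk|exact: base_circ].
Qed.

Lemma pm_poly J : sends (pm J) Z (P J).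
Proof.
move=> _ ->; exists (pprod J) => // z /momentP[s sK hs]; exists s => // j.
rewrite /cell /cellM /cellE inE; case jJ: (j \in J) => /=.
  by rewrite !pm_in //; exact: hs.
by have := @pm_out J z j; rewrite jJ => /(_ isT) h; case: (j \in s).
Qed.

Lemma Sing_poly_moment J N (s : simplex R mx N) : Sing (P J) s -> Sing Z s.
Proof.
case=> _ -> h; exists ZK => // t; have [u uK hu] := h t; apply/momentP; exists u => // j.
have := hu j; rewrite /cell /cellM /cellE inE; case: (j \in J); case: (j \in u) => //=.
  exact: base_disk.
exact: base_circ.
Qed.

Lemma pm_id_poly J N (s : simplex R mx N) : Sing (P J) s -> spush (pm J) s = s.
Proof.
case=> _ -> h; apply/continuousEP => t /=; apply/matrixP => j l.
case jJ: (j \in J); first by rewrite pm_in.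
have [u _ /(_ j)] := h t; rewrite /cell /cellM /cellE jJ /=.
case: ifP => _ [h0 h1]; rewrite mxE jJ;
by case: l => [[|[]]] // ?; [rewrite -[LHS]/1 -h0|rewrite -[LHS]/0 -h1]; congr (s t j _); exact: val_inj.
Qed.

(* Inclusion-exclusion over the coordinate projections. *)
Definition part J N (f : cochain R mx N) : cochain R mx N :=
  fun s => \sum_(L : {set 'I_m} | (L \subset J)%SET) f (spush (pm L) s).

Lemma part_codiff J N (f : cochain R mx N) : codiff (part J f) = part J (codiff f).
Proof.
apply/funext => s; rewrite /part /codiff exchange_big /=.
by apply: eq_bigr => L _; apply: eq_bigr => i _; rewrite sface_spush.
Qed.

(** If coordinate [i] of the simplex is constantly the base point, adding [i] to [L] does not change
    the projection, so the terms cancel in pairs. *)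
Lemma vanish_part J N (f : cochain R mx N) : vanish (P J) (fam J) (part J f).
Proof.
move=> s _ [_ [i iJ ->] hs]; rewrite /part big_mkcond /=.
apply: (@sum_toggle _ _ i) => L iL.
rewrite finset.subUset finset.sub1set iJ /=; case: ifP => // _.
congr f; apply/continuousEP => t /=; apply/matrixP => j l; rewrite !mxE !inE.
case: eqVneq => //= ->; rewrite (negbTE iL).
have := hs t; rewrite /fsp /cellF inE => -[h0 h1].
by case: l => [[|[]]] // ?; [rewrite -[RHS]/1 -h0|rewrite -[RHS]/0 -h1]; congr (s t i _); exact: val_inj.
Qed.

Lemma rcocycle_part J N (f : cochain R mx N) :
  rcocycle Z set0 f -> rcocycle (P J) (fam J) (part J f).
Proof.
move=> [_ df]; split; first exact: vanish_part.
move=> s /Sing_poly_moment Zs; rewrite part_codiff; apply: big1 => L _; apply: df.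
exact: Sing_spush (@pm_moment L) _.
Qed.

Lemma rcobound_part J N (f : cochain R mx N) :
  rcobound Z set0 f -> rcobound (P J) (fam J) (part J f).
Proof.
case: N f => [|N] f /= h.
  move=> s /Sing_poly_moment Zs; apply: big1 => L _; apply: h.
  exact: Sing_spush (@pm_moment L) _.
case: h => g _ hg; exists (part J g); first exact: vanish_part.
move=> s /Sing_poly_moment Zs; rewrite part_codiff; apply: eq_bigr => L _; apply: hg.
exact: Sing_spush (@pm_moment L) _.
Qed.

Lemma sum_interval J L (c : 'F_2) : J != L ->
  \sum_(M : {set 'I_m} | (J \subset M) && (M \subset L)) c = 0.
Proof.
move=> JL; rewrite big_mkcond /=.
have [JsL|JsL] := boolP (J \subset L)%SET; last first.
  apply: big1 => M _; case: ifP => // /andP[h1 h2].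
  by rewrite (fintype.subset_trans h1 h2) in JsL.
have [i iL iJ] : exists2 i, i \in L & i \notin J.
  apply: contrapT => h; move/negP: JL; apply; rewrite finset.eqEsubset JsL /=.
  apply/fintype.subsetP => i iL; apply: contrapT => iJ; apply: h; exists i => //; exact/negP.
apply: (@sum_toggle _ _ i) => M iM; congr (if _ && _ then _ else _).
  apply/idP/idP => h; last exact: fintype.subset_trans h (finset.subsetUr _ _).
  apply/fintype.subsetP => j jJ; have := fintype.subsetP h j jJ.
  by rewrite !inE => /predU1P[e|//]; rewrite -e jJ in iJ.
by rewrite finset.subUset finset.sub1set iL.
Qed.

Notation I := {J : {set 'I_m} | J \notin K}.

Definition glue N (y : I -> cochain R mx N) : cochain R mx N :=
  \sum_(i : I) pull (pm (val i)) (y i).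

Lemma glueE N (y : I -> cochain R mx N) s :
  glue y s = \sum_(i : I) y i (spush (pm (val i)) s).
Proof. exact: cochain_sumE. Qed.

Lemma pull_pm_fam J N (y : cochain R mx N) :
  rcocycle (P J) (fam J) y -> rcocycle Z set0 (pull (pm J) y).
Proof.
move=> [_ dy]; split; first by move=> ? _ [].
by move=> s Zs; rewrite codiff_pull; apply: dy; exact: Sing_spush (@pm_poly J) _.
Qed.

Lemma pull_pm_cobound J N (y : cochain R mx N) :
  rcobound (P J) (fam J) y -> rcobound Z set0 (pull (pm J) y).
Proof.
case: N y => [|N] y /= h; first by move=> s Zs; apply: h; exact: Sing_spush (@pm_poly J) _.
case: h => g _ hg; exists (pull (pm J) g); first by move=> ? _ [].
by move=> s Zs; rewrite codiff_pull; apply: hg; exact: Sing_spush (@pm_poly J) _.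
Qed.

(** A term with [val i] not contained in [M] is zero, since projecting to [M] makes some coordinate
    in [val i] constant at the base point. The other terms are equal and indexed by an interval of
    subsets, of even size unless [i = L]. *)
Lemma part_glue (L : I) N (y : I -> cochain R mx N) s :
  (forall i, rcocycle (P (val i)) (fam (val i)) (y i)) -> Sing (P (val L)) s ->
  part (val L) (glue y) s = y L s.
Proof.
move=> hy Ps; rewrite /part; under eq_bigr do rewrite glueE.
rewrite exchange_big /=.
have key (i : I) : \sum_(M : {set 'I_m} | (M \subset val L)%SET) y i (spush (pm (val i)) (spush (pm M) s)) =
    \sum_(M : {set 'I_m} | (val i \subset M) && (M \subset val L)) y i (spush (pm (val i)) s).
  rewrite big_mkcond [RHS]big_mkcond /=; apply: eq_bigr => M _.
  case ML: (M \subset val L)%SET; rewrite ?andbF // andbT.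
  case: ifPn => iM; first by rewrite spush_pm (finset.setIidPl iM).
  have /fintype.subsetPn[j ji jM] := iM.
  have [y0 _] := hy i; apply: y0.
    apply: Sing_spush (@pm_poly (val i)) _; apply: Sing_spush (@pm_moment M) _.
    exact: Sing_poly_moment Ps.
  exists (fsp j (cellF finset.set0 j)); first by exists j.
  move=> t; rewrite /fsp /cellF inE /= pm_pm; apply: pm_out.
  by rewrite inE (negbTE jM) andbF.
under eq_bigr do rewrite key.
rewrite (bigD1 L) //= [X in _ + X]big1 ?addr0 => [|i iL]; last first.
  by apply: sum_interval; apply: contra_neq iL => /val_inj.
rewrite (big_pred1 (val L)) ?pm_id_poly // => M.
by rewrite -finset.eqEsubset eq_sym.
Qed.

(** Möbius inversion mod 2: the term of [L] occurs once for each [J] containing [L], an even number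
    of times unless [L] is the full set. *)
Lemma glue_part N (f : cochain R mx N) s :
  \sum_(J : {set 'I_m}) part J f (spush (pm J) s) = f s.
Proof.
have e J : part J f (spush (pm J) s) =
    \sum_(L : {set 'I_m} | (L \subset J)%SET) f (spush (pm L) s).
  by apply: eq_bigr => L LJ; rewrite spush_pm (finset.setIidPl LJ).
under eq_bigr do rewrite e.
rewrite (exchange_big_dep predT) //= (bigD1 [set: 'I_m]%SET) //= [X in _ + X]big1 ?addr0.
  rewrite (big_pred1 [set: 'I_m]%SET) => [|J]; last by rewrite finset.subTset.
  by congr f; apply/continuousEP => t /=; exact: pmT.
move=> L LT; rewrite -[RHS](sum_interval (f (spush (pm L) s)) LT).
by apply: eq_bigl => J; rewrite finset.subsetT andbT.
Qed.

Definition decomp N (f : cochain R mx N) (y : I -> cochain R mx N) : Prop :=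
  [/\ rcocycle Z set0 f, forall i, rcocycle (P (val i)) (fam (val i)) (y i) &
      rcobound Z set0 (f + glue y)].

Lemma glue_cocycle N (y : I -> cochain R mx N) :
  (forall i, rcocycle (P (val i)) (fam (val i)) (y i)) -> rcocycle Z set0 (glue y).
Proof. by move=> hy; apply: rcocycle_sum => i; exact: pull_pm_fam. Qed.

Lemma decomp_l N (f : cochain R mx N) : rcocycle Z set0 f -> exists y, decomp f y.
Proof.
move=> hf; exists (fun i => part (val i) f); split=> //.
  by move=> i; exact: rcocycle_part.
(* The identity [glue_part] involves all [J], and [glue] only those outside [K]; the terms with
   [J \in K] are coboundaries by [stage_acyclic]. *)
apply: (@rcobound_eq _ _ _ _ _
    (\sum_(J : {set 'I_m}) if J \in K then pull (pm J) (part J f) else 0)).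
  move=> s Zs; rewrite cochain_sumE cochainDE glueE -{1}(glue_part f s).
  rewrite -(sum_sig (fun J => J \notin K) (fun J => part J f (spush (pm J) s))).
  rewrite [X in _ = X + _](bigID (fun J => J \in K)) /= -addrA addF2 addr0 [RHS]big_mkcond /=.
  by apply: eq_bigr => J _; case: (J \in K).
apply: rcobound_sum => J; case: ifP => JK; last exact: rcobound0.
apply: pull_pm_cobound; apply: stage_acyclic => //; exact: rcocycle_part.
Qed.

Lemma decomp_r N (y : I -> cochain R mx N) :
  (forall i, rcocycle (P (val i)) (fam (val i)) (y i)) -> exists f, decomp f y.
Proof.
move=> hy; exists (glue y); split=> //; first exact: glue_cocycle.
exact: rcobound_add2.
Qed.

Lemma decompD N (f f' : cochain R mx N) y y' : decomp f y -> decomp f' y' ->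
  decomp (f + f') (fun i => y i + y' i).
Proof.
move=> [h1 h2 h3] [h1' h2' h3']; split; first exact: rcocycleD.
  by move=> i; exact: rcocycleD.
have -> : glue (fun i => y i + y' i) = glue y + glue y'.
  by rewrite /glue -big_split.
by rewrite addrACA; exact: rcoboundD.
Qed.

Lemma decompB N (f : cochain R mx N) y : decomp f y ->
  (rcobound Z set0 f <-> forall i, rcobound (P (val i)) (fam (val i)) (y i)).
Proof.
move=> [h1 h2 h3]; split=> [hf i|hy].
  apply: rcobound_eq (rcobound_part (val i) (rcobound_addl h3 hf)).
  by move=> s Ps; exact: part_glue.
apply: (rcobound_addr h3); apply: rcobound_sum => i; exact: pull_pm_cobound.
Qed.

Lemma decomp_sq N n (f : cochain R mx N) y : decomp f y ->
  decomp (cup f f : cochain R mx n) (fun i => cup (y i) (y i)).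
Proof.
move=> [h1 h2 h3]; split; first exact: rcocycle_sq.
  by move=> i; exact: rcocycle_sq.
have := rcobound_sqD n h1 (glue_cocycle h2) h3.
have := rcobound_sq_sum (index_enum I) n (fun i => pull_pm_fam (h2 i)).
rewrite -/(glue y) => h4 h5; have := rcoboundD h5 h4.
rewrite -addrA [X in _ + X]addrA addcF2 add0r.
congr (rcobound _ _ (_ + _)); apply: eq_bigr => i _; exact: cup_pull.
Qed.

End Decomposition.

(** * Isomorphism of modules over the Steenrod algebra *)

Definition fullc (X : topologicalType) : cpair := @CPair X [set setT]%classic set0.

Lemma lmodF2_add (V : lmodType 'F_2) (x : V) : x + x = 0.
Proof. by rewrite -[x]scale1r -scalerDl addF2 scale0r. Qed.

(** Any choice of values is linear: mod 2, [f (x + y) + (f x + f y)] is related to 0 and hence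
    vanishes, and additive maps over F_2 are linear. *)
Lemma linear_of_rel (V W : lmodType 'F_2) (r : V -> W -> Prop) :
  (forall x, exists w, r x w) ->
  (forall x w x' w', r x w -> r x' w' -> r (x + x') (w + w')) ->
  (forall w, r 0 w -> w = 0) ->
  exists f : {linear V -> W}, forall x, r x (f x).
Proof.
move=> /choice[f hf] rD r0.
have fD x y : f (x + y) = f x + f y.
  apply: (addIr (f x + f y)); rewrite lmodF2_add; apply: r0.
  by rewrite -(lmodF2_add (x + y)); apply: (rD) => //; apply: rD.
have f0 : f 0 = 0 by apply: r0.
have lf : linear f.
  move=> a x y; rewrite fD; congr (_ + _).
  have : a = 0 \/ a = 1 by case: a => -[|[|]] // i; [left|right]; exact: val_inj.
  by case=> ->; rewrite ?scale1r // !scale0r.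
pose fl : {linear V -> W} := HB.pack f (GRing.isLinear.Build _ _ _ _ f lf).
by exists fl.
Qed.

Section Rep.
Variables (R : realType) (X : topologicalType).
Local Notation Z f := (rcocycle (cpP (fullc X)) (cpQ (fullc X)) f).
Local Notation B f := (rcobound (cpP (fullc X)) (cpQ (fullc X)) f).

Lemma Sing_full N (s : simplex R X N) : Sing [set setT]%classic s.
Proof. by exists setT. Qed.

Lemma full_cocycle N (f : cochain R X N) : Z f <-> f \in @cocycle R X N.
Proof.
split=> [[_ df]|/eqP df]; last by split=> [? _ []|s _] //; rewrite df.
by apply/eqP/funext => s; apply: df; exact: Sing_full.
Qed.

Lemma full_cobound N (f : cochain R X N) : B f <-> is_coboundary f.
Proof.
case: N f => [|N] f /=.
  split=> [h|-> //]; apply/funext => s; apply: h; exact: Sing_full.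
split=> [[g _ hg]|[g ->]]; last by exists g => // ? _ [].
by exists g; apply/funext => s; apply: hg; exact: Sing_full.
Qed.

(** Degrees of reduced cohomology are integers such as [n + 1], equal to some [Posz N] only up to a
    proof; the transport is confined to this relation. *)
Definition rep (a : int) (x : vcoh R X a) (N : nat) (f : cochain R X N) : Prop :=
  exists h : Posz N = a, exists2 z : cocycles R X N, cocycle_val z = f &
    x = eq_rect (Posz N) (vcoh R X) (lquot_pi (@coboundary R X N) z) a h.

Lemma rep_cocycle a (x : vcoh R X a) N (f : cochain R X N) : rep x f -> Z f.
Proof. by case=> _ [z <- _]; apply/full_cocycle; case: z. Qed.

Lemma rep_ex a (x : vcoh R X a) N : Posz N = a -> exists f : cochain R X N, rep x f.
Proof.
move=> h; case: a / h x => x; exists (cocycle_val (lquot_repr x)), erefl.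
by exists (lquot_repr x) => //=; rewrite lquot_reprK.
Qed.

Lemma rep_of a N (f : cochain R X N) : Posz N = a -> Z f ->
  exists x : vcoh R X a, rep x f.
Proof.
move=> h /full_cocycle zf; case: a / h.
by exists (lquot_pi _ (Cocycle zf)), erefl; exists (Cocycle zf).
Qed.

Lemma repD a (x x' : vcoh R X a) N (f f' : cochain R X N) :
  rep x f -> rep x' f' -> rep (x + x') (f + f').
Proof.
case=> h [z <- ->] [h' [z' <- ->]]; case: a / h h' {x x'} => h'.
rewrite (Prop_irrelevance h' erefl) /=; exists erefl; exists (z + z') => //=.
by rewrite lquot_piD.
Qed.

Lemma lquot_pi0 N : lquot_pi (@coboundary R X N) 0 = 0.
Proof. by apply: (addrI (lquot_pi (@coboundary R X N) 0)); rewrite -lquot_piD !addr0. Qed.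

Lemma rep_eq0 a (x : vcoh R X a) N (f : cochain R X N) :
  rep x f -> (x = 0 <-> B f).
Proof.
case=> h [z <- ->]; case: a / h {x} => /=.
rewrite full_cobound -[X in _ = X](lquot_pi0 N).
have e : (z - 0 \in @coboundary R X N) <-> is_coboundary (cocycle_val z).
  by rewrite subr0; split=> [/asboolP|h]; last exact/asboolP.
by rewrite -e; split=> /lquot_piP.
Qed.

Lemma rep_sq a b (x : vcoh R X a) N n (f : cochain R X N) :
  rep x f -> Posz n = b -> rep (vcoh_sq R X a b x) (cup f f : cochain R X n).
Proof.
case=> h [z <- ->] h'; case: a / h {x}; case: b / h' => /=.
by exists erefl; exists (cocycle_sq n z) => //=; rewrite coh_sq_pi.
Qed.

Lemma vcoh_neg a (x : vcoh R X a) : (a < 0)%R -> x = 0.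
Proof. by case: a x => [//|j] x _; apply/rowP => -[]. Qed.

End Rep.

(* [link y w]: [y] corresponds under [rho] to a cocycle representing [w]; this is
   void when N < k, where both sides vanish. *)
Section Link.
Variables (R : realType) (C : cpair) (Y : topologicalType) (k : nat).
Variable rho : forall M, cochain R (cpT C) (k + M) -> cochain R Y M -> Prop.
Hypothesis H : @is_corr R k C (fullc Y) rho.
Local Notation coch N := (cochain R (cpT C) N).
Local Notation cocy f := (rcocycle (cpP C) (cpQ C) f).
Local Notation cobo f := (rcobound (cpP C) (cpQ C) f).

Definition link N a (y : coch N) (w : vcoh R Y a) : Prop :=
  forall M (e : N = (k + M)%N),
    exists2 v, rep w v & rho (eq_rect N (cochain R (cpT C)) y _ e) v.

Variables (N : nat) (a : int).
Hypothesis deg : a + k%:Z = N%:Z.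

Lemma link_l (y : coch N) : cocy y -> exists w, link (a := a) y w.
Proof.
move=> hy; have [kN|Nk] := leqP k N; last by exists 0 => M e; lia.
have [M e] : exists M, N = (k + M)%N by exists (N - k)%N; lia.
subst N; have [v hv] := corr_l H hy; have [_ zv] := corrZ H hv.
have [|w hw] := @rep_of R Y a M v _ zv; first by lia.
exists w => M' e; have eM : M = M' by lia.
by subst M'; rewrite (Prop_irrelevance e erefl); exists v.
Qed.

Lemma link_r (w : vcoh R Y a) : exists2 y, cocy y & link (N := N) y w.
Proof.
have [kN|Nk] := leqP k N; last by exists 0; [exact: rcocycle0|move=> M e; lia].
have [M e] : exists M, N = (k + M)%N by exists (N - k)%N; lia.
subst N; have [|v hv] := @rep_ex R Y a w M; first by lia.
have [y hy] := corr_r H (rep_cocycle hv); have [zy _] := corrZ H hy.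
exists y => // M' e; have eM : M = M' by lia.
by subst M'; rewrite (Prop_irrelevance e erefl); exists v.
Qed.

Lemma linkD (y y' : coch N) (w w' : vcoh R Y a) :
  link y w -> link y' w' -> link (y + y') (w + w').
Proof.
move=> h h' M e; have [v hv1 hv2] := h M e; have [v' hv1' hv2'] := h' M e.
exists (v + v'); first exact: repD.
by subst N; exact: (corrD H).
Qed.

Lemma link_eq0 (y : coch N) (w : vcoh R Y a) : cocy y -> link y w ->
  (w = 0 <-> cobo y).
Proof.
move=> hy h; have [kN|Nk] := leqP k N; last first.
  by split=> _; [exact: (corr_low H)|apply: vcoh_neg; lia].
have [M e] : exists M, N = (k + M)%N by exists (N - k)%N; lia.
have [v /rep_eq0 -> hv2] := h M e; subst N.
exact: iff_sym (corrB H hv2).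
Qed.

Lemma link_sq (y : coch N) (w : vcoh R Y a) n b : cocy y -> link y w ->
  b + k%:Z = n%:Z -> link (cup y y : coch n) (vcoh_sq R Y a b w).
Proof.
move=> hy h deg' M' e'; have [kN|Nk] := leqP k N.
  have [M e] : exists M, N = (k + M)%N by exists (N - k)%N; lia.
  have [v hv1 hv2] := h M e; exists (cup v v).
    by apply: rep_sq => //; lia.
  by subst N; subst n; exact: (corr_sq H).
(* Here [w] has negative degree, but the target degree [b] need not be negative: [y] is a
   coboundary, so its square is one, and what that square represents is 0. *)
have w0 : w = 0 by apply: vcoh_neg; lia.
have By : cobo y by apply/(link_eq0 hy h).
subst n; have hyy := rcocycle_sq (k + M') hy.
have [v hv] := corr_l H hyy; have [_ zv] := corrZ H hv.
have [|x hx] := @rep_of R Y b M' v _ zv; first by lia.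
exists v => //; suff <- : x = vcoh_sq R Y a b w by [].
rewrite w0 linear0; apply/(rep_eq0 hx)/(corrB H hv).
exact: rcobound_sq.
Qed.

End Link.

Definition castlin (M : steenrodModule) (a b : int) (h : a = b) : {linear M a -> M b} :=
  match h with erefl => idfun end.

Lemma castlin_bij (M : steenrodModule) (a b : int) (h : a = b) : bijective (castlin M h).
Proof. by case: b / h; exists idfun. Qed.

Lemma castlin_op (M : steenrodModule) (a b a' b' : int) (h : a = a') (h' : b = b') x :
  castlin M h' (stm_op M a b x) = stm_op M a' b' (castlin M h x).
Proof. by case: a' / h; case: b' / h'. Qed.

Lemma iter_suspension (k : nat) (M : steenrodModule) :
  exists e : forall n : int, {linear iter k suspension M n -> M (n - k%:Z)},
    (forall n, bijective (e n)) /\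
    (forall a b x, e b (stm_op _ a b x) = stm_op _ _ _ (e a x)).
Proof.
elim: k => [|k [e [be ce]]].
  have h (n : int) : n = n - 0%:Z by rewrite subr0.
  exists (fun n => castlin M (h n)); split=> [n|a b x]; first exact: castlin_bij.
  exact: castlin_op.
have h (n : int) : n - 1 - k%:Z = n - k.+1%:Z by lia.
exists (fun n => castlin M (h n) \o e (n - 1)); split=> [n|a b x] /=.
  by apply: bij_comp; [exact: castlin_bij|exact: be].
by rewrite ce castlin_op.
Qed.

Lemma inj_surj_bij (T U : Type) (f : T -> U) :
  (forall x y, f x = f y -> x = y) -> (forall u, exists x, f x = u) -> bijective f.
Proof.
move=> inj /choice[g hg]; exists g => // x; apply: inj; exact: hg.
Qed.

(** * From correspondences to an isomorphism of Steenrod modules *)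

Section Assembly.
Variables (R : realType) (X : topologicalType) (I : finType).
Variables (D : I -> cpair) (k : I -> nat) (Y : I -> topologicalType).
Hypothesis hc : forall i, corr R (k i) (D i) (fullc (Y i)).
Local Notation cocy i f := (rcocycle (cpP (D i)) (cpQ (D i)) f).
Local Notation cobo i f := (rcobound (cpP (D i)) (cpQ (D i)) f).
Local Notation ZX f := (rcocycle (cpP (fullc X)) (cpQ (fullc X)) f).
Local Notation BX f := (rcobound (cpP (fullc X)) (cpQ (fullc X)) f).

Variable r : forall N, cochain R X N -> (forall i, cochain R (cpT (D i)) N) -> Prop.
Hypothesis rZ : forall N f y, @r N f y -> ZX f /\ forall i, cocy i (y i).
Hypothesis r_l : forall N f, ZX f -> exists y, @r N f y.
Hypothesis r_r : forall N y, (forall i, cocy i (y i)) -> exists f, @r N f y.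
Hypothesis rD : forall N f f' y y', @r N f y -> @r N f' y' ->
  @r N (f + f') (fun i => y i + y' i).
Hypothesis rB : forall N f y, @r N f y -> (BX f <-> forall i, cobo i (y i)).
Hypothesis r_sq : forall N n f y, @r N f y ->
  @r n (cup f f) (fun i => cup (y i) (y i)).

Let rho i := projT1 (cid (hc i)).
Let hrho i : @is_corr R (k i) (D i) (fullc (Y i)) (@rho i) := projT2 (cid (hc i)).
Let E i := projT1 (cid (iter_suspension (k i) (reduced_cohomology R (Y i)))).
Let hE i := projT2 (cid (iter_suspension (k i) (reduced_cohomology R (Y i)))).
Local Notation L := (steenrod_sum (fun i => iter (k i) suspension (reduced_cohomology R (Y i)))).

(** Void for [n + 1 < 0], where both modules vanish; in the other degrees it is meant to be the
    graph of the isomorphism. *)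
Let Phi (n : int) (x : reduced_cohomology R X n) (w : L n) : Prop :=
  forall N, Posz N = n + 1 -> exists f y,
    [/\ rep (x : vcoh R X (n + 1)) f, @r N f y &
        forall i, link (@rho i) (a := n - (k i)%:Z + 1) (y i) (E i n (w i))].

Let degE (n : int) i N : Posz N = n + 1 -> (n - (k i)%:Z + 1) + (k i)%:Z = N%:Z.
Proof. by move=> ->; lia. Qed.

Let vneg (n : int) (x : reduced_cohomology R X n) : (n + 1 < 0)%R -> x = 0.
Proof. exact: vcoh_neg. Qed.

Let E_inj n i (w : iter (k i) suspension (reduced_cohomology R (Y i)) n) :
  E i n w = 0 -> w = 0.
Proof.
have [/(_ n) /bij_inj inj _] := hE i => h; apply: inj.
by rewrite [LHS]h linear0.
Qed.

Let wneg (n : int) (w : L n) : (n + 1 < 0)%R -> w = 0.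
Proof.
move=> h; apply: functional_extensionality_dep => i; apply: E_inj.
apply: vcoh_neg; lia.
Qed.

Let nonneg (n : int) : (n + 1 < 0)%R \/ exists N, Posz N = n + 1.
Proof. by case: (n + 1) => [N|N]; [right; exists N|left]. Qed.

Let Phi_l n x : exists w, @Phi n x w.
Proof.
have [neg|[N hN]] := nonneg n; first by exists 0 => N hN; lia.
have [f hf] := rep_ex (x : vcoh R X (n + 1)) hN.
have [y hy] := r_l (rep_cocycle hf); have [_ zy] := rZ hy.
have h i : exists w, link (@rho i) (a := n - (k i)%:Z + 1) (y i) (E i n w).
  have [w hw] := link_l (hrho i) (degE i hN) (zy i).
  have [/(_ n) [g _ gK] _] := hE i.
  by exists (g w); rewrite [E i n _]gK.
exists (fun i => projT1 (cid (h i))) => N' hN'.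
have eN : N = N' by lia.
subst N'; exists f, y; split=> // i; exact: projT2 (cid (h i)).
Qed.

Let PhiD n x w x' w' : @Phi n x w -> @Phi n x' w' -> @Phi n (x + x') (w + w').
Proof.
move=> h h' N hN; have [f [y [h1 h2 h3]]] := h N hN.
have [f' [y' [h1' h2' h3']]] := h' N hN.
exists (f + f'), (fun i => y i + y' i); split; [exact: repD|exact: rD|].
by move=> i; rewrite [E i n _]linearD; exact (linkD (hrho i) (degE i hN) (h3 i) (h3' i)).
Qed.

Let Phi_eq0 n x w : @Phi n x w -> (x = 0 <-> w = 0).
Proof.
move=> h; have [neg|[N hN]] := nonneg n.
  by split=> _; [exact: wneg|exact: vneg].
have [f [y [h1 h2 h3]]] := h N hN; have [_ zy] := rZ h2.
rewrite (iff_trans (rep_eq0 h1) (rB h2)); split=> [hy|w0 i].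
  apply: functional_extensionality_dep => i; apply: E_inj.
  by apply/(link_eq0 (hrho i) (degE i hN) (zy i) (h3 i)).
apply/(link_eq0 (hrho i) (degE i hN) (zy i) (h3 i)).
by rewrite w0 [LHS]linear0.
Qed.

Let Phi_r n w : exists x, @Phi n x w.
Proof.
have [neg|[N hN]] := nonneg n; first by exists 0 => N hN; lia.
have h i := cid2 (link_r (hrho i) (degE i hN) (E i n (w i))).
pose y i := s2val (h i).
have [f hf] := r_r (fun i => s2valP (h i) : cocy i (y i)).
have [zf _] := rZ hf; have [x hx] := rep_of hN zf.
exists x => N' hN'; have eN : N = N' by lia.
subst N'; exists f, y; split=> // i; exact: s2valP' (h i).
Qed.

Let Phi_sq n m x w : @Phi n x w ->
  @Phi m (stm_op (reduced_cohomology R X) n m x) (stm_op L n m w).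
Proof.
move=> h N' hN'; have [neg|[N hN]] := nonneg n.
  (* The source degree is too low for representatives, though the target degree is not. Both
     operations give 0 there, so representatives of the zero elements in degree [m] suffice. *)
  have [f [y [h1 h2 h3]]] : exists f y, [/\ rep (0 : vcoh R X (m + 1)) f, @r N' f y &
      forall i, link (@rho i) (a := m - (k i)%:Z + 1) (y i) (E i m ((0 : L m) i))].
    have [w0 hw0] := @Phi_l m 0; have := hw0; rewrite (proj1 (Phi_eq0 hw0) erefl).
    by move=> /(_ N' hN').
  exists f, y; split=> //; first by rewrite (vneg x neg) linear0.
  by move=> i; rewrite (wneg w neg) linear0.
have [f [y [h1 h2 h3]]] := h N hN; have [_ zy] := rZ h2.
exists (cup f f), (fun i => cup (y i) (y i)); split.
- exact: rep_sq h1 _.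
- exact: r_sq.
- move=> i; have [_ cE] := hE i.
  rewrite [E i m _](cE n m (w i)).
  exact: (link_sq (hrho i) (degE i hN) (zy i) (h3 i) (degE i hN')).
Qed.

Lemma steenrod_iso_assembly : steenrod_iso (reduced_cohomology R X) L.
Proof.
have hphi n : exists f : {linear reduced_cohomology R X n -> L n}, forall x, Phi x (f x).
  apply: linear_of_rel; [exact: Phi_l|exact: PhiD|].
  by move=> w /Phi_eq0 [h _]; exact: h.
pose phi n := projT1 (cid (hphi n)).
have hp n : forall x, Phi x (phi n x) := projT2 (cid (hphi n)).
have uniq n x w w' : @Phi n x w -> @Phi n x w' -> w = w'.
  move=> h h'; have := PhiD h h'; rewrite lmodF2_add => /Phi_eq0 [/(_ erefl) e _].
  by apply: (addIr w'); rewrite e lmodF2_add.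
exists phi; split=> [n|d n x]; last first.
  by apply: (uniq _ (Sq d x)); [exact: hp|apply: Phi_sq; exact: hp].
apply: inj_surj_bij => [x y e|w]; last first.
  by have [x hx] := Phi_r w; exists x; apply: uniq (hp n x) hx.
apply: (addIr y); rewrite lmodF2_add; have := hp n (x + y).
by rewrite linearD e lmodF2_add => /Phi_eq0 [_ h]; exact: h.
Qed.

End Assembly.

Theorem proposition4p1p1 (R : realType) (m : nat) (K : {set {set 'I_m}})
    (hK : simplicial_complex K) :
  steenrod_iso
    (reduced_cohomology R (moment_angle R K))
    (steenrod_sum (fun J : {J : {set 'I_m} | J \notin K} =>
       iter (#|val J| + 1) suspension
         (reduced_cohomology R (realization R (full_subcomplex K (val J)))))).
Proof.
have [q [qZ ql qr qD qB qs _]] := corr_sym (corr_subspace R (@moment_angle_set R m K)).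
pose D (i : {J : {set 'I_m} | J \notin K}) := stage R K (val i) finset.set0.
apply: (@steenrod_iso_assembly R (moment_angle R K) _ D
  (fun i => (#|val i| + 1)%N) (fun i => realization R (full_subcomplex K (val i))) _
  (fun N f y => exists2 x, q N f x & decomp x y)).
- by move=> i; apply: stage_realization => //; exact: (valP i).
- by move=> N f y [x /qZ[? _] []].
- move=> N f zf; have [x hx] := ql N f zf; have [_ zx] := qZ _ _ _ hx.
  by have [y hy] := decomp_l zx; exists y, x.
- move=> N y /decomp_r [x hx]; have [zx _ _] := hx.
  by have [f hf] := qr N x zx; exists f, x.
- move=> N f f' y y' [x h1 h2] [x' h1' h2']; exists (x + x'); first exact: qD h1 h1'.
  exact: decompD.
- move=> N f y [x h1 h2]; exact: iff_trans (qB _ _ _ h1) (decompB h2).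
- move=> N n f y [x h1 h2]; exists (cup x x); [exact: qs h1|exact: decomp_sq].
Qed.
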